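(* For any $\alpha\in(0,1]$, the global flow on the (regularized) parabolic manifold $\mathscr P$ of the dihedral planar four-body problem is described by the following relationships among stable and unstable manifolds on $\mathscr P$: 1. $W^u(\boldsymbol c_-)\subset W^s(0)\cup W^s(\pi/2)$; 2. $W^u(\epsilon\pi/2)\cap W^s(\sigma\pi/2)$ is an open set for $\epsilon,\sigma\in\{0,1\}$. Here $\boldsymbol c_-$ is the equilibrium at the planar central configuration corresponding to the negative value of $v$.
   Context: Let $\alpha\in(0,2)$, $\beta=\alpha/2$. The planar subproblem of the dihedral four-body problem (four equal masses at the vertices of a rectangle) has shape coordinate $\theta\in[0,\pi/2]$, with binary collisions at $\theta=0$ and $\theta=\pi/2$, and potential $U(\theta)=2^{-\alpha}\big(1+\sin^{-\alpha}\theta+\cos^{-\alpha}\theta\big)$. In McGehee variables $(v,\theta,w)$ on the (unregularized) parabolic manifold $v^2+w^2=2U(\theta)$ the flow is $v'=w^2+\beta(v^2-2U(\theta))$, $\theta'=w$, $w'=(\beta-1)vw+U'(\theta)$; equivalently, along orbits, $dv/d\theta=\pm(1-\beta)\sqrt{2U(\theta)-v^2}$ with sign $+$ where $w>0$ and $-$ where $w<0$. Regularization: put $W(\theta)=\sin^\alpha(2\theta)\,U(\theta)=\sin^\alpha\theta\cos^\alpha\theta+\sin^\alpha\theta+\cos^\alpha\theta$, $u=\sin^\alpha(2\theta)\,w/\sqrt{W(\theta)}$, $d/d\sigma=\big(\sin^\alpha(2\theta)/\sqrt{W(\theta)}\big)\,d/d\tau$, where $\tau$ is the old time. The regularized parabolic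 manifold is $\mathscr P=\{(\theta,v,u):\theta\in[0,\pi/2],\ v\in\mathbb R,\ u^2+v^2\sin^{2\alpha}(2\theta)/W(\theta)=2\sin^\alpha(2\theta)\}$, and in the time $\sigma$ the flow satisfies $\theta'=u$, $v'=(1-\beta)\sqrt{W(\theta)}\,\big[2-v^2\sin^\alpha(2\theta)/W(\theta)\big]$. An orbit reaching a binary collision $\theta\in\{0,\pi/2\}$ at a finite value of $v$ (where $u=0$) is continued through it with the same $v$ and with $u$ changing sign. The function $v$ is strictly increasing along non-equilibrium orbits. The only equilibria are $\boldsymbol c_\pm=(\theta,v,u)=(\pi/4,\pm\sqrt{2U(\pi/4)},0)$ (the planar central configuration), and they are saddles. For $\theta_0\in\{0,\pi/2\}$, $W^s(\theta_0)$ (resp. $W^u(\theta_0)$) denotes the set of points of $\mathscr P$ whose forward (resp. backward) orbit runs out along the upper (resp. lower) arm of binary collision at $\theta=\theta_0$, i.e. $v\to+\infty$ in forward time (resp. $v\to-\infty$ in backward time) with $\theta\to\theta_0$. $W^u(\boldsymbol c_-)$ is understood as its two branches (the equilibrium itself being excluded). *)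

(* Defs.v *)
From Stdlib Require Import Reals.
From Coquelicot Require Import Coquelicot.
Open Scope R_scope.

(* Real power x^a of a base x >= 0 and exponent a > 0, with 0^a = 0.
   The library's Rpower is unsuitable at the binary collisions, because
   Rpower 0 a = 1. *)
Definition rpow (x a : R) : R :=
  if Rlt_dec 0 x then Rpower x a else 0.

(* The potential; meaningful only for 0 < th < PI/2. *)
Definition U (alpha th : R) : R :=
  Rpower 2 (- alpha) *
    (1 + Rpower (sin th) (- alpha) + Rpower (cos th) (- alpha)).

(* W = sin^alpha(2 th) * U(th), in the form that extends to the collisions. *)
Definition W (alpha th : R) : R :=
  rpow (sin th) alpha * rpow (cos th) alpha
    + rpow (sin th) alpha + rpow (cos th) alpha.

Definition collision (th : R) : Prop := th = 0 \/ th = PI / 2.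

(* Points of phase space are triples (th, v, u). *)
Definition parabolic_manifold (alpha : R) (p : R * R * R) : Prop :=
  let '(th, v, u) := p in
  0 <= th <= PI / 2 /\
  u ^ 2 + v ^ 2 * rpow (sin (2 * th)) (2 * alpha) / W alpha th
    = 2 * rpow (sin (2 * th)) alpha.

(* The unregularized velocity w, from u = sin^alpha(2 th) * w / sqrt W;
   meaningful only off the collisions. *)
Definition velocity (alpha th u : R) : R :=
  u * sqrt (W alpha th) / rpow (sin (2 * th)) alpha.

(* A complete orbit s |-> (th s, v s, u s) in the regularized time s.
   - The equations for th and v alone do not determine the motion: they also
     admit a curve resting at a non-equilibrium point with u = 0.  Off the
     collisions the original equation w' = (beta - 1) v w + U'(th), rescaled to
     the time s, is therefore required as well.
   - At a collision, where u = 0, the orbit continues with the same v (v is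
     continuous, being differentiable) and u changes sign; this excludes the
     curves that stay on the lines th = 0 and th = PI/2. *)
Definition is_orbit (alpha : R) (th v u : R -> R) : Prop :=
  let beta := alpha / 2 in
  forall s : R,
    parabolic_manifold alpha (th s, v s, u s) /\
    is_derive th s (u s) /\
    is_derive v s
      ((1 - beta) * sqrt (W alpha (th s)) *
         (2 - v s ^ 2 * rpow (sin (2 * th s)) alpha / W alpha (th s))) /\
    (~ collision (th s) ->
       is_derive (fun t => velocity alpha (th t) (u t)) s
         (rpow (sin (2 * th s)) alpha / sqrt (W alpha (th s)) *
            ((beta - 1) * v s * velocity alpha (th s) (u s)
               + Derive (U alpha) (th s)))) /\
    (collision (th s) ->
       at_right 0 (fun h => u (s - h) * u (s + h) < 0)).

Definition orbit_through (alpha : R) (p : R * R * R) (th v u : R -> R) : Prop :=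
  is_orbit alpha th v u /\ (th 0, v 0, u 0) = p.

(* W^s(th0), for th0 = 0 or th0 = PI/2. *)
Definition Ws (alpha th0 : R) (p : R * R * R) : Prop :=
  exists th v u : R -> R,
    orbit_through alpha p th v u /\
    is_lim v p_infty p_infty /\ is_lim th p_infty th0.

(* W^u(th0), for th0 = 0 or th0 = PI/2. *)
Definition Wu (alpha th0 : R) (p : R * R * R) : Prop :=
  exists th v u : R -> R,
    orbit_through alpha p th v u /\
    is_lim v m_infty m_infty /\ is_lim th m_infty th0.

Definition c_minus (alpha : R) : R * R * R :=
  (PI / 4, - sqrt (2 * U alpha (PI / 4)), 0).

(* The two branches of the unstable manifold of c_minus, without c_minus. *)
Definition Wu_c_minus (alpha : R) (p : R * R * R) : Prop :=
  p <> c_minus alpha /\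
  exists th v u : R -> R,
    orbit_through alpha p th v u /\
    filterlim (fun s => (th s, v s, u s)) (Rbar_locally m_infty)
      (locally (c_minus alpha)).

(* A is a subset of M that is open in the topology induced on M. *)
Definition open_in (M A : R * R * R -> Prop) : Prop :=
  exists O : R * R * R -> Prop,
    open O /\ forall p, A p <-> M p /\ O p.

(* Main.v *)
Require Import Defs.
From Stdlib Require Import Reals Lra Psatz ZArith ClassicalEpsilon Ranalysis5.
From Coquelicot Require Import Coquelicot.
From Corelib Require Import ssreflect.
Open Scope R_scope.
Unset SsrRewrite.
Open Scope general_if_scope.

(** Write [c = sqrt (2 U (PI / 4))], so that the equilibria are at [v = - c] and
    [v = c], and [k = 1 - alpha / 2]. Since [v ^ 2 <= 2 U], the manifold splits
    above the level [v = c] into the two arms around [th = 0] and [th = PI / 2].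
    An orbit that gets above this level therefore stays on its side; it cannot
    keep [v] bounded, because by Barbalat's lemma it would then converge to an
    equilibrium ([bounded_limit]); and so it escapes along its arm ([escape_0],
    [escape_PI2]).

    An unstable branch of [c_-] can thus fail to escape only by converging to
    [c_+] ([no_connection]). To exclude this, consider the instant where such a
    branch has [v = 0]. The claim is that [u (th - PI / 4) > 0] then. As the flow
    is reversible under [(th, v, u) -> (th, - v, - u)], a connecting orbit run
    backwards is again an unstable branch of [c_-]; it crosses [v = 0] at the
    same [th] with the opposite [u], against the claim.

    The claim ([crossing_sign]) is proved with explicit barriers; by reflection
    the branch may be assumed to leave [c_-] with [th] increasing. With
    [S = sin^(-alpha) + cos^(-alpha)] and [m = S (PI / 4)] (below, [sep] and
    [sep_min], while [c] is [vc]) one has [2 U = c^2 (1 + S) / (1 + m)]. If this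
    is replaced by the larger [c^2 S / m], the equation
    [dv/dth = +- k sqrt (2 U - v^2)] has the solutions
    [v = - kappa (sin^k th + cos^k th)] with [th] increasing from [c_-] to the
    collision at [PI / 2], and [v = - kappa (sin^k th - cos^k th)] on the way
    back, where [kappa = c / sqrt m]. The height of the branch above [v = - c] is
    at most that of this explicit solution, and at least [m / (1 + m)] times it.
    The upper bound puts the first collision before the instant where [v = 0],
    the lower bound puts the second collision after it, and the upper bound on
    the way back puts that instant at [th < PI / 4], while [u < 0].

    For the second assertion, the stable set of an arm is open because being on
    the arm above [v = c] is an open condition, which is carried back along the
    orbit by continuous dependence ([captured_along]); unstable sets are the
    reversed stable sets. Two facts about the flow are needed: every point of the
    manifold has a complete orbit ([complete_orbit]), and orbits depend
    continuously on their starting point ([dependence]). Away from collisions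
    both are the classical theorems for [(th, v, w)]. At the collision [th = 0]
    the equations are not Lipschitz. Existence uses the coordinate [+- tan^k th],
    which changes sign at the collision and moves with nonzero speed; continuous
    dependence comes from comparing two orbits at equal angles, since as a
    function of the angle [v] obeys an equation that is Lipschitz in [v]. *)

(** * Calculus on the line *)

Lemma continuous_of_derive (f : R -> R) (x l : R) :
  is_derive f x l -> continuous f x.
Proof.
  intros H. apply (ex_derive_continuous f x). now exists l.
Qed.

Lemma derive_mult (f g : R -> R) (x lf lg l : R) :
  is_derive f x lf -> is_derive g x lg -> l = lf * g x + f x * lg ->
  is_derive (fun y => f y * g y) x l.
Proof.
  intros Hf Hg ->. apply is_derive_Reals.
  apply (derivable_pt_lim_mult f g); now apply is_derive_Reals.
Qed.

Lemma derive_plus (f g : R -> R) (x lf lg l : R) :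
  is_derive f x lf -> is_derive g x lg -> l = lf + lg ->
  is_derive (fun y => f y + g y) x l.
Proof. intros Hf Hg ->. now apply: is_derive_plus. Qed.

Lemma derive_minus (f g : R -> R) (x lf lg l : R) :
  is_derive f x lf -> is_derive g x lg -> l = lf - lg ->
  is_derive (fun y => f y - g y) x l.
Proof. intros Hf Hg ->. now apply: is_derive_minus. Qed.

Lemma derive_comp (f g : R -> R) (x lf lg l : R) :
  is_derive f (g x) lf -> is_derive g x lg -> l = lf * lg ->
  is_derive (fun y => f (g y)) x l.
Proof.
  intros Hf Hg ->. rewrite Rmult_comm. now apply: is_derive_comp.
Qed.

Lemma derive_scal (f : R -> R) (c x lf l : R) :
  is_derive f x lf -> l = c * lf -> is_derive (fun y => c * f y) x l.
Proof. intros Hf ->. now apply: is_derive_scal. Qed.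

Lemma derive_eq (f : R -> R) (x l l' : R) :
  is_derive f x l -> l = l' -> is_derive f x l'.
Proof. now intros H <-. Qed.

Lemma derive_sq (f : R -> R) (x lf l : R) :
  is_derive f x lf -> l = 2 * f x * lf -> is_derive (fun y => f y ^ 2) x l.
Proof.
  intros Hf ->. apply (derive_comp (fun z => z ^ 2) f x (2 * f x) lf); trivial.
  auto_derive; trivial; simpl; ring.
Qed.

Lemma derive_sqrt (f : R -> R) (x lf l : R) :
  is_derive f x lf -> 0 < f x -> l = lf / (2 * sqrt (f x)) ->
  is_derive (fun y => sqrt (f y)) x l.
Proof.
  intros Hf Hp ->. apply (derive_comp sqrt f x (/ (2 * sqrt (f x))) lf); trivial.
  - now apply is_derive_Reals, derivable_pt_lim_sqrt.
  - unfold Rdiv; ring.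
Qed.

(** Differentiability is not asked at the end points, since the functions to
    which this is applied are only continuous at collisions. *)
Lemma mvt_open (f : R -> R) (a b : R) :
  a < b -> (forall x, a <= x <= b -> continuous f x) ->
  (forall x, a < x < b -> ex_derive f x) ->
  exists c, a < c < b /\ f b - f a = Derive f c * (b - a).
Proof.
  intros Hab Hc Hd.
  assert (pr1 : forall c, a < c < b -> derivable_pt f c).
  { intros c Hcc. exists (Derive f c). apply is_derive_Reals.
    apply Derive_correct. now apply Hd. }
  assert (pr2 : forall c, a < c < b -> derivable_pt id c).
  { intros c Hcc. apply derivable_pt_id. }
  destruct (MVT f id a b pr1 pr2 Hab) as [c [P HP]].
  - intros c Hcc. apply continuity_pt_filterlim. now apply Hc.
  - intros c Hcc. apply derivable_continuous_pt, derivable_pt_id.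
  - exists c. split; [exact P|].
    rewrite (derive_pt_eq_0 f c (Derive f c) (pr1 c P)) in HP.
    2: apply is_derive_Reals, Derive_correct, Hd; exact P.
    rewrite (derive_pt_eq_0 id c 1 (pr2 c P)) in HP.
    2: apply derivable_pt_lim_id.
    unfold id in HP. lra.
Qed.

Lemma mono_le (f : R -> R) (a b : R) :
  a <= b -> (forall x, a <= x <= b -> continuous f x) ->
  (forall x, a < x < b -> exists l : R, is_derive f x l /\ 0 <= l) ->
  f a <= f b.
Proof.
  intros Hab Hc Hd.
  destruct (Req_dec a b) as [->|Hne]; [lra|].
  destruct (mvt_open f a b) as [c [Hc1 Hc2]]; try assumption; [lra| |].
  - intros x Hx. destruct (Hd x Hx) as [l [Hl _]]. now exists l.
  - destruct (Hd c Hc1) as [l [Hl Hl0]].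
    apply is_derive_unique in Hl. rewrite Hl in Hc2. nra.
Qed.

Lemma mono_lt (f : R -> R) (a b : R) :
  a < b -> (forall x, a <= x <= b -> continuous f x) ->
  (forall x, a < x < b -> exists l : R, is_derive f x l /\ 0 < l) ->
  f a < f b.
Proof.
  intros Hab Hc Hd.
  destruct (mvt_open f a b) as [c [Hc1 Hc2]]; try assumption.
  - intros x Hx. destruct (Hd x Hx) as [l [Hl _]]. now exists l.
  - destruct (Hd c Hc1) as [l [Hl Hl0]].
    apply is_derive_unique in Hl. rewrite Hl in Hc2. nra.
Qed.

Lemma mono_ge (f : R -> R) (a b : R) :
  a <= b -> (forall x, a <= x <= b -> continuous f x) ->
  (forall x, a < x < b -> exists l : R, is_derive f x l /\ l <= 0) ->
  f b <= f a.
Proof.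
  intros Hab Hc Hd.
  cut (- f a <= - f b); [lra|].
  apply (mono_le (fun x => - f x)); trivial.
  - intros x Hx. apply: continuous_opp. now apply Hc.
  - intros x Hx. destruct (Hd x Hx) as [l [Hl Hl0]]. exists (- l).
    split; [|lra]. now apply: is_derive_opp.
Qed.

Lemma growth_le (f : R -> R) (M a b : R) :
  a <= b -> (forall x, a <= x <= b -> continuous f x) ->
  (forall x, a < x < b -> exists l : R, is_derive f x l /\ l <= M) ->
  f b - f a <= M * (b - a).
Proof.
  intros Hab Hc Hd.
  cut (f b - M * b <= f a - M * a); [lra|].
  apply (mono_ge (fun x => f x - M * x)); trivial.
  - intros x Hx. apply: continuous_minus; [now apply Hc|].
    apply: continuous_scal; [apply: continuous_const|apply: continuous_id].
  - intros x Hx. destruct (Hd x Hx) as [l [Hl Hl0]]. exists (l - M).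
    split; [|lra]. apply: is_derive_minus; [exact Hl|].
    auto_derive; trivial; ring.
Qed.

Lemma lipschitz_of_derive (f : R -> R) (M a b : R) :
  a <= b -> (forall x, a <= x <= b -> continuous f x) ->
  (forall x, a < x < b -> exists l : R, is_derive f x l /\ Rabs l <= M) ->
  Rabs (f b - f a) <= M * (b - a).
Proof.
  intros Hab Hc Hd. apply Rabs_le. split.
  - cut (- f b - - f a <= M * (b - a)); [lra|].
    apply (growth_le (fun x => - f x)); trivial.
    + intros x Hx. apply: continuous_opp. now apply Hc.
    + intros x Hx. destruct (Hd x Hx) as [l [Hl Hl0]]. exists (- l).
      split; [now apply: is_derive_opp|]. apply Rabs_le_between in Hl0. lra.
  - apply growth_le; trivial.
    intros x Hx. destruct (Hd x Hx) as [l [Hl Hl0]]. exists l.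
    split; [exact Hl|]. apply Rabs_le_between in Hl0. lra.
Qed.

Lemma Rabs_lt_of_sq (x e : R) : 0 < e -> x ^ 2 < e ^ 2 -> Rabs x < e.
Proof.
  intros He H. rewrite <- (pow2_abs x) in H. assert (P := Rabs_pos x).
  apply Rnot_le_lt. intros K. nra.
Qed.

(** The square of [f] times [exp (- 2 C (x - a))] does not increase. *)
Lemma gronwall (f : R -> R) (C a b : R) :
  a <= b -> (forall x, a <= x <= b -> continuous f x) ->
  (forall x, a < x < b -> exists l : R, is_derive f x l /\ Rabs l <= C * Rabs (f x)) ->
  Rabs (f b) <= Rabs (f a) * exp (C * (b - a)).
Proof.
  intros Hab Hc Hd.
  assert (H : f b ^ 2 * exp (- (2 * C * (b - a))) <= f a ^ 2 * exp (- (2 * C * (a - a)))).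
  { apply (mono_ge (fun x => f x ^ 2 * exp (- (2 * C * (x - a))))); trivial.
    - intros x Hx. apply: continuous_mult.
      + apply: (continuous_comp f (fun y => y ^ 2)); [now apply Hc|].
        apply: (continuous_of_derive _ _ (2 * f x)). auto_derive; trivial. ring.
      + apply (ex_derive_continuous (fun x : R => exp (- (2 * C * (x - a)))) x).
        auto_derive; trivial.
    - intros x Hx. destruct (Hd x Hx) as [l [Hl Hl0]].
      exists ((2 * f x * l - 2 * C * f x ^ 2) * exp (- (2 * C * (x - a)))).
      split.
      + eapply derive_mult; [apply (derive_sq f x l); [exact Hl|reflexivity]| |].
        * instantiate (1 := - (2 * C) * exp (- (2 * C * (x - a)))).
          auto_derive; trivial; simpl; unfold Rminus; ring.
        * simpl; ring.
      + assert (0 < exp (- (2 * C * (x - a)))) by apply exp_pos.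
        assert (f x * l <= C * f x ^ 2).
        { replace (C * f x ^ 2) with (Rabs (f x) * (C * Rabs (f x))).
          2:{ rewrite <- (pow2_abs (f x)). ring. }
          apply Rle_trans with (Rabs (f x * l)); [apply Rle_abs|].
          rewrite Rabs_mult. apply Rmult_le_compat_l; [apply Rabs_pos|exact Hl0]. }
        nra. }
  replace (a - a) with 0 in H by ring.
  rewrite Rmult_0_r, Ropp_0, exp_0, Rmult_1_r in H.
  apply Rsqr_incr_0.
  2: apply Rabs_pos.
  2:{ apply Rmult_le_pos; [apply Rabs_pos|left; apply exp_pos]. }
  unfold Rsqr.
  replace (Rabs (f b) * Rabs (f b)) with (f b ^ 2) by (rewrite <- (pow2_abs (f b)); ring).
  replace (Rabs (f a) * exp (C * (b - a)) * (Rabs (f a) * exp (C * (b - a))))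
    with (f a ^ 2 * (exp (C * (b - a)) * exp (C * (b - a))))
    by (rewrite <- (pow2_abs (f a)); ring).
  rewrite <- exp_plus.
  replace (C * (b - a) + C * (b - a)) with (2 * C * (b - a)) by ring.
  rewrite exp_Ropp in H.
  assert (He : 0 < exp (2 * C * (b - a))) by apply exp_pos.
  apply (Rmult_le_compat_r (exp (2 * C * (b - a)))) in H; [|lra].
  unfold Rsqr in H. rewrite Rmult_assoc, Rinv_l, Rmult_1_r in H by lra.
  unfold pow in *. lra.
Qed.

Lemma derive_glue (f g : R -> R) (b l : R) :
  is_derive f b l -> is_derive g b l -> f b = g b ->
  is_derive (fun s => if Rle_dec s b then f s else g s) b l.
Proof.
  intros Hf Hg E. apply is_derive_Reals in Hf. apply is_derive_Reals in Hg.
  apply is_derive_Reals. intros eps He.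
  destruct (Hf eps He) as [d1 H1]. destruct (Hg eps He) as [d2 H2].
  assert (Hd : 0 < Rmin d1 d2) by (apply Rmin_pos; apply cond_pos).
  exists (mkposreal _ Hd). intros h Hh0 Hh. simpl in Hh.
  destruct (Rle_dec b b) as [_|]; [|lra].
  destruct (Rle_dec (b + h) b).
  - apply H1; trivial. apply Rlt_le_trans with (1 := Hh), Rmin_l.
  - rewrite E. apply H2; trivial. apply Rlt_le_trans with (1 := Hh), Rmin_r.
Qed.

(** By the mean value theorem. This gives the derivative of [th] at a collision,
    where the chain rule is not available. *)
Lemma derive_of_limit (f : R -> R) (b l r : R) :
  0 < r -> (forall x, Rabs (x - b) < r -> continuous f x) ->
  (forall eps, 0 < eps -> exists d, 0 < d /\
     forall x, x <> b -> Rabs (x - b) < d ->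
       exists m : R, is_derive f x m /\ Rabs (m - l) < eps) ->
  is_derive f b l.
Proof.
  intros Hr Hc Hd. apply is_derive_Reals. intros eps He.
  destruct (Hd eps He) as [d [Hd0 Hd1]].
  assert (Hm : 0 < Rmin d r) by (apply Rmin_pos; lra).
  exists (mkposreal _ Hm). intros h Hh0 Hh. simpl in Hh.
  assert (Hh1 := Rlt_le_trans _ _ _ Hh (Rmin_l _ _)).
  assert (Hh2 := Rlt_le_trans _ _ _ Hh (Rmin_r _ _)).
  assert (exists c, c <> b /\ Rabs (c - b) < d /\ f (b + h) - f b = Derive f c * h) as [c [Hc1 [Hc2 Hc3]]].
  { destruct (Rlt_dec 0 h).
    - rewrite Rabs_right in Hh1, Hh2 by lra.
      destruct (mvt_open f b (b + h)) as [c [Hc1 Hc2]]; [lra| | |].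
      + intros x Hx. apply Hc. apply Rabs_def1; lra.
      + intros x Hx. destruct (Hd1 x) as [m [Hm1 _]]; [lra|apply Rabs_def1; lra|].
        now exists m.
      + exists c. repeat split; [lra|apply Rabs_def1; lra|]. rewrite Hc2. ring.
    - rewrite Rabs_left in Hh1, Hh2 by lra.
      destruct (mvt_open f (b + h) b) as [c [Hc1 Hc2]]; [lra| | |].
      + intros x Hx. apply Hc. apply Rabs_def1; lra.
      + intros x Hx. destruct (Hd1 x) as [m [Hm1 _]]; [lra|apply Rabs_def1; lra|].
        now exists m.
      + exists c. repeat split; [lra|apply Rabs_def1; lra|]. lra. }
  rewrite Hc3. replace (Derive f c * h / h) with (Derive f c) by (field; lra).
  destruct (Hd1 c Hc1 Hc2) as [m [Hm1 Hm2]].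
  now rewrite (is_derive_unique _ _ _ Hm1).
Qed.

(** Barbalat's lemma: by uniform continuity a slope [eps] at a late time
    persists over an interval of fixed length, which adds a fixed amount to a
    function that has almost reached its supremum. *)
Lemma barbalat (f df : R -> R) (M : R) :
  (forall s, is_derive f s (df s)) -> (forall s, 0 <= df s) ->
  (forall s, f s <= M) ->
  (forall eps, 0 < eps -> exists d, 0 < d /\
     forall s t, 0 <= s -> 0 <= t -> Rabs (s - t) < d -> Rabs (df s - df t) < eps) ->
  forall eps, 0 < eps -> exists S, forall s, S < s -> df s < eps.
Proof.
  intros Hf Hp HM Hu eps He.
  assert (Hc : forall x, continuous f x) by (intros x; now apply (continuous_of_derive f x (df x))).
  assert (Hmono : forall a b, a <= b -> f a <= f b).
  { intros a b Hab. apply mono_le; trivial. intros x _. now exists (df x). }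
  destruct (completeness (fun y => exists s, y = f s)) as [L [HL1 HL2]].
  { exists M. intros y [s ->]. apply HM. }
  { now exists (f 0), 0. }
  destruct (Hu (eps / 2)) as [d [Hd Hd1]]; [lra|].
  assert (exists S, L - eps * d / 8 < f S) as [S HS].
  { apply NNPP. intros N. assert (L <= L - eps * d / 8).
    { apply HL2. intros y [s ->]. apply Rnot_lt_le. intros K. apply N. now exists s. }
    nra. }
  exists (Rmax S 0). intros s Hs'. assert (M1 := Rmax_l S 0). assert (M2 := Rmax_r S 0).
  assert (Hs : S < s) by lra. apply Rnot_le_lt. intros K.
  assert (f s + eps / 2 * (d / 2) <= f (s + d / 2)).
  { cut (f s - eps / 2 * s <= f (s + d / 2) - eps / 2 * (s + d / 2)); [nra|].
    apply (mono_le (fun x => f x - eps / 2 * x)); [lra| |].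
    - intros x _. apply: continuous_minus; [apply Hc|].
      apply (ex_derive_continuous (fun x => eps / 2 * x)). auto_derive; trivial.
    - intros x Hx. exists (df x - eps / 2). split.
      + eapply derive_minus; [apply Hf| |reflexivity]. auto_derive; trivial; ring.
      + assert (Rabs (df x - df s) < eps / 2).
        { apply Hd1; [lra|lra|]. rewrite Rabs_right; lra. }
        apply Rabs_def2 in H. lra. }
  assert (f S <= f s) by (apply Hmono; lra).
  assert (f (s + d / 2) <= L) by (apply HL1; now eexists).
  nra.
Qed.

(** Separation of variables: [Z] inverts the integral [G] of [/ f], which is
    onto because [f] is bounded. *)
Lemma autonomous_solution (f : R -> R) (m M z0 : R) :
  0 < m -> (forall z, m <= f z <= M) -> (forall z, continuous f z) ->
  exists Z : R -> R, Z 0 = z0 /\ forall s, is_derive Z s (f (Z s)).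
Proof.
  intros Hm Hf Hc.
  assert (Hfp : forall z, 0 < f z) by (intros z; specialize (Hf z); lra).
  assert (HMp : 0 < M) by (specialize (Hf 0); lra).
  assert (Hci : forall z, continuous (fun z => / f z) z).
  { intros z. apply (continuous_comp f Rinv); [apply Hc|].
    apply continuity_pt_filterlim, continuity_pt_inv; [apply continuity_pt_id|].
    unfold id. specialize (Hfp z). lra. }
  pose (G z := RInt (fun z => / f z) z0 z).
  assert (HG : forall z, is_derive G z (/ f z)).
  { intros z. apply (is_derive_RInt (fun z => / f z) G z0 z).
    - exists (mkposreal 1 Rlt_0_1). intros y _. apply: RInt_correct.
      apply: ex_RInt_continuous. intros; apply Hci.
    - apply Hci. }
  assert (HGc : forall z, continuous G z) by (intros z; now apply (continuous_of_derive G z (/ f z))).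
  assert (HG0 : G z0 = 0) by apply: RInt_point.
  assert (Hslope : forall a b, a <= b -> (b - a) / M <= G b - G a).
  { intros a b Hab. cut (G a - / M * a <= G b - / M * b); [unfold Rdiv; lra|].
    apply (mono_le (fun z => G z - / M * z)); trivial.
    - intros x _. apply: continuous_minus; [apply HGc|].
      apply (ex_derive_continuous (fun x => / M * x)). auto_derive; trivial.
    - intros x _. exists (/ f x - / M). split.
      + eapply derive_minus; [apply HG| |reflexivity]. auto_derive; trivial; ring.
      + assert (/ M <= / f x); [|lra]. apply Rinv_le_contravar; [apply Hfp|apply Hf]. }
  assert (Hsurj : forall s, exists z, G z = s).
  { intros s.
    assert (Hlo : G (z0 - M * Rabs s) <= s).
    { assert (H := Hslope (z0 - M * Rabs s) z0). rewrite HG0 in H.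
      replace ((z0 - (z0 - M * Rabs s)) / M) with (Rabs s) in H by (field; lra).
      assert (0 <= Rabs s) by apply Rabs_pos.
      assert (- s <= Rabs s) by (rewrite <- Rabs_Ropp; apply Rle_abs).
      assert (0 <= M * Rabs s) by nra. lra. }
    assert (Hhi : s <= G (z0 + M * Rabs s)).
    { assert (H := Hslope z0 (z0 + M * Rabs s)). rewrite HG0 in H.
      replace ((z0 + M * Rabs s - z0) / M) with (Rabs s) in H by (field; lra).
      assert (0 <= Rabs s) by apply Rabs_pos. assert (s <= Rabs s) by apply Rle_abs.
      assert (0 <= M * Rabs s) by nra. lra. }
    destruct (IVT_gen G (z0 - M * Rabs s) (z0 + M * Rabs s) s) as [z [_ Hz]].
    - intros x. apply continuity_pt_filterlim, HGc.
    - split.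
      + apply Rle_trans with (2 := Hlo), Rmin_l.
      + apply Rle_trans with (1 := Hhi), Rmax_r.
    - now exists z. }
  pose (Z s := proj1_sig (constructive_indefinite_description _ (Hsurj s))).
  assert (HZ : forall s, G (Z s) = s).
  { intros s. unfold Z. now destruct (constructive_indefinite_description _ (Hsurj s)). }
  assert (Hinj : forall a b, G a = G b -> a = b).
  { intros a b E. destruct (Rtotal_order a b) as [H|[H|H]]; trivial.
    - assert (K := Hslope a b). assert (0 < (b - a) / M) by (apply Rdiv_lt_0_compat; lra). lra.
    - assert (K := Hslope b a). assert (0 < (a - b) / M) by (apply Rdiv_lt_0_compat; lra). lra. }
  assert (HLip : forall a b, Rabs (Z a - Z b) <= M * Rabs (a - b)).
  { assert (W : forall a b, Z b <= Z a -> Z a - Z b <= M * Rabs (a - b)).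
    { intros a b H. assert (K := Hslope _ _ H). rewrite !HZ in K.
      apply (Rmult_le_compat_l M) in K; [|lra].
      replace (M * ((Z a - Z b) / M)) with (Z a - Z b) in K by (field; lra).
      assert (a - b <= Rabs (a - b)) by apply Rle_abs. nra. }
    intros a b. destruct (Rle_dec (Z b) (Z a)) as [H|H].
    - rewrite (Rabs_right (Z a - Z b)) by lra. now apply W.
    - rewrite (Rabs_left (Z a - Z b)) by lra. rewrite (Rabs_minus_sym a b).
      assert (K := W b a). lra. }
  exists Z. split; [apply Hinj; now rewrite HZ, HG0|].
  intros s. apply is_derive_Reals. intros eps He.
  destruct (proj1 (filterlim_locally f (f (Z s))) (Hc (Z s)) (mkposreal _ He)) as [d Hd].
  assert (Hd' : 0 < d / M) by (apply Rdiv_lt_0_compat; [apply cond_pos|lra]).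
  exists (mkposreal _ Hd'). intros h Hh0 Hh. simpl in Hh.
  assert (Hnear : Rabs (Z (s + h) - Z s) < d).
  { apply Rle_lt_trans with (1 := HLip _ _).
    replace (s + h - s) with h by ring.
    apply (Rmult_lt_compat_l M) in Hh; [|lra].
    replace (M * (d / M)) with (pos d) in Hh by (field; lra). exact Hh. }
  assert (exists c, Rabs (c - Z s) < d /\ h = / f c * (Z (s + h) - Z s)) as [c [Hc1 Hc2]].
  { destruct (MVT_gen G (Z s) (Z (s + h)) (fun z => / f z)) as [c [Hc1 Hc2]].
    - intros x _. apply HG.
    - intros x _. apply continuity_pt_filterlim, HGc.
    - exists c. split.
      + apply Rabs_def2 in Hnear. revert Hc1. unfold Rmin, Rmax.
        destruct (Rle_dec (Z s) (Z (s + h))); intros; apply Rabs_def1; lra.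
      + rewrite !HZ in Hc2. lra. }
  replace ((Z (s + h) - Z s) / h) with (f c).
  - apply Hd. exact Hc1.
  - assert (f c <> 0) by (specialize (Hfp c); lra).
    apply (Rmult_eq_reg_r h); trivial. rewrite Hc2 at 1. field. auto.
Qed.

(** * Local existence for ordinary differential equations *)

Lemma minus_plus_plus {G : AbelianGroup} (a x y : G) :
  minus (plus a x) (plus a y) = minus x y.
Proof.
  unfold minus. rewrite opp_plus, (plus_comm a x), <- plus_assoc.
  now rewrite (plus_assoc a), plus_opp_r, plus_zero_l.
Qed.

Lemma minus_plus_cancel {G : AbelianGroup} (a x : G) : minus (plus a x) a = x.
Proof.
  unfold minus. rewrite (plus_comm a x), <- plus_assoc.
  apply: (eq_trans (f_equal (plus x) (plus_opp_r a))). apply: plus_zero_r.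
Qed.

Lemma norm_minus_sym {E : NormedModule R_AbsRing} (x y : E) :
  norm (minus x y) = norm (minus y x).
Proof.
  rewrite <- (norm_opp (minus x y)). f_equal. apply: opp_minus.
Qed.

Lemma norm_minus_triangle {E : NormedModule R_AbsRing} (y x z : E) :
  norm (minus x z) <= norm (minus x y) + norm (minus y z).
Proof.
  replace (minus x z) with (plus (minus x y) (minus y z)).
  - apply: norm_triangle.
  - symmetry. apply: minus_trans.
Qed.

(** The Picard-Lindelof theorem, by iteration of the integral operator.
    Continuity of the field is only asked along continuous curves, not in all
    variables jointly; this allows a merely Holder dependence on the independent
    variable, as met at the collisions. That variable is clamped by [cl] to the
    interval of existence, so that the iteration acts on curves defined on the
    whole line. *)
Lemma picard {E : CompleteNormedModule R_AbsRing} (F : R -> E -> E)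
  (L M h t0 : R) (x0 : E) :
  (forall X : R -> E, (forall t, continuous X t) ->
     forall t, continuous (fun s => F s (X s)) t) ->
  (forall t x y, norm (minus (F t x) (F t y)) <= L * norm (minus x y)) ->
  (forall t x, norm (F t x) <= M) ->
  0 <= L -> 0 < h -> h * L <= / 2 ->
  exists X : R -> E, X t0 = x0 /\ (forall t, continuous X t) /\
    forall t, Rabs (t - t0) < h -> is_derive X t (F t (X t)).
Proof.
  intros Hc HL HM HL0 Hh HhL.
  assert (HM0 : 0 <= M).
  { apply Rle_trans with (2 := HM 0 x0). apply norm_ge_0. }
  pose (cl t := Rmax (t0 - h) (Rmin (t0 + h) t)).
  assert (Hcl : forall t, Rabs (cl t - t0) <= h).
  { intros t. apply Rabs_le. unfold cl, Rmax, Rmin.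
    destruct (Rle_dec (t0 + h) t); destruct (Rle_dec (t0 - h) _); lra. }
  assert (Hcl1 : forall t, Rabs (t - t0) < h -> cl t = t).
  { intros t Ht. apply Rabs_def2 in Ht. unfold cl, Rmax, Rmin.
    destruct (Rle_dec (t0 + h) t); destruct (Rle_dec (t0 - h) _); lra. }
  assert (Hclc : forall t, continuous cl t).
  { intros t. apply (continuous_comp (fun t => Rmin (t0 + h) t) (fun y => Rmax (t0 - h) y)).
    - intros P [e He]. exists e. intros y Hy. apply He.
      revert Hy. unfold ball; simpl; unfold AbsRing_ball, abs, minus, plus, opp; simpl.
      intros Hy. apply Rle_lt_trans with (2 := Hy). unfold Rmin.
      destruct (Rle_dec (t0 + h) y); destruct (Rle_dec (t0 + h) t);
        unfold Rabs; repeat destruct Rcase_abs; lra.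
    - intros P [e He]. exists e. intros y Hy. apply He.
      revert Hy. unfold ball; simpl; unfold AbsRing_ball, abs, minus, plus, opp; simpl.
      intros Hy. apply Rle_lt_trans with (2 := Hy). unfold Rmax.
      destruct (Rle_dec (t0 - h) y); destruct (Rle_dec (t0 - h) (Rmin (t0 + h) t));
        unfold Rabs; repeat destruct Rcase_abs; lra. }
  pose (cont X := forall t : R, continuous (X : R -> E) t).
  pose (P X t := plus x0 (RInt (fun s => F s (X s)) t0 (cl t))).
  assert (Hex : forall X, cont X -> forall a b, ex_RInt (fun s => F s (X s)) a b).
  { intros X HX a b. apply ex_RInt_continuous. intros z _. now apply Hc. }
  assert (HP : forall X, cont X -> cont (P X)).
  { intros X HX t. unfold P. apply: continuous_plus; [apply: continuous_const|].
    apply (continuous_comp cl (fun b => RInt (fun s => F s (X s)) t0 b)); [apply Hclc|].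
    apply (continuous_RInt_1 (fun s => F s (X s)) t0 (cl t)).
    exists (mkposreal 1 Rlt_0_1). intros y _. apply: RInt_correct. now apply Hex. }
  assert (Hcontr : forall X Y B, cont X -> cont Y ->
     (forall t, norm (minus (X t) (Y t)) <= B) ->
     forall t, norm (minus (P X t) (P Y t)) <= B / 2).
  { intros X Y B HX HY HB t. unfold P.
    assert (HB0 : 0 <= B) by (apply Rle_trans with (2 := HB 0); apply norm_ge_0).
    replace (minus (plus x0 (RInt (fun s => F s (X s)) t0 (cl t)))
                   (plus x0 (RInt (fun s => F s (Y s)) t0 (cl t))))
      with (minus (RInt (fun s => F s (X s)) t0 (cl t)) (RInt (fun s => F s (Y s)) t0 (cl t))).
    2:{ symmetry. apply: minus_plus_plus. }
    apply Rle_trans with (Rabs (cl t - t0) * (L * B)).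
    - apply (norm_RInt_le_const_abs (fun s => minus (F s (X s)) (F s (Y s))) t0 (cl t)).
      + intros s _. apply Rle_trans with (1 := HL _ _ _). now apply Rmult_le_compat_l.
      + apply: is_RInt_minus; apply: RInt_correct; now apply Hex.
    - specialize (Hcl t). assert (0 <= Rabs (cl t - t0)) by apply Rabs_pos.
      apply Rle_trans with (h * (L * B)); [|nra].
      apply Rmult_le_compat_r; trivial. now apply Rmult_le_pos. }
  pose (X := fix X n := match n with O => fun _ => x0 | S n => P (X n) end).
  assert (HX : forall n, cont (X n)).
  { induction n; simpl; [intros t; apply continuous_const|now apply HP]. }
  pose (C := M * h).
  assert (HC0 : 0 <= C) by (apply Rmult_le_pos; lra).
  assert (Hpos : forall n, 0 < (/ 2) ^ n) by (intros; apply pow_lt; lra).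
  assert (Hd : forall n t, norm (minus (X (S n) t) (X n t)) <= C * (/ 2) ^ n).
  { induction n.
    - intros t. simpl. unfold P.
      replace (minus (plus x0 (RInt (fun s => F s x0) t0 (cl t))) x0)
        with (RInt (fun s => F s x0) t0 (cl t)).
      2:{ symmetry. apply: minus_plus_cancel. }
      apply Rle_trans with (Rabs (cl t - t0) * M).
      + apply (norm_RInt_le_const_abs (fun s => F s x0) t0 (cl t)); [intros; apply HM|].
        apply: RInt_correct. apply (Hex (fun _ => x0)). intros s; apply continuous_const.
      + specialize (Hcl t). unfold C. assert (Rabs (cl t - t0) * M <= h * M) by (apply Rmult_le_compat_r; lra). lra.
    - intros t. apply Rle_trans with (C * (/ 2) ^ n / 2).
      + apply (Hcontr (X (S n)) (X n)); trivial.
      + simpl. lra. }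
  assert (Hcauchy : forall n p t, norm (minus (X (n + p)%nat t) (X n t)) <= 2 * C * (/ 2) ^ n * (1 - (/ 2) ^ p)).
  { intros n p t. induction p.
    - rewrite Nat.add_0_r. replace (norm (minus (X n t) (X n t))) with 0; [simpl; lra|].
      symmetry. rewrite <- (@norm_zero R_AbsRing E). f_equal. apply: minus_eq_zero.
    - rewrite Nat.add_succ_r.
      apply Rle_trans with (1 := norm_minus_triangle (X (n + p)%nat t) _ _).
      apply Rle_trans with (C * (/ 2) ^ (n + p) + 2 * C * (/ 2) ^ n * (1 - (/ 2) ^ p)).
      + apply Rplus_le_compat; [apply Hd|exact IHp].
      + rewrite pow_add. simpl. assert (Hn := Hpos n). assert (Hp := Hpos p). nra. }
  assert (Hlim : forall t, exists l : E, filterlim (fun n => X n t) eventually (locally l)).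
  { intros t. apply: (proj1 (filterlim_locally_cauchy (F := eventually) (fun n => X n t))). intros eps.
    assert (exists N, 4 * C * (/ 2) ^ N < eps) as [N HN].
    { destruct (pow_lt_1_zero (/ 2)) with (y := eps / (4 * C + 1)) as [N HN].
      - rewrite Rabs_right; lra.
      - apply Rdiv_lt_0_compat; [apply cond_pos|lra].
      - exists N. specialize (HN N (le_n _)). rewrite Rabs_right in HN by (specialize (Hpos N); lra).
        apply (Rmult_lt_compat_l (4 * C + 1)) in HN; [|lra].
        replace ((4 * C + 1) * (eps / (4 * C + 1))) with (pos eps) in HN by (field; lra).
        specialize (Hpos N). lra. }
    exists (fun n => (N <= n)%nat). split; [now exists N|].
    intros n m Hn Hm.
    assert (K : forall n, (N <= n)%nat -> norm (minus (X n t) (X N t)) <= 2 * C * (/ 2) ^ N).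
    { intros j Hj. replace j with (N + (j - N))%nat by (clear -Hj; lia).
      apply Rle_trans with (1 := Hcauchy _ _ _).
      assert (H1 := Hpos N). assert (H2 := Hpos (j - N)%nat).
      assert (0 <= C * (/ 2) ^ N) by (apply Rmult_le_pos; lra). nra. }
    apply (@norm_compat1 R_AbsRing E).
    apply Rle_lt_trans with (1 := norm_minus_triangle (X N t) _ _).
    rewrite (norm_minus_sym (X N t)).
    assert (K1 := K n Hn). assert (K2 := K m Hm).
    eapply Rle_lt_trans; [apply Rplus_le_compat; eassumption|]. lra. }
  pose (Y t := proj1_sig (constructive_indefinite_description _ (Hlim t))).
  assert (HY : forall t, filterlim (fun n => X n t) eventually (locally (Y t))).
  { intros t. unfold Y. now destruct (constructive_indefinite_description _ (Hlim t)). }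
  assert (HXY : forall n t, norm (minus (Y t) (X n t)) <= 2 * C * (/ 2) ^ n).
  { intros n t. apply le_epsilon. intros eps He.
    assert (Hf : 0 < @norm_factor R_AbsRing E) by apply norm_factor_gt_0.
    assert (He' : 0 < eps / @norm_factor R_AbsRing E) by now apply Rdiv_lt_0_compat.
    destruct (proj1 (filterlim_locally _ _) (HY t) (mkposreal _ He')) as [N HN].
    assert (Hle : (N <= n + N)%nat) by apply Nat.le_add_l.
    assert (Hb := HN (n + N)%nat Hle).
    apply (@norm_compat2 R_AbsRing E) in Hb. simpl in Hb.
    replace (norm_factor * (eps / norm_factor)) with eps in Hb by (field; lra).
    apply Rle_trans with (1 := norm_minus_triangle (X (n + N)%nat t) _ _).
    rewrite (norm_minus_sym (Y t)).
    assert (K := Hcauchy n N t). assert (H1 := Hpos n). assert (H2 := Hpos N).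
    assert (0 <= C * (/ 2) ^ n) by (apply Rmult_le_pos; lra).
    apply Rle_trans with (eps + 2 * C * (/ 2) ^ n * (1 - (/ 2) ^ N)); [|nra].
    apply Rplus_le_compat; [now left|exact K]. }
  assert (Hsmall : forall eps, 0 < eps -> exists n, 2 * C * (/ 2) ^ n < eps).
  { intros eps He. destruct (pow_lt_1_zero (/ 2)) with (y := eps / (2 * C + 1)) as [N HN].
    - rewrite Rabs_right; lra.
    - apply Rdiv_lt_0_compat; lra.
    - exists N. specialize (HN N (le_n _)). rewrite Rabs_right in HN by (specialize (Hpos N); lra).
      apply (Rmult_lt_compat_l (2 * C + 1)) in HN; [|lra].
      replace ((2 * C + 1) * (eps / (2 * C + 1))) with eps in HN by (field; lra).
      specialize (Hpos N). lra. }
  assert (HYc : cont Y).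
  { intros t. apply filterlim_locally. intros eps.
    assert (Hf : 0 < @norm_factor R_AbsRing E) by apply norm_factor_gt_0.
    destruct (Hsmall (eps / 3)) as [n Hn]; [specialize (cond_pos eps); lra|].
    assert (He' : 0 < eps / 3 / @norm_factor R_AbsRing E).
    { apply Rdiv_lt_0_compat; trivial. specialize (cond_pos eps); lra. }
    specialize (proj1 (filterlim_locally _ _) (HX n t) (mkposreal _ He')).
    apply filter_imp. intros s Hs. apply (@norm_compat2 R_AbsRing E) in Hs. simpl in Hs.
    replace (norm_factor * (eps / 3 / norm_factor)) with (eps / 3) in Hs by (field; lra).
    apply (@norm_compat1 R_AbsRing E).
    apply Rle_lt_trans with (1 := norm_minus_triangle (X n s) _ _).
    assert (K := norm_minus_triangle (X n t) (X n s) (Y t)).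
    rewrite (norm_minus_sym (X n t) (Y t)) in K.
    assert (K1 := HXY n s). assert (K2 := HXY n t).
    apply Rle_lt_trans with (2 * C * (/ 2) ^ n + (eps / 3 + 2 * C * (/ 2) ^ n)); [|lra].
    apply Rplus_le_compat; [exact K1|]. apply Rle_trans with (1 := K).
    apply Rplus_le_compat; [now left|exact K2]. }
  assert (Hfix : forall t, Y t = P Y t).
  { intros t. apply eq_sym. apply (@eq_close R_AbsRing E).
    intros eps. apply (@norm_compat1 R_AbsRing E).
    destruct (Hsmall (eps / 2)) as [n Hn]; [specialize (cond_pos eps); lra|].
    apply Rle_lt_trans with (1 := norm_minus_triangle (X (S n) t) _ _).
    rewrite (norm_minus_sym (X (S n) t) (P Y t)).
    assert (K1 := HXY (S n) t).
    assert (K2 := Hcontr Y (X n) _ HYc (HX n) (HXY n) t).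
    simpl in K1. specialize (cond_pos eps). specialize (Hpos n). intros.
    assert (0 <= C * (/ 2) ^ n) by (apply Rmult_le_pos; lra).
    eapply Rle_lt_trans; [apply Rplus_le_compat; [exact K1|exact K2]|]. lra. }
  exists Y. split; [|split; [exact HYc|]].
  - rewrite Hfix. unfold P. rewrite Hcl1 by (rewrite Rminus_diag_eq, Rabs_R0; lra).
    rewrite RInt_point. apply plus_zero_r.
  - intros t Ht.
    apply (is_derive_ext_loc (fun t => plus x0 (RInt (fun s => F s (Y s)) t0 t))).
    + assert (He : 0 < h - Rabs (t - t0)) by lra.
      exists (mkposreal _ He). intros s Hs. rewrite (Hfix s). unfold P.
      rewrite Hcl1; trivial.
      revert Hs. unfold ball; simpl; unfold AbsRing_ball, abs, minus, plus, opp; simpl. intros Hs.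
      replace (s - t0) with ((s + - t) + (t - t0)) by ring.
      apply Rle_lt_trans with (1 := Rabs_triang _ _). lra.
    + rewrite <- (plus_zero_l (F t (Y t))) at 1.
      apply: is_derive_plus; [apply: is_derive_const|].
      apply (is_derive_RInt (fun s => F s (Y s)) _ t0 t).
      * exists (mkposreal 1 Rlt_0_1). intros y _. apply: RInt_correct. now apply Hex.
      * now apply Hc.
Qed.

(** * The potential *)

(** A class, so that the bounds on the exponent are found by inference. *)
Class admissible (alpha : R) : Prop := admissible_bounds : 0 < alpha <= 1.

Lemma rpow_of_pos (x a : R) : 0 < x -> rpow x a = Rpower x a.
Proof. intros H. unfold rpow. now destruct (Rlt_dec 0 x). Qed.

Lemma rpow_of_nonpos (x a : R) : x <= 0 -> rpow x a = 0.
Proof. intros H. unfold rpow. destruct (Rlt_dec 0 x); [lra|trivial]. Qed.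

Lemma Rpower_pos (x a : R) : 0 < Rpower x a.
Proof. apply exp_pos. Qed.

Lemma Rpower_base_1 (a : R) : Rpower 1 a = 1.
Proof. unfold Rpower. now rewrite ln_1, Rmult_0_r, exp_0. Qed.

Lemma rpow_nonneg (x a : R) : 0 <= rpow x a.
Proof.
  unfold rpow. destruct (Rlt_dec 0 x); [left; apply Rpower_pos|lra].
Qed.

Lemma rpow_le (x y a : R) : 0 < a -> x <= y -> rpow x a <= rpow y a.
Proof.
  intros Ha Hxy. unfold rpow.
  destruct (Rlt_dec 0 x), (Rlt_dec 0 y); try lra.
  - now apply Rle_Rpower_l; [lra|split].
  - left; apply Rpower_pos.
Qed.

Lemma rpow_1 (a : R) : rpow 1 a = 1.
Proof.
  rewrite rpow_of_pos by lra. apply Rpower_base_1.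
Qed.

Lemma rpow_ge_sq (x a : R) : 0 <= x <= 1 -> a <= 2 -> x ^ 2 <= rpow x a.
Proof.
  intros [H0 H1] Ha. destruct (Req_dec x 0) as [->|Hx].
  - simpl. rewrite Rmult_0_l. apply rpow_nonneg.
  - rewrite rpow_of_pos by lra. rewrite <- (Rpower_pow 2) by lra.
    unfold Rpower. simpl INR.
    assert (ln x <= 0).
    { rewrite <- ln_1. destruct (Req_dec x 1) as [->|]; [lra|].
      left. apply ln_increasing; lra. }
    assert (K : (1 + 1) * ln x <= a * ln x) by nra.
    destruct K as [K| ->]; [left; now apply exp_increasing|lra].
Qed.

Lemma rpow_twice (x a : R) : rpow x (2 * a) = rpow x a ^ 2.
Proof.
  unfold rpow. destruct (Rlt_dec 0 x); [|simpl; ring].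
  replace (2 * a) with (a + a) by ring. rewrite Rpower_plus. ring.
Qed.

Lemma derive_Rpower (f : R -> R) (a x lf l : R) :
  is_derive f x lf -> 0 < f x -> l = a * Rpower (f x) (a - 1) * lf ->
  is_derive (fun y => Rpower (f y) a) x l.
Proof.
  intros Hf Hp ->.
  apply (derive_comp (fun z => Rpower z a) f x (a * Rpower (f x) (a - 1)) lf); trivial.
  now apply is_derive_Reals, derivable_pt_lim_power.
Qed.

Lemma rpow_continuous (a x : R) : 0 < a -> continuous (fun y => rpow y a) x.
Proof.
  intros Ha. destruct (Rtotal_order x 0) as [H|[->|H]].
  - apply (continuous_ext_loc _ (fun _ => 0)).
    + assert (He : 0 < - x) by lra. exists (mkposreal _ He). intros y Hy.
      symmetry. apply rpow_of_nonpos. apply Rabs_def2 in Hy. simpl in Hy.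
      unfold minus, plus, opp in Hy; simpl in Hy. lra.
    + apply continuous_const.
  - apply filterlim_locally. intros eps.
    exists (mkposreal _ (Rpower_pos eps (/ a))). intros y Hy.
    apply Rabs_def2 in Hy. simpl in Hy. unfold minus, plus, opp in Hy; simpl in Hy.
    apply Rabs_def1; unfold minus, plus, opp; simpl; rewrite (rpow_of_nonpos 0) by lra;
      specialize (cond_pos eps); intros He; [|specialize (rpow_nonneg y a); lra].
    unfold rpow. destruct (Rlt_dec 0 y); [|lra].
    apply Rlt_le_trans with (Rpower (Rpower eps (/ a)) a + - 0).
    + apply Rplus_lt_compat_r. apply exp_increasing, Rmult_lt_compat_l; trivial.
      apply ln_increasing; lra.
    + rewrite Rpower_mult, Rinv_l, Rpower_1 by lra. lra.
  - apply (continuous_ext_loc _ (fun y => Rpower y a)).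
    + exists (mkposreal _ H). intros y Hy. symmetry. apply rpow_of_pos.
      apply Rabs_def2 in Hy. simpl in Hy. unfold minus, plus, opp in Hy; simpl in Hy. lra.
    + apply (continuous_of_derive _ _ (a * Rpower x (a - 1))).
      now apply is_derive_Reals, derivable_pt_lim_power.
Qed.

(** The common factor of the regularization. It is continuous on the whole line,
    but not differentiable at the collisions. *)
Definition cf (alpha th : R) : R := rpow (sin (2 * th)) alpha.

(** On the manifold [u^2 = cf * Qf], and [Qf] vanishes exactly at the rest
    points of [v]; off the collisions [Qf = w^2 / U]. *)
Definition Qf (alpha th v : R) : R := 2 - v ^ 2 * cf alpha th / W alpha th.

(** The time change [d tau / d s]. *)
Definition gf (alpha th : R) : R := cf alpha th / sqrt (W alpha th).

Definition U' (alpha th : R) : R :=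
  Rpower 2 (- alpha) * alpha *
    (sin th * Rpower (cos th) (- alpha - 1) - cos th * Rpower (sin th) (- alpha - 1)).

Section Potential.
Context {alpha : R} {Ha : admissible alpha}.
Set Default Proof Using "All".

Lemma alpha_bounds : 0 < alpha <= 1.
Proof. exact Ha. Qed.

Lemma sin_cos_interior (th : R) : 0 < th < PI / 2 ->
  0 < sin th /\ 0 < cos th /\ 0 < sin (2 * th).
Proof.
  intros H. assert (HPI := PI_RGT_0). repeat split.
  - apply sin_gt_0; lra.
  - apply cos_gt_0; lra.
  - apply sin_gt_0; lra.
Qed.

Lemma sin_cos_closed (th : R) : 0 <= th <= PI / 2 ->
  0 <= sin th <= 1 /\ 0 <= cos th <= 1 /\ 0 <= sin (2 * th) <= 1.
Proof.
  intros H. assert (HPI := PI_RGT_0).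
  specialize (SIN_bound th). specialize (COS_bound th). specialize (SIN_bound (2 * th)).
  intros. repeat split; try lra.
  - apply sin_ge_0; lra.
  - apply cos_ge_0; lra.
  - apply sin_ge_0; lra.
Qed.

Lemma not_collision (th : R) : 0 <= th <= PI / 2 -> ~ collision th -> 0 < th < PI / 2.
Proof.
  unfold collision. intros H N.
  split; apply Rnot_le_lt; intros K; apply N; [left|right]; lra.
Qed.

Lemma interior_not_collision (th : R) : 0 < th < PI / 2 -> ~ collision th.
Proof. unfold collision. intros H [K|K]; lra. Qed.

Lemma cf_collision (th : R) : collision th -> cf alpha th = 0.
Proof.
  intros [->| ->]; unfold cf; apply rpow_of_nonpos.
  - rewrite Rmult_0_r, sin_0. lra.
  - replace (2 * (PI / 2)) with PI by field. rewrite sin_PI. lra.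
Qed.

Lemma cf_pos (th : R) : 0 < th < PI / 2 -> 0 < cf alpha th.
Proof.
  intros H. unfold cf. rewrite rpow_of_pos by now apply sin_cos_interior.
  apply Rpower_pos.
Qed.

Lemma cf_bounds (th : R) : 0 <= cf alpha th <= 1.
Proof.
  split; [apply rpow_nonneg|].
  rewrite <- (rpow_1 alpha). apply rpow_le; [apply Ha|apply SIN_bound].
Qed.

Lemma cf_continuous (th : R) : continuous (cf alpha) th.
Proof.
  apply (continuous_comp (fun th => sin (2 * th)) (fun y => rpow y alpha)).
  - apply (ex_derive_continuous (fun th : R => sin (2 * th))). auto_derive; trivial.
  - apply rpow_continuous, Ha.
Qed.

(** The lower bound comes from [sin^2 + cos^2 = 1]. *)
Lemma W_bounds (th : R) : 0 <= th <= PI / 2 -> 1 <= W alpha th <= 3.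
Proof.
  intros H. destruct (sin_cos_closed th H) as [Hs [Hc _]].
  assert (Ha0 := alpha_bounds).
  assert (1 = sin th ^ 2 + cos th ^ 2).
  { rewrite <- (sin2_cos2 th). unfold Rsqr. ring. }
  assert (H1 := rpow_ge_sq (sin th) alpha Hs ltac:(lra)).
  assert (H2 := rpow_ge_sq (cos th) alpha Hc ltac:(lra)).
  assert (H3 := rpow_nonneg (sin th) alpha). assert (H4 := rpow_nonneg (cos th) alpha).
  assert (H5 : rpow (sin th) alpha <= 1) by (rewrite <- (rpow_1 alpha); apply rpow_le; lra).
  assert (H6 : rpow (cos th) alpha <= 1) by (rewrite <- (rpow_1 alpha); apply rpow_le; lra).
  unfold W. nra.
Qed.

Lemma sqrtW_bounds (th : R) : 0 <= th <= PI / 2 -> 1 <= sqrt (W alpha th) <= 2.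
Proof.
  intros H. assert (HW := W_bounds th H). split.
  - rewrite <- sqrt_1. apply sqrt_le_1; lra.
  - replace 2 with (sqrt (2 * 2)) by (apply sqrt_square; lra). apply sqrt_le_1; lra.
Qed.

Lemma W_continuous (th : R) : continuous (W alpha) th.
Proof.
  assert (Hs : continuous (fun th => rpow (sin th) alpha) th).
  { apply (continuous_comp sin (fun y => rpow y alpha)).
    - apply continuity_pt_filterlim, continuity_sin.
    - apply rpow_continuous, Ha. }
  assert (Hc : continuous (fun th => rpow (cos th) alpha) th).
  { apply (continuous_comp cos (fun y => rpow y alpha)).
    - apply continuity_pt_filterlim, continuity_cos.
    - apply rpow_continuous, Ha. }
  apply: continuous_plus; [|exact Hc]. apply: continuous_plus; [|exact Hs].
  now apply: continuous_mult.
Qed.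

Lemma cf_interior (th : R) : 0 < th < PI / 2 ->
  cf alpha th = Rpower 2 alpha * (Rpower (sin th) alpha * Rpower (cos th) alpha).
Proof.
  intros H. destruct (sin_cos_interior th H) as [Hs [Hc Hsc]].
  unfold cf. rewrite rpow_of_pos by trivial. rewrite sin_2a, Rmult_assoc.
  rewrite !Rpower_mult_distr; trivial; try lra. now apply Rmult_lt_0_compat.
Qed.

Lemma W_interior (th : R) : 0 < th < PI / 2 ->
  W alpha th = Rpower (sin th) alpha * Rpower (cos th) alpha
                + Rpower (sin th) alpha + Rpower (cos th) alpha.
Proof.
  intros H. destruct (sin_cos_interior th H) as [Hs [Hc Hsc]].
  unfold W. now rewrite !rpow_of_pos.
Qed.

Lemma U_eq (th : R) : 0 < th < PI / 2 -> U alpha th = W alpha th / cf alpha th.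
Proof.
  intros H. rewrite (cf_interior th H), (W_interior th H). unfold U.
  rewrite !Rpower_Ropp.
  assert (H1 := Rpower_pos 2 alpha). assert (H2 := Rpower_pos (sin th) alpha).
  assert (H3 := Rpower_pos (cos th) alpha). field. lra.
Qed.

Lemma PI4_interior : 0 < PI / 4 < PI / 2.
Proof. assert (HPI := PI_RGT_0). lra. Qed.

Lemma cf_PI4 : cf alpha (PI / 4) = 1.
Proof.
  unfold cf. replace (2 * (PI / 4)) with (PI / 2) by field.
  now rewrite sin_PI2, rpow_1.
Qed.

Lemma sin_2_lt_1 (th : R) : 0 <= th <= PI / 2 -> th <> PI / 4 -> sin (2 * th) < 1.
Proof.
  intros H N. assert (HPI := PI_RGT_0). rewrite <- sin_PI2.
  destruct (Rtotal_order th (PI / 4)) as [K|[K|K]]; [|contradiction|].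
  - apply sin_increasing_1; lra.
  - apply sin_decreasing_1; lra.
Qed.

(** By the arithmetic-geometric inequality, as [sin^alpha cos^alpha] is largest
    at the central configuration. *)
Lemma U_min_strict (th : R) : 0 < th < PI / 2 -> th <> PI / 4 ->
  U alpha (PI / 4) < U alpha th.
Proof.
  intros H N. assert (HPI := PI_RGT_0).
  assert (Hcf : cf alpha th < 1).
  { assert (K := sin_2_lt_1 th ltac:(lra) N).
    destruct (sin_cos_interior th H) as [_ [_ Hsc]].
    unfold cf. rewrite rpow_of_pos by trivial.
    replace 1 with (Rpower 1 alpha).
    - apply exp_increasing, Rmult_lt_compat_l; [apply Ha|]. now apply ln_increasing.
    - apply Rpower_base_1. }
  assert (H4 := cf_PI4).
  rewrite (cf_interior th H) in Hcf. rewrite (cf_interior _ PI4_interior) in H4.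
  unfold U. rewrite !Rpower_Ropp.
  rewrite sin_PI4, cos_PI4 in *.
  assert (H1 := Rpower_pos 2 alpha). assert (H2 := Rpower_pos (sin th) alpha).
  assert (H3 := Rpower_pos (cos th) alpha).
  assert (H5 := Rpower_pos (1 / sqrt 2) alpha).
  set (m := Rpower 2 alpha) in *. set (A := Rpower (sin th) alpha) in *.
  set (B := Rpower (cos th) alpha) in *. set (C := Rpower (1 / sqrt 2) alpha) in *.
  clearbody m A B C.
  apply Rmult_lt_compat_l; [now apply Rinv_0_lt_compat|].
  assert (HAB : A * B < C * C) by nra.
  assert (/ C + / C < / A + / B); [|lra].
  replace (/ C + / C) with (2 / C) by (field; lra).
  replace (/ A + / B) with ((A + B) / (A * B)) by (field; lra).
  assert (0 < A * B) by nra. assert (2 * (A * B) < (A + B) * C).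
  { assert (4 * (A * B) <= (A + B) * (A + B)) by (specialize (pow2_ge_0 (A - B)); simpl; intros; nra).
    assert ((2 * (A * B)) ^ 2 < ((A + B) * C) ^ 2).
    { assert (((A + B) * C) ^ 2 = (A + B) * (A + B) * (C * C)) by ring.
      assert (4 * (A * B) * (C * C) <= (A + B) * (A + B) * (C * C)) by (apply Rmult_le_compat_r; nra).
      nra. }
    apply Rnot_le_lt. intros K. assert (0 < (A + B) * C) by nra. nra. }
  apply (Rmult_lt_reg_r (C * (A * B))); [nra|].
  replace (2 / C * (C * (A * B))) with (2 * (A * B)) by (field; lra).
  replace ((A + B) / (A * B) * (C * (A * B))) with ((A + B) * C) by (field; lra).
  trivial.
Qed.

Lemma U_min (th : R) : 0 < th < PI / 2 -> U alpha (PI / 4) <= U alpha th.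
Proof.
  intros H. destruct (Req_dec th (PI / 4)) as [->|N]; [lra|].
  left. now apply U_min_strict.
Qed.

Lemma U_pos (th : R) : 0 < U alpha th.
Proof.
  unfold U. apply Rmult_lt_0_compat; [apply Rpower_pos|].
  assert (H1 := Rpower_pos (sin th) (- alpha)). assert (H2 := Rpower_pos (cos th) (- alpha)).
  lra.
Qed.

Lemma derive_U (th : R) : 0 < th < PI / 2 -> is_derive (U alpha) th (U' alpha th).
Proof.
  intros H. destruct (sin_cos_interior th H) as [Hs [Hc _]].
  eapply derive_eq.
  - apply derive_scal with (lf := - alpha * Rpower (sin th) (- alpha - 1) * cos th
       + - alpha * Rpower (cos th) (- alpha - 1) * (- sin th)); [|reflexivity].
    eapply derive_plus.
    + eapply derive_plus; [apply: is_derive_const| |reflexivity].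
      eapply derive_Rpower; [apply is_derive_Reals, derivable_pt_lim_sin|trivial|reflexivity].
    + eapply derive_Rpower; [apply is_derive_Reals, derivable_pt_lim_cos|trivial|reflexivity].
    + unfold zero; simpl. ring.
  - unfold U'. ring.
Qed.

Lemma Derive_U (th : R) : 0 < th < PI / 2 -> Derive (U alpha) th = U' alpha th.
Proof. intros H. now apply is_derive_unique, derive_U. Qed.

Lemma sin_compl (th : R) : sin (PI / 2 - th) = cos th.
Proof. apply sin_shift. Qed.

Lemma cos_compl (th : R) : cos (PI / 2 - th) = sin th.
Proof. apply cos_shift. Qed.

Lemma cf_sym (th : R) : cf alpha (PI / 2 - th) = cf alpha th.
Proof.
  unfold cf. replace (2 * (PI / 2 - th)) with (PI - 2 * th) by field.
  now rewrite sin_PI_x.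
Qed.

Lemma W_sym (th : R) : W alpha (PI / 2 - th) = W alpha th.
Proof. unfold W. rewrite sin_compl, cos_compl. ring. Qed.

Lemma U'_sym (th : R) : U' alpha (PI / 2 - th) = - U' alpha th.
Proof. unfold U'. rewrite sin_compl, cos_compl. ring. Qed.

Lemma collision_sym (th : R) : collision (PI / 2 - th) <-> collision th.
Proof. unfold collision. lra. Qed.

(** Keeps the force away from [0] off the centre, see [no_rest_left]. *)
Lemma U'_neg (th : R) : 0 < th <= PI / 4 ->
  U' alpha th <= - (Rpower 2 (- alpha) * alpha * (cos th - sin th)).
Proof.
  intros H. assert (HPI := PI_RGT_0). assert (Ha0 := alpha_bounds).
  destruct (sin_cos_interior th ltac:(lra)) as [Hs [Hc _]].
  assert (Hsc : sin th <= cos th).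
  { rewrite <- (sin_compl th). apply sin_incr_1; lra. }
  assert (H1 : Rpower (cos th) (- alpha - 1) <= Rpower (sin th) (- alpha - 1)).
  { replace (- alpha - 1) with (- (alpha + 1)) by ring. rewrite !Rpower_Ropp.
    apply Rinv_le_contravar; [apply Rpower_pos|]. apply Rle_Rpower_l; lra. }
  assert (H2 : 1 <= Rpower (cos th) (- alpha - 1)).
  { replace (- alpha - 1) with (- (alpha + 1)) by ring. rewrite Rpower_Ropp.
    assert (K : Rpower (cos th) (alpha + 1) <= 1).
    { apply Rle_trans with (Rpower 1 (alpha + 1)); [|rewrite Rpower_base_1; lra].
      apply Rle_Rpower_l; [lra|]. specialize (COS_bound th). lra. }
    apply Rinv_le_contravar in K; [lra|apply Rpower_pos]. }
  unfold U'. assert (H3 := Rpower_pos 2 (- alpha)).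
  assert (0 < Rpower 2 (- alpha) * alpha) by nra.
  assert (sin th * Rpower (cos th) (- alpha - 1) - cos th * Rpower (sin th) (- alpha - 1)
     <= - (cos th - sin th)) by nra.
  nra.
Qed.

Lemma U'_PI4 : U' alpha (PI / 4) = 0.
Proof. unfold U'. rewrite sin_PI4, cos_PI4. ring. Qed.

Lemma Qf_continuous {T : UniformSpace} (th v : T -> R) (s : T) :
  0 <= th s <= PI / 2 -> continuous th s -> continuous v s ->
  continuous (fun s => Qf alpha (th s) (v s)) s.
Proof.
  intros H Ht Hv. apply: continuous_minus; [apply: continuous_const|].
  apply: continuous_mult.
  - apply: continuous_mult.
    + apply: (continuous_comp v (fun y => y ^ 2)); trivial.
      apply (ex_derive_continuous (fun y : R => y ^ 2)). auto_derive; trivial.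
    + apply (continuous_comp th (cf alpha)); trivial. apply cf_continuous.
  - apply (continuous_comp (fun s => W alpha (th s)) Rinv).
    + apply (continuous_comp th (W alpha)); trivial. apply W_continuous.
    + apply continuity_pt_filterlim, continuity_pt_inv; [apply continuity_pt_id|].
      unfold id. specialize (W_bounds _ H). lra.
Qed.

Lemma Qf_le_2 (th v : R) : 0 <= th <= PI / 2 -> Qf alpha th v <= 2.
Proof.
  intros H. unfold Qf. specialize (W_bounds th H). specialize (cf_bounds th). intros.
  assert (0 <= v ^ 2 * cf alpha th / W alpha th); [|lra].
  apply Rdiv_le_0_compat; [|lra]. apply Rmult_le_pos; [apply pow2_ge_0|lra].
Qed.

Lemma Qf_interior (th v : R) : 0 < th < PI / 2 ->
  Qf alpha th v = (2 * U alpha th - v ^ 2) / U alpha th.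
Proof.
  intros H. unfold Qf. rewrite (U_eq th H). specialize (W_bounds th ltac:(lra)).
  specialize (cf_pos th H). intros. field. lra.
Qed.

Lemma parabolic_iff (th v u : R) :
  parabolic_manifold alpha (th, v, u) <->
  0 <= th <= PI / 2 /\ u ^ 2 = cf alpha th * Qf alpha th v.
Proof.
  unfold parabolic_manifold. split.
  - intros [H E]. split; trivial. specialize (W_bounds th H). intros HW.
    rewrite rpow_twice in E. fold (cf alpha th) in E. unfold Qf.
    apply (Rplus_eq_reg_r (v ^ 2 * cf alpha th ^ 2 / W alpha th)). rewrite E. field. lra.
  - intros [H E]. split; trivial. specialize (W_bounds th H). intros HW.
    rewrite rpow_twice. fold (cf alpha th). rewrite E. unfold Qf. field. lra.
Qed.

End Potential.

(** * Orbits *)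

Lemma sign_pos (f : R -> R) (a b : R) : a <= b ->
  (forall x, a <= x <= b -> continuous f x) ->
  (forall x, a <= x <= b -> f x <> 0) -> 0 < f a -> 0 < f b.
Proof.
  intros Hab Hc Hn Hp. apply Rnot_le_lt. intros K.
  assert (f b <> 0) by (apply Hn; lra).
  destruct (Req_dec a b) as [->|N]; [lra|].
  destruct (IVT_interv (fun x => - f x) a b) as [z [Hz1 Hz2]]; try lra.
  - intros x Hx. apply continuity_pt_opp, continuity_pt_filterlim. now apply Hc.
  - apply (Hn z); lra.
Qed.

Lemma sign_neg (f : R -> R) (a b : R) : a <= b ->
  (forall x, a <= x <= b -> continuous f x) ->
  (forall x, a <= x <= b -> f x <> 0) -> f a < 0 -> f b < 0.
Proof.
  intros Hab Hc Hn Hp. cut (0 < - f b); [lra|].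
  apply (sign_pos (fun x => - f x) a b); trivial; try lra.
  - intros x Hx. apply: continuous_opp. now apply Hc.
  - intros x Hx. specialize (Hn x Hx). lra.
Qed.

Lemma locally_of_lt (P : R -> Prop) (a b s : R) :
  a < s < b -> (forall t, a < t < b -> P t) -> locally s P.
Proof.
  intros Hs H.
  assert (He : 0 < Rmin (s - a) (b - s)) by (apply Rmin_pos; lra).
  exists (mkposreal _ He). intros t Ht. apply H. apply Rabs_def2 in Ht.
  simpl in Ht. unfold minus, plus, opp in Ht; simpl in Ht.
  assert (K1 := Rmin_l (s - a) (b - s)). assert (K2 := Rmin_r (s - a) (b - s)). lra.
Qed.

Lemma locally_abs (P : R -> Prop) (s : R) :
  locally s P -> exists e : R, 0 < e /\ forall t : R, Rabs (t - s) < e -> P t.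
Proof. intros [e He]. exists e. split; [apply cond_pos|]. exact He. Qed.

Lemma continuous_abs (f : R -> R) (s : R) : continuous f s <->
  forall eps, 0 < eps -> exists d : R, 0 < d /\ forall t : R, Rabs (t - s) < d -> Rabs (f t - f s) < eps.
Proof.
  split.
  - intros H eps He.
    destruct (proj1 (filterlim_locally f (f s)) H (mkposreal _ He)) as [d Hd].
    exists d. split; [apply cond_pos|exact Hd].
  - intros H. apply filterlim_locally. intros eps.
    destruct (H eps (cond_pos eps)) as [d [Hd0 Hd]].
    now exists (mkposreal _ Hd0).
Qed.

(** The conditions on an orbit at one instant, so that one can speak of orbit
    segments: these are what local existence provides and what is glued
    together. *)
Definition orbit_at (alpha : R) (th v u : R -> R) (s : R) : Prop :=
  0 <= th s <= PI / 2 /\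
  u s ^ 2 = cf alpha (th s) * Qf alpha (th s) (v s) /\
  is_derive th s (u s) /\
  is_derive v s ((1 - alpha / 2) * sqrt (W alpha (th s)) * Qf alpha (th s) (v s)) /\
  (0 < th s < PI / 2 ->
     is_derive (fun t => velocity alpha (th t) (u t)) s
       (gf alpha (th s) * ((alpha / 2 - 1) * v s * velocity alpha (th s) (u s)
                             + U' alpha (th s)))) /\
  (collision (th s) -> at_right 0 (fun h => u (s - h) * u (s + h) < 0)).

Section Orbits.
Context {alpha : R} {Ha : admissible alpha}.
Set Default Proof Using "All".

Lemma is_orbit_iff (th v u : R -> R) :
  is_orbit alpha th v u <-> forall s, orbit_at alpha th v u s.
Proof.
  split; intros H s; destruct (H s) as [H1 H2].
  - apply parabolic_iff in H1. destruct H1 as [H0 H1].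
    destruct H2 as [H2 [H3 [H4 H5]]]. do 4 (split; trivial). split; [|trivial].
    intros Hi. rewrite <- (Derive_U _ Hi). apply H4. now apply interior_not_collision.
  - destruct H2 as [H2 [H3 [H4 [H5 H6]]]].
    split; [now apply parabolic_iff|]. split; trivial. split; [exact H4|]. split; [|trivial].
    intros Hi. assert (Hj := not_collision _ H1 Hi). rewrite (Derive_U _ Hj). now apply H5.
Qed.

Lemma gf_pos (x : R) : 0 < x < PI / 2 -> 0 < gf alpha x.
Proof.
  intros H. unfold gf. apply Rdiv_lt_0_compat; [now apply cf_pos|].
  apply sqrt_lt_R0. specialize (W_bounds x ltac:(lra)). lra.
Qed.

Lemma gf_bounds (x : R) : 0 <= x <= PI / 2 -> 0 <= gf alpha x <= 1.
Proof.
  intros H. assert (HW := sqrtW_bounds x H). assert (Hc := cf_bounds (alpha := alpha) x). unfold gf.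
  split; [apply Rdiv_le_0_compat; lra|].
  apply Rmult_le_reg_r with (sqrt (W alpha x)); [lra|].
  unfold Rdiv. rewrite Rmult_assoc, Rinv_l by lra. lra.
Qed.

Lemma gf_continuous (x : R) : 0 <= x <= PI / 2 -> continuous (gf alpha) x.
Proof.
  intros H. specialize (W_bounds x H). intros HW.
  apply: continuous_mult; [apply cf_continuous|].
  apply (continuous_comp (fun s => sqrt (W alpha s)) Rinv).
  - apply (continuous_comp (W alpha) sqrt); [apply W_continuous|].
    apply continuity_pt_filterlim, continuity_pt_sqrt. lra.
  - apply continuity_pt_filterlim, continuity_pt_inv; [apply continuity_pt_id|].
    unfold id. assert (0 < sqrt (W alpha x)) by (apply sqrt_lt_R0; lra). lra.
Qed.

Lemma velocity_eq (x y : R) : velocity alpha x y = y / gf alpha x.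
Proof.
  unfold velocity, gf. fold (cf alpha x). unfold Rdiv.
  rewrite Rinv_mult, Rinv_inv. ring.
Qed.

Lemma u_eq (x y : R) : 0 < x < PI / 2 -> y = gf alpha x * velocity alpha x y.
Proof.
  intros H. rewrite velocity_eq. specialize (gf_pos x H). intros. field. lra.
Qed.

Lemma gf_sq (x : R) : 0 < x < PI / 2 -> gf alpha x ^ 2 * U alpha x = cf alpha x.
Proof.
  intros H. rewrite (U_eq x H). unfold gf. specialize (W_bounds x ltac:(lra)). intros HW.
  specialize (cf_pos x H). intros Hc.
  replace ((cf alpha x / sqrt (W alpha x)) ^ 2) with (cf alpha x ^ 2 / (sqrt (W alpha x) * sqrt (W alpha x))).
  - rewrite sqrt_sqrt by lra. field. lra.
  - field. assert (0 < sqrt (W alpha x)) by (apply sqrt_lt_R0; lra). lra.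
Qed.

Lemma velocity_sq (x y z : R) : 0 < x < PI / 2 ->
  z ^ 2 = cf alpha x * Qf alpha x y ->
  velocity alpha x z ^ 2 = 2 * U alpha x - y ^ 2.
Proof.
  intros H E. rewrite velocity_eq.
  specialize (gf_pos x H). specialize (gf_sq x H). specialize (U_pos (alpha := alpha) x).
  intros HU Hg Hgp. rewrite (Qf_interior x y H) in E. rewrite <- Hg in E.
  replace ((z / gf alpha x) ^ 2) with (z ^ 2 / gf alpha x ^ 2) by (field; lra).
  rewrite E. field. split; lra.
Qed.

Lemma sqrtW_Qf (x y z : R) : 0 < x < PI / 2 ->
  z ^ 2 = cf alpha x * Qf alpha x y ->
  sqrt (W alpha x) * Qf alpha x y = gf alpha x * velocity alpha x z ^ 2.
Proof.
  intros H E. rewrite velocity_eq. specialize (gf_pos x H). intros Hgp.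
  replace (gf alpha x * (z / gf alpha x) ^ 2) with (z ^ 2 / gf alpha x) by (field; lra).
  rewrite E. specialize (cf_pos x H). intros Hc. unfold gf.
  specialize (W_bounds x ltac:(lra)). intros HW.
  field. assert (0 < sqrt (W alpha x)) by (apply sqrt_lt_R0; lra). lra.
Qed.

Lemma orbit_at_ext (th v u th' v' u' : R -> R) (s : R) :
  locally s (fun t => th t = th' t /\ v t = v' t /\ u t = u' t) ->
  orbit_at alpha th v u s -> orbit_at alpha th' v' u' s.
Proof.
  intros Hl [H1 [H2 [H3 [H4 [H5 H6]]]]].
  assert (E := locally_singleton _ _ Hl). destruct E as [E1 [E2 E3]].
  unfold orbit_at. rewrite <- E1, <- E2, <- E3. split; trivial. split; trivial.
  split.
  { apply (is_derive_ext_loc th); trivial. revert Hl. apply filter_imp. tauto. }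
  split.
  { apply (is_derive_ext_loc v); trivial. revert Hl. apply filter_imp. tauto. }
  split.
  { intros Hi. apply (is_derive_ext_loc (fun t => velocity alpha (th t) (u t))); [|now apply H5].
    revert Hl. apply filter_imp. intros t [Et [_ Eu]]. now rewrite Et, Eu. }
  intros Hc. destruct (H6 Hc) as [e He]. destruct (locally_abs _ _ Hl) as [d [Hd0 Hd]].
  assert (Hm : 0 < Rmin e d) by (apply Rmin_pos; [apply cond_pos|trivial]).
  exists (mkposreal _ Hm). intros h Hh Hh0.
  assert (Hb : Rabs h < Rmin e d).
  { apply Rabs_def2 in Hh. simpl in Hh. unfold minus, plus, opp in Hh; simpl in Hh.
    apply Rabs_def1; lra. }
  assert (K1 := Rmin_l e d). assert (K2 := Rmin_r e d).
  destruct (Hd (s - h)) as [_ [_ <-]].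
  { replace (s - h - s) with (- h) by ring. rewrite Rabs_Ropp. lra. }
  destruct (Hd (s + h)) as [_ [_ <-]].
  { assert (X : s + h - s = h) by ring. rewrite X. lra. }
  apply He; trivial. unfold ball; simpl. unfold AbsRing_ball, abs, minus, plus, opp; simpl.
  assert (X : h + - 0 = h) by ring. rewrite X. lra.
Qed.

Lemma orbit_at_shift (th v u : R -> R) (c s : R) :
  orbit_at alpha th v u (s + c) ->
  orbit_at alpha (fun t => th (t + c)) (fun t => v (t + c)) (fun t => u (t + c)) s.
Proof.
  intros [H1 [H2 [H3 [H4 [H5 H6]]]]].
  assert (D : is_derive (fun t : R => t + c) s 1) by (auto_derive; trivial).
  split; trivial. split; trivial.
  split; [eapply derive_comp; [exact H3|exact D|exact (eq_sym (Rmult_1_r _))]|].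
  split; [eapply derive_comp; [exact H4|exact D|exact (eq_sym (Rmult_1_r _))]|].
  split.
  - intros Hi. eapply (derive_comp (fun t => velocity alpha (th t) (u t)) (fun t => t + c));
      [now apply H5|exact D|exact (eq_sym (Rmult_1_r _))].
  - intros Hc. generalize (H6 Hc). apply filter_imp. intros h.
    replace (s + c - h) with (s - h + c) by ring.
    now replace (s + c + h) with (s + h + c) by ring.
Qed.

(** The two symmetries of the flow: reversal of time, and the exchange of the
    two collisions. *)
Lemma orbit_at_reverse (th v u : R -> R) (s : R) :
  orbit_at alpha th v u (- s) ->
  orbit_at alpha (fun t => th (- t)) (fun t => - v (- t)) (fun t => - u (- t)) s.
Proof.
  intros [H1 [H2 [H3 [H4 [H5 H6]]]]].
  assert (D : is_derive (fun t : R => - t) s (- 1)) by (auto_derive; trivial).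
  assert (EQ : Qf alpha (th (- s)) (- v (- s)) = Qf alpha (th (- s)) (v (- s))).
  { unfold Qf. replace ((- v (- s)) ^ 2) with (v (- s) ^ 2) by ring. trivial. }
  assert (EV : forall x y, velocity alpha x (- y) = - velocity alpha x y).
  { intros x y. rewrite !velocity_eq. unfold Rdiv. ring. }
  split; trivial. rewrite EQ. split; [rewrite <- H2; ring|].
  split; [eapply derive_comp; [exact H3|exact D|ring]|].
  split.
  { eapply (derive_comp (fun x => - v x) (fun t => - t)); [|exact D|].
    - apply: is_derive_opp. exact H4.
    - unfold opp; simpl. ring. }
  split.
  - intros Hi. apply (is_derive_ext (fun t => - velocity alpha (th (- t)) (u (- t)))).
    { intros t. now rewrite EV. }
    rewrite EV.
    eapply (derive_comp (fun x => - velocity alpha (th x) (u x)) (fun t => - t)); [|exact D|].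
    + apply: is_derive_opp. now apply H5.
    + unfold opp; simpl. ring.
  - intros Hc. generalize (H6 Hc). apply filter_imp. intros h.
    replace (- (s - h)) with (- s + h) by ring.
    replace (- (s + h)) with (- s - h) by ring. nra.
Qed.

Lemma orbit_at_reflect (th v u : R -> R) (s : R) :
  orbit_at alpha th v u s ->
  orbit_at alpha (fun t => PI / 2 - th t) v (fun t => - u t) s.
Proof.
  intros [H1 [H2 [H3 [H4 [H5 H6]]]]].
  assert (EQ : forall x y, Qf alpha (PI / 2 - x) y = Qf alpha x y).
  { intros. unfold Qf. now rewrite cf_sym, W_sym. }
  assert (EG : forall x, gf alpha (PI / 2 - x) = gf alpha x).
  { intros. unfold gf. now rewrite cf_sym, W_sym. }
  assert (EV : forall x y, velocity alpha (PI / 2 - x) (- y) = - velocity alpha x y).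
  { intros x y. rewrite !velocity_eq, EG. unfold Rdiv. ring. }
  split; [lra|]. rewrite EQ, cf_sym, W_sym. split; [rewrite <- H2; ring|].
  split.
  { eapply derive_minus; [apply: is_derive_const|exact H3|]. unfold zero; simpl. ring. }
  split; trivial. split.
  - intros Hi. apply (is_derive_ext (fun t => - velocity alpha (th t) (u t))).
    { intros t. now rewrite EV. }
    eapply derive_eq; [apply: is_derive_opp; apply H5; lra|].
    rewrite EV, EG, U'_sym. unfold opp; simpl. ring.
  - intros Hc. generalize (H6 (proj1 (collision_sym _) Hc)). apply filter_imp.
    intros h. nra.
Qed.

Lemma orbit_at_derive (th v u : R -> R) (s : R) : orbit_at alpha th v u s ->
  is_derive th s (u s) /\
  is_derive v s ((1 - alpha / 2) * sqrt (W alpha (th s)) * Qf alpha (th s) (v s)).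
Proof. now intros [_ [_ [H3 [H4 _]]]]. Qed.

Lemma orbit_at_continuous (th v u : R -> R) (s : R) :
  orbit_at alpha th v u s -> continuous th s /\ continuous v s.
Proof.
  intros [H1 [H2 [H3 [H4 _]]]]. split; eapply continuous_of_derive; eassumption.
Qed.

Lemma Qf_nonneg (x y z : R) : 0 <= x <= PI / 2 ->
  z ^ 2 = cf alpha x * Qf alpha x y -> 0 <= Qf alpha x y.
Proof.
  intros H E. destruct (Req_dec (cf alpha x) 0) as [E0|E0].
  - unfold Qf. rewrite E0. unfold Rdiv. lra.
  - assert (K := cf_bounds (alpha := alpha) x). assert (0 < cf alpha x) by lra.
    assert (0 <= z ^ 2) by apply pow2_ge_0.
    apply Rnot_lt_le. intros L. nra.
Qed.

(** Near a collision [th] moves with [u ^ 2 = cf * Qf]; this bound makes [cf]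
    the only degenerate factor. *)
Lemma Qf_ge_1_near_collision (V : R) : 0 < V ->
  exists x1, 0 < x1 <= PI / 6 /\
    forall x y, 0 <= x <= x1 -> Rabs y <= V -> 1 <= Qf alpha x y.
Proof.
  intros HV. assert (HPI := PI_RGT_0).
  destruct (proj1 (continuous_abs (cf alpha) 0) (cf_continuous 0) (/ V ^ 2)) as [e [He0 He]].
  { apply Rinv_0_lt_compat. nra. }
  rewrite (cf_collision 0) in He by now left.
  exists (Rmin (e / 2) (PI / 6)).
  assert (K1 := Rmin_l (e / 2) (PI / 6)). assert (K2 := Rmin_r (e / 2) (PI / 6)).
  split; [split; [apply Rmin_pos; lra|lra]|]. intros x y Hx Hy.
  specialize (He x). rewrite !Rminus_0_r in He. rewrite (Rabs_right x) in He by lra.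
  specialize (He ltac:(lra)). assert (Hc := cf_bounds x). rewrite Rabs_right in He by lra.
  assert (HW := W_bounds x ltac:(lra)).
  assert (Hy2 : y ^ 2 <= V ^ 2).
  { rewrite <- (pow2_abs y). assert (P := Rabs_pos y). nra. }
  assert (Hyc : y ^ 2 * cf alpha x <= 1).
  { apply Rle_trans with (V ^ 2 * / V ^ 2).
    - apply Rmult_le_compat; [apply pow2_ge_0|lra|lra|lra].
    - rewrite Rinv_r; [lra|]. nra. }
  unfold Qf. assert (y ^ 2 * cf alpha x / W alpha x <= 1); [|lra].
  apply Rmult_le_reg_r with (W alpha x); [lra|].
  unfold Rdiv. rewrite Rmult_assoc, Rinv_l by lra. lra.
Qed.

Lemma u_bound (x y z : R) : 0 <= x <= PI / 2 ->
  z ^ 2 = cf alpha x * Qf alpha x y -> Rabs z <= 3 / 2.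
Proof.
  intros H E. assert (K := cf_bounds (alpha := alpha) x). assert (K1 := Qf_le_2 x y H).
  assert (K2 := Qf_nonneg x y z H E). apply Rabs_le. split; nra.
Qed.

Lemma v_rate_bound (x y z : R) : 0 <= x <= PI / 2 ->
  z ^ 2 = cf alpha x * Qf alpha x y ->
  0 <= (1 - alpha / 2) * sqrt (W alpha x) * Qf alpha x y <= 4.
Proof.
  intros H E. assert (K1 := Qf_le_2 x y H). assert (K2 := Qf_nonneg x y z H E).
  assert (HW := W_bounds x H). assert (Ha0 := alpha_bounds).
  assert (Hs := sqrtW_bounds x H).
  assert (0 <= (1 - alpha / 2) * sqrt (W alpha x) <= 2) by nra. nra.
Qed.

Lemma orbit_on_bounds (th v u : R -> R) (a b : R) : a <= b ->
  (forall s, a <= s <= b -> orbit_at alpha th v u s) ->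
  Rabs (th b - th a) <= 3 / 2 * (b - a) /\ 0 <= v b - v a <= 4 * (b - a).
Proof.
  intros Hab H. split; [|split].
  - apply lipschitz_of_derive; trivial.
    + intros x Hx. now apply (orbit_at_continuous th v u x), H.
    + intros x Hx. destruct (H x ltac:(lra)) as [H1 [H2 [H3 _]]].
      exists (u x). split; trivial. eapply u_bound; eassumption.
  - cut (v a <= v b); [lra|]. apply mono_le; trivial.
    + intros x Hx. now apply (orbit_at_continuous th v u x), H.
    + intros x Hx. destruct (H x ltac:(lra)) as [H1 [H2 [H3 [H4 _]]]].
      eexists. split; [exact H4|]. now apply (v_rate_bound _ _ (u x)).
  - apply growth_le; trivial.
    + intros x Hx. now apply (orbit_at_continuous th v u x), H.
    + intros x Hx. destruct (H x ltac:(lra)) as [H1 [H2 [H3 [H4 _]]]].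
      eexists. split; [exact H4|]. now apply (v_rate_bound _ _ (u x)).
Qed.

Lemma u_collision (th v u : R -> R) (s : R) :
  orbit_at alpha th v u s -> collision (th s) -> u s = 0.
Proof.
  intros [_ [H _]] Hc. rewrite (cf_collision _ Hc), Rmult_0_l in H. nra.
Qed.

(** At a collision this follows from [u ^ 2 <= 2 cf], elsewhere from the
    differentiability of the velocity. *)
Lemma u_continuous (th v u : R -> R) (s : R) :
  locally s (orbit_at alpha th v u) -> continuous u s.
Proof.
  intros Hl. assert (Hs := locally_singleton _ _ Hl).
  destruct (orbit_at_continuous _ _ _ _ Hs) as [Ct Cv].
  assert (Hs' := Hs). destruct Hs' as [H1 [H2 [H3 [H4 [H5 H6]]]]].
  destruct (classic (collision (th s))) as [Hc|Hc].
  - apply continuous_abs. intros eps He. rewrite (u_collision _ _ _ _ Hs Hc).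
    assert (Cc : continuous (fun t => cf alpha (th t)) s)
      by (apply (continuous_comp th (cf alpha)); trivial; apply cf_continuous).
    destruct (proj1 (continuous_abs _ _) Cc (eps ^ 2 / 2)) as [d [Hd0 Hd]]; [nra|].
    rewrite (cf_collision _ Hc) in Hd.
    destruct (locally_abs _ _ Hl) as [e [He0 Hel]].
    exists (Rmin d e). split; [now apply Rmin_pos|]. intros t Ht.
    assert (K1 := Rmin_l d e). assert (K2 := Rmin_r d e).
    destruct (Hel t ltac:(lra)) as [G1 [G2 _]].
    specialize (Hd t ltac:(lra)). apply Rabs_def2 in Hd.
    assert (G3 := Qf_le_2 (th t) (v t) G1). assert (G4 := Qf_nonneg _ _ _ G1 G2).
    assert (G5 := cf_bounds (alpha := alpha) (th t)).
    rewrite Rminus_0_r. apply Rabs_lt_of_sq; trivial. nra.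
  - assert (Hi := not_collision _ H1 Hc).
    assert (Hloc : locally s (fun t => 0 < th t < PI / 2)).
    { apply (Ct (fun x => 0 < x < PI / 2)). now apply (locally_of_lt _ 0 (PI / 2)). }
    apply (continuous_ext_loc _ (fun t => gf alpha (th t) * velocity alpha (th t) (u t))).
    + revert Hloc. apply filter_imp. intros t Ht. symmetry. now apply u_eq.
    + apply: continuous_mult.
      * apply (continuous_comp th (gf alpha)); trivial. now apply gf_continuous.
      * eapply continuous_of_derive. now apply H5.
Qed.

(** The required change of sign of [u] at a collision can only go one way, since
    [th] stays in [0, PI / 2]. *)
Lemma collision_sign_0 (th v u : R -> R) (a b s : R) :
  a < s < b -> (forall t, a < t < b -> orbit_at alpha th v u t) -> th s = 0 ->
  exists e, 0 < e /\ forall h, 0 < h < e -> u (s - h) < 0 /\ 0 < u (s + h).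
Proof.
  intros Hs Ho E. destruct (Ho s Hs) as [_ [_ [_ [_ [_ H6]]]]].
  destruct (H6 (or_introl E)) as [e He].
  assert (Hm : 0 < Rmin e (b - s)) by (apply Rmin_pos; [apply cond_pos|lra]).
  exists (Rmin e (b - s)). split; trivial.
  assert (K1 := Rmin_l e (b - s)). assert (K2 := Rmin_r e (b - s)).
  assert (Hprod : forall h, 0 < h < Rmin e (b - s) -> u (s - h) * u (s + h) < 0).
  { intros h Hh. apply He; [|lra]. unfold ball; simpl.
    unfold AbsRing_ball, abs, minus, plus, opp; simpl.
    rewrite Rabs_right; lra. }
  assert (Hpos : forall h, 0 < h < Rmin e (b - s) -> 0 < u (s + h)).
  { intros h Hh. apply Rnot_le_lt. intros K.
    assert (Hn : forall t, s < t <= s + h -> u t <> 0).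
    { intros t Ht Z. specialize (Hprod (t - s) ltac:(lra)).
      replace (s + (t - s)) with t in Hprod by ring. rewrite Z in Hprod. lra. }
    assert (Hc : forall t, s < t <= s + h -> continuous u t).
    { intros t Ht. apply (u_continuous th v u). apply (locally_of_lt _ a b); [lra|trivial]. }
    assert (Hneg : forall t, s < t <= s + h -> u t < 0).
    { intros t Ht. apply Rnot_le_lt. intros P.
      assert (0 < u (s + h)).
      { apply (sign_pos u t (s + h)); [lra| | |].
        - intros x Hx. apply Hc. lra.
        - intros x Hx. apply Hn. lra.
        - specialize (Hn t Ht). lra. }
      lra. }
    assert (- th s < - th (s + h)).
    { apply (mono_lt (fun x => - th x)); [lra| |].
      - intros x Hx. apply: continuous_opp.
        apply (orbit_at_continuous th v u x), Ho. lra.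
      - intros x Hx. exists (- u x). split.
        + apply: is_derive_opp. apply Ho. lra.
        + specialize (Hneg x ltac:(lra)). lra. }
    destruct (Ho (s + h) ltac:(lra)) as [G _]. lra. }
  intros h Hh. specialize (Hprod h Hh). specialize (Hpos h Hh). split; trivial. nra.
Qed.

Lemma collision_sign_PI2 (th v u : R -> R) (a b s : R) :
  a < s < b -> (forall t, a < t < b -> orbit_at alpha th v u t) -> th s = PI / 2 ->
  exists e, 0 < e /\ forall h, 0 < h < e -> 0 < u (s - h) /\ u (s + h) < 0.
Proof.
  intros Hs Ho E.
  destruct (collision_sign_0 (fun t => PI / 2 - th t) v (fun t => - u t) a b s)
    as [e [He0 He]]; trivial.
  - intros t Ht. now apply orbit_at_reflect, Ho.
  - lra.
  - exists e. split; trivial. intros h Hh. specialize (He h Hh). lra.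
Qed.

Definition glue (b : R) (f g : R -> R) (s : R) : R := if Rle_dec s b then f s else g s.

(** The junction may be a collision: by the two previous lemmas both segments
    have the same signs of [u] just before and just after it. *)
Lemma orbit_glue (th v u th' v' u' : R -> R) (a b c e : R) :
  a < b < c -> 0 < e ->
  (forall s, a < s < b + e -> orbit_at alpha th v u s) ->
  (forall s, b - e < s < c -> orbit_at alpha th' v' u' s) ->
  th b = th' b -> v b = v' b -> u b = u' b ->
  forall s, a < s < c ->
    orbit_at alpha (glue b th th') (glue b v v') (glue b u u') s.
Proof.
  intros Hb He Ho Ho' Et Ev Eu s Hs.
  destruct (Rtotal_order s b) as [L|[->|G]].
  - apply (orbit_at_ext th v u); [|apply Ho; lra].
    apply (locally_of_lt _ a b); [lra|]. intros t Ht. unfold glue.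
    destruct (Rle_dec t b); [tauto|lra].
  - assert (Eb : forall f g : R -> R, glue b f g b = f b).
    { intros f g. unfold glue. destruct (Rle_dec b b); [trivial|lra]. }
    assert (O1 := Ho b ltac:(lra)). assert (O2 := Ho' b ltac:(lra)).
    destruct O1 as [H1 [H2 [H3 [H4 [H5 H6]]]]].
    destruct O2 as [G1 [G2 [G3 [G4 [G5 G6]]]]].
    unfold orbit_at. rewrite !Eb. rewrite <- Et, <- Ev in G4. rewrite <- Eu in G3.
    rewrite <- Et, <- Ev, <- Eu in G5.
    split; trivial. split; trivial.
    split; [now apply derive_glue|]. split; [now apply derive_glue|]. split.
    + intros Hi.
      apply (is_derive_ext (glue b (fun t => velocity alpha (th t) (u t))
                                   (fun t => velocity alpha (th' t) (u' t)))).
      { intros t. unfold glue. now destruct (Rle_dec t b). }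
      apply derive_glue; [now apply H5|now apply G5|now rewrite Et, Eu].
    + intros Hc.
      assert (K : exists d, 0 < d /\ forall h, 0 < h < d -> u (b - h) * u' (b + h) < 0).
      { destruct Hc as [Hc|Hc].
        - destruct (collision_sign_0 th v u a (b + e) b) as [d1 [P1 D1]]; trivial; [lra|].
          destruct (collision_sign_0 th' v' u' (b - e) c b) as [d2 [P2 D2]]; trivial; [lra|lra|].
          exists (Rmin d1 d2). split; [now apply Rmin_pos|]. intros h Hh.
          assert (K1 := Rmin_l d1 d2). assert (K2 := Rmin_r d1 d2).
          destruct (D1 h ltac:(lra)) as [X1 _]. destruct (D2 h ltac:(lra)) as [_ X2]. nra.
        - destruct (collision_sign_PI2 th v u a (b + e) b) as [d1 [P1 D1]]; trivial; [lra|].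
          destruct (collision_sign_PI2 th' v' u' (b - e) c b) as [d2 [P2 D2]]; trivial; [lra|lra|].
          exists (Rmin d1 d2). split; [now apply Rmin_pos|]. intros h Hh.
          assert (K1 := Rmin_l d1 d2). assert (K2 := Rmin_r d1 d2).
          destruct (D1 h ltac:(lra)) as [X1 _]. destruct (D2 h ltac:(lra)) as [_ X2]. nra. }
      destruct K as [d [Hd0 Hd]]. exists (mkposreal _ Hd0). intros h Hh Hh0.
      apply Rabs_def2 in Hh. simpl in Hh. unfold minus, plus, opp in Hh; simpl in Hh.
      unfold glue. destruct (Rle_dec (b - h) b); [|lra].
      destruct (Rle_dec (b + h) b); [lra|]. apply Hd. lra.
  - apply (orbit_at_ext th' v' u'); [|apply Ho'; lra].
    apply (locally_of_lt _ b c); [lra|]. intros t Ht. unfold glue.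
    destruct (Rle_dec t b); [lra|tauto].
Qed.

End Orbits.

(** * Bounded Lipschitz functions *)

(** Bounded Lipschitz functions form an algebra, closed under composition: this
    is how the vector field is seen to be Lipschitz away from collisions. *)
Definition BL {E : NormedModule R_AbsRing} (D : E -> Prop) (f : E -> R) : Prop :=
  exists M L, 0 <= L /\ (forall x, D x -> Rabs (f x) <= M) /\
    forall x y, D x -> D y -> Rabs (f x - f y) <= L * norm (minus x y).

Section BoundedLipschitz.
Context {E : NormedModule R_AbsRing} (D : E -> Prop).

Lemma BL_ext (f g : E -> R) : (forall x, D x -> f x = g x) -> BL D f -> BL D g.
Proof.
  intros H [M [L [H1 [H2 H3]]]]. exists M, L. split; trivial. split.
  - intros x Hx. rewrite <- H by trivial. now apply H2.
  - intros x y Hx Hy. rewrite <- !H by trivial. now apply H3.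
Qed.

Lemma BL_const (c : R) : BL D (fun _ => c).
Proof.
  exists (Rabs c), 0. split; [lra|]. split; [intros; lra|].
  intros. rewrite Rminus_diag_eq, Rabs_R0; lra.
Qed.

Lemma BL_plus (f g : E -> R) : BL D f -> BL D g -> BL D (fun x => f x + g x).
Proof.
  intros [M [L [H1 [H2 H3]]]] [M' [L' [H1' [H2' H3']]]].
  exists (M + M'), (L + L'). split; [lra|]. split.
  - intros x Hx. apply Rle_trans with (1 := Rabs_triang _ _).
    specialize (H2 x Hx). specialize (H2' x Hx). lra.
  - intros x y Hx Hy.
    replace (f x + g x - (f y + g y)) with ((f x - f y) + (g x - g y)) by ring.
    apply Rle_trans with (1 := Rabs_triang _ _).
    specialize (H3 x y Hx Hy). specialize (H3' x y Hx Hy). lra.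
Qed.

Lemma BL_mult (f g : E -> R) : BL D f -> BL D g -> BL D (fun x => f x * g x).
Proof.
  intros [M [L [H1 [H2 H3]]]] [M' [L' [H1' [H2' H3']]]].
  exists (Rabs M * Rabs M'), (Rabs M * L' + Rabs M' * L).
  assert (P1 := Rabs_pos M). assert (P2 := Rabs_pos M').
  split; [nra|]. split.
  - intros x Hx. rewrite Rabs_mult.
    apply Rmult_le_compat; try apply Rabs_pos.
    + apply Rle_trans with (1 := H2 x Hx), Rle_abs.
    + apply Rle_trans with (1 := H2' x Hx), Rle_abs.
  - intros x y Hx Hy.
    replace (f x * g x - f y * g y) with (f x * (g x - g y) + g y * (f x - f y)) by ring.
    apply Rle_trans with (1 := Rabs_triang _ _). rewrite !Rabs_mult, Rmult_plus_distr_r.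
    rewrite !Rmult_assoc.
    apply Rplus_le_compat; apply Rmult_le_compat; try apply Rabs_pos.
    + apply Rle_trans with (1 := H2 x Hx), Rle_abs.
    + now apply H3'.
    + apply Rle_trans with (1 := H2' y Hy), Rle_abs.
    + now apply H3.
Qed.

Lemma BL_comp (D' : R -> Prop) (phi : R -> R) (f : E -> R) :
  BL (E := R_NormedModule) D' phi -> BL D f -> (forall x, D x -> D' (f x)) ->
  BL D (fun x => phi (f x)).
Proof.
  intros [M [L [H1 [H2 H3]]]] [M' [L' [H1' [H2' H3']]]] HD.
  exists M, (L * L'). split; [nra|]. split.
  - intros x Hx. now apply H2, HD.
  - intros x y Hx Hy. apply Rle_trans with (1 := H3 _ _ (HD x Hx) (HD y Hy)).
    rewrite Rmult_assoc. apply Rmult_le_compat_l; trivial. now apply H3'.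
Qed.

End BoundedLipschitz.

Lemma BL_C1 (f f' : R -> R) (a b : R) :
  (forall x, a <= x <= b -> is_derive f x (f' x)) ->
  (forall x, a <= x <= b -> continuous f' x) ->
  BL (E := R_NormedModule) (fun x => a <= x <= b) f.
Proof.
  intros Hd Hc. destruct (Rle_dec a b) as [Hab|N].
  2:{ exists 0, 0. split; [lra|]. split; intros; lra. }
  assert (Hf : forall x, a <= x <= b -> continuous f x).
  { intros x Hx. now apply (continuous_of_derive f x (f' x)), Hd. }
  assert (Hbd : forall g : R -> R, (forall x, a <= x <= b -> continuous g x) ->
     exists M, forall x, a <= x <= b -> Rabs (g x) <= M).
  { intros g Hg.
    destruct (Rtopology.continuity_ab_maj g a b Hab) as [x1 [H1 _]].
    { intros c Hcc. now apply continuity_pt_filterlim, Hg. }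
    destruct (Rtopology.continuity_ab_min g a b Hab) as [x2 [H2 _]].
    { intros c Hcc. now apply continuity_pt_filterlim, Hg. }
    exists (Rabs (g x1) + Rabs (g x2)). intros x Hx.
    specialize (H1 x Hx). specialize (H2 x Hx).
    assert (K1 := Rle_abs (g x1)). assert (K2 := Rle_abs (- g x2)).
    rewrite Rabs_Ropp in K2.
    assert (K3 := Rabs_pos (g x1)). assert (K4 := Rabs_pos (g x2)).
    apply Rabs_le. lra. }
  destruct (Hbd f Hf) as [M HM]. destruct (Hbd f' Hc) as [L HL].
  assert (0 <= L) by (apply Rle_trans with (2 := HL a ltac:(lra)); apply Rabs_pos).
  exists M, L. split; trivial. split; trivial.
  assert (W : forall x y, x <= y -> a <= x <= b -> a <= y <= b -> Rabs (f y - f x) <= L * (y - x)).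
  { intros x y Hxy Hx Hy. apply lipschitz_of_derive; trivial.
    - intros z Hz. apply Hf. lra.
    - intros z Hz. exists (f' z). split; [apply Hd|apply HL]; lra. }
  intros x y Hx Hy. unfold norm, minus, plus, opp; simpl. unfold abs; simpl.
  destruct (Rle_dec x y) as [H1|H1].
  - rewrite Rabs_minus_sym. rewrite (Rabs_left1 (x + - y)) by lra.
    assert (K := W x y H1 Hx Hy). lra.
  - rewrite (Rabs_right (x + - y)) by lra. apply W; trivial. lra.
Qed.

Lemma BL_Rpower (m M p : R) : 0 < m ->
  BL (E := R_NormedModule) (fun x => m <= x <= M) (fun x => Rpower x p).
Proof.
  intros Hm. apply (BL_C1 _ (fun x => p * Rpower x (p - 1))).
  - intros x Hx. apply is_derive_Reals, derivable_pt_lim_power. lra.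
  - intros x Hx. apply (continuous_of_derive _ _ (p * ((p - 1) * Rpower x (p - 1 - 1)))).
    eapply derive_scal; [apply is_derive_Reals, derivable_pt_lim_power; lra|reflexivity].
Qed.

Definition clamp (a b x : R) : R := Rmax a (Rmin b x).

Lemma clamp_id (a b x : R) : a <= x <= b -> clamp a b x = x.
Proof.
  intros H. unfold clamp. rewrite Rmin_right by lra. now apply Rmax_right.
Qed.

Lemma clamp_in (a b x : R) : a <= b -> a <= clamp a b x <= b.
Proof.
  intros H. unfold clamp, Rmax, Rmin. destruct (Rle_dec b x), (Rle_dec a _); lra.
Qed.

Lemma clamp_lipschitz (a b x y : R) : Rabs (clamp a b x - clamp a b y) <= Rabs (x - y).
Proof.
  unfold clamp, Rmax, Rmin.
  destruct (Rle_dec b x), (Rle_dec b y); repeat destruct (Rle_dec a _);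
    unfold Rabs; repeat destruct Rcase_abs; lra.
Qed.

Lemma clamp_continuous (a b x : R) : continuous (clamp a b) x.
Proof.
  apply continuous_abs. intros eps He. exists eps. split; trivial. intros t Ht.
  apply Rle_lt_trans with (1 := clamp_lipschitz _ _ _ _) (2 := Ht).
Qed.

(** * Existence of orbits away from collisions *)

Section ProductComplete.
Context (A B : CompleteNormedModule R_AbsRing).

Let AB := prod_NormedModule R_AbsRing A B.

Lemma prod_lim_cauchy (F : (AB -> Prop) -> Prop) : ProperFilter F -> cauchy F ->
  forall eps : posreal,
    F (ball ((lim (filtermap fst F), lim (filtermap snd F)) : AB) eps).
Proof.
  intros HF Hc eps. apply filter_and.
  - apply: (complete_cauchy (filtermap (fst : AB -> A) F)).
    intros e. destruct (Hc e) as [x Hx]. exists (fst x).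
    unfold filtermap. revert Hx. apply filter_imp. intros y Hy. apply Hy.
  - apply: (complete_cauchy (filtermap (snd : AB -> B) F)).
    intros e. destruct (Hc e) as [x Hx]. exists (snd x).
    unfold filtermap. revert Hx. apply filter_imp. intros y Hy. apply Hy.
Qed.

Lemma prod_lim_close (F G : (AB -> Prop) -> Prop) : filter_le F G -> filter_le G F ->
  close ((lim (filtermap fst F), lim (filtermap snd F)) : AB)
        (lim (filtermap fst G), lim (filtermap snd G)).
Proof.
  intros H1 H2 eps. split.
  - apply: close_lim; intros P; [apply H1|apply H2].
  - apply: close_lim; intros P; [apply H1|apply H2].
Qed.

Definition prod_CompleteNormedModule : CompleteNormedModule R_AbsRing :=
  CompleteNormedModule.Pack R_AbsRing (A * B)
    (CompleteNormedModule.Class R_AbsRing (A * B) (NormedModule.class R_AbsRing AB)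
      (CompleteSpace.Mixin (prod_UniformSpace A B) _ prod_lim_cauchy prod_lim_close)) (A * B).

End ProductComplete.

(** States are kept as [((th, v), w)], with the unregularized velocity [w],
    because the equations are smooth in these variables away from collisions. *)
Definition E3 : CompleteNormedModule R_AbsRing :=
  prod_CompleteNormedModule (prod_CompleteNormedModule R_CompleteNormedModule R_CompleteNormedModule)
    R_CompleteNormedModule.

Definition th_of (X : E3) : R := fst (fst X).
Definition v_of (X : E3) : R := snd (fst X).
Definition w_of (X : E3) : R := snd X.
Definition state (x y z : R) : E3 := ((x, y), z).

Lemma norm_E3_sq (X : E3) : norm X ^ 2 = th_of X ^ 2 + v_of X ^ 2 + w_of X ^ 2.
Proof.
  destruct X as [[x y] z]. unfold th_of, v_of, w_of; simpl fst; simpl snd.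
  change (norm _) with (sqrt (sqrt (Rabs x ^ 2 + Rabs y ^ 2) ^ 2 + Rabs z ^ 2)).
  rewrite <- (pow2_abs x), <- (pow2_abs y), <- (pow2_abs z).
  assert (K1 := pow2_ge_0 (Rabs x)). assert (K2 := pow2_ge_0 (Rabs y)).
  assert (K3 := pow2_ge_0 (Rabs z)).
  rewrite !pow2_sqrt; trivial; rewrite ?pow2_sqrt; lra.
Qed.

Lemma norm_E3_ge (X : E3) :
  Rabs (th_of X) <= norm X /\ Rabs (v_of X) <= norm X /\ Rabs (w_of X) <= norm X.
Proof.
  assert (H := norm_E3_sq X). assert (H0 := norm_ge_0 X).
  repeat split; apply Rabs_le; split; nra.
Qed.

Lemma norm_E3_le (X : E3) : norm X <= Rabs (th_of X) + Rabs (v_of X) + Rabs (w_of X).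
Proof.
  assert (H := norm_E3_sq X). assert (H0 := norm_ge_0 X).
  rewrite <- (pow2_abs (th_of X)), <- (pow2_abs (v_of X)), <- (pow2_abs (w_of X)) in H.
  assert (K1 := Rabs_pos (th_of X)). assert (K2 := Rabs_pos (v_of X)).
  assert (K3 := Rabs_pos (w_of X)). apply Rnot_lt_le. intros K.
  assert ((Rabs (th_of X) + Rabs (v_of X) + Rabs (w_of X)) ^ 2 < norm X ^ 2) by nra. nra.
Qed.

Lemma minus_E3 (X Y : E3) : th_of (minus X Y) = th_of X - th_of Y /\ v_of (minus X Y) = v_of X - v_of Y /\ w_of (minus X Y) = w_of X - w_of Y.
Proof. now destruct X as [[x y] z], Y as [[x' y'] z']. Qed.

Lemma derive_E3 (X : R -> E3) (t : R) (l : E3) : is_derive X t l ->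
  is_derive (fun s => th_of (X s)) t (th_of l) /\
  is_derive (fun s => v_of (X s)) t (v_of l) /\
  is_derive (fun s => w_of (X s)) t (w_of l).
Proof.
  intros H.
  assert (W : forall p : E3 -> R_NormedModule, is_linear p ->
            is_derive (fun s => p (X s)) t (p l)).
  { intros p Hp. unfold is_derive.
    apply (filterdiff_ext_lin _ (fun y : R_AbsRing => p (scal y l))).
    - apply (filterdiff_comp' X p t (fun y : R_AbsRing => scal y l) p); [exact H|].
      now apply filterdiff_linear.
    - intros y. now apply (linear_scal p Hp). }
  split; [|split]; apply W.
  - split; [reflexivity|reflexivity|]. exists 1. split; [lra|].
    intros Y. rewrite Rmult_1_l. apply norm_E3_ge.
  - split; [reflexivity|reflexivity|]. exists 1. split; [lra|].
    intros Y. rewrite Rmult_1_l. apply norm_E3_ge.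
  - split; [reflexivity|reflexivity|]. exists 1. split; [lra|].
    intros Y. rewrite Rmult_1_l. apply norm_E3_ge.
Qed.

Section Interior.
Context {alpha : R} {Ha : admissible alpha}.
Set Default Proof Using "All".

Let interior_range (d : R) : R -> Prop := fun x => d <= x <= PI / 2 - d.

Lemma sin_cos_range (d x : R) : 0 < d < PI / 4 -> d <= x <= PI / 2 - d ->
  sin d <= sin x <= 1 /\ sin d <= cos x <= 1 /\ 0 < sin d.
Proof.
  intros Hd Hx. assert (HPI := PI_RGT_0).
  assert (K1 := SIN_bound x). assert (K2 := COS_bound x).
  repeat split; try lra.
  - apply sin_incr_1; lra.
  - rewrite <- (sin_compl (alpha := alpha) x). apply sin_incr_1; lra.
  - apply sin_gt_0; lra.
Qed.

Lemma BL_sin (d p : R) : 0 < d < PI / 4 ->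
  BL (E := R_NormedModule) (interior_range d) (fun x => Rpower (sin x) p).
Proof.
  intros Hd. assert (HPI := PI_RGT_0).
  apply (BL_comp _ (fun y => sin d <= y <= 1) (fun y => Rpower y p) sin).
  - apply BL_Rpower. apply sin_gt_0; lra.
  - apply (BL_C1 sin cos).
    + intros x _. apply is_derive_Reals, derivable_pt_lim_sin.
    + intros x _. apply continuity_pt_filterlim, continuity_cos.
  - intros x Hx. now apply (sin_cos_range d x).
Qed.

Lemma BL_cos (d p : R) : 0 < d < PI / 4 ->
  BL (E := R_NormedModule) (interior_range d) (fun x => Rpower (cos x) p).
Proof.
  intros Hd. assert (HPI := PI_RGT_0).
  apply (BL_comp _ (fun y => sin d <= y <= 1) (fun y => Rpower y p) cos).
  - apply BL_Rpower. apply sin_gt_0; lra.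
  - apply (BL_C1 cos (fun x => - sin x)).
    + intros x _. apply is_derive_Reals, derivable_pt_lim_cos.
    + intros x _. apply: continuous_opp. apply continuity_pt_filterlim, continuity_sin.
  - intros x Hx. now apply (sin_cos_range d x).
Qed.

Lemma BL_sincos (d : R) (f f' : R -> R) :
  (forall x, is_derive f x (f' x)) -> (forall x, continuous f' x) ->
  BL (E := R_NormedModule) (interior_range d) f.
Proof. intros H1 H2. apply (BL_C1 f f'); intros; [apply H1|apply H2]. Qed.

Lemma BL_U' (d : R) : 0 < d < PI / 4 ->
  BL (E := R_NormedModule) (interior_range d) (U' alpha).
Proof.
  intros Hd. unfold U'. apply BL_mult; [apply BL_const|].
  apply (BL_ext _ (fun x => sin x * Rpower (cos x) (- alpha - 1)
                  + (- 1) * (cos x * Rpower (sin x) (- alpha - 1)))).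
  { intros x _. ring. }
  apply BL_plus; [|apply BL_mult; [apply BL_const|]]; apply BL_mult.
  - apply (BL_sincos d sin cos).
    + intros x. apply is_derive_Reals, derivable_pt_lim_sin.
    + intros x. apply continuity_pt_filterlim, continuity_cos.
  - now apply BL_cos.
  - apply (BL_sincos d cos (fun x => - sin x)).
    + intros x. apply is_derive_Reals, derivable_pt_lim_cos.
    + intros x. apply: continuous_opp. apply continuity_pt_filterlim, continuity_sin.
  - now apply BL_sin.
Qed.

Lemma BL_U (d : R) : 0 < d < PI / 4 ->
  BL (E := R_NormedModule) (interior_range d) (U alpha).
Proof.
  intros Hd. unfold U. apply BL_mult; [apply BL_const|].
  apply BL_plus; [apply BL_plus; [apply BL_const|now apply BL_sin]|now apply BL_cos].
Qed.

Lemma BL_gf (d : R) : 0 < d < PI / 4 ->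
  BL (E := R_NormedModule) (interior_range d) (gf alpha).
Proof.
  intros Hd.
  assert (Hi : forall x, interior_range d x -> 0 < x < PI / 2) by (unfold interior_range; intros; lra).
  pose (Wi x := Rpower (sin x) alpha * Rpower (cos x) alpha
                + Rpower (sin x) alpha + Rpower (cos x) alpha).
  assert (BS := BL_sin d alpha Hd). assert (BC := BL_cos d alpha Hd).
  apply (BL_ext _ (fun x => Rpower 2 alpha * (Rpower (sin x) alpha * Rpower (cos x) alpha)
                     * Rpower (Wi x) (- / 2))).
  { intros x Hx. specialize (Hi x Hx). unfold gf, Wi.
    rewrite (cf_interior x Hi), (W_interior x Hi), Rpower_Ropp, Rpower_sqrt; trivial.
    rewrite <- (W_interior x Hi). assert (K := W_bounds x ltac:(lra)). lra. }
  apply BL_mult; [apply BL_mult; [apply BL_const|now apply BL_mult]|].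
  apply (BL_comp _ (fun y => 1 <= y <= 3) (fun y => Rpower y (- / 2)) Wi).
  - apply BL_Rpower. lra.
  - apply BL_plus; trivial. apply BL_plus; trivial. now apply BL_mult.
  - intros x Hx. specialize (Hi x Hx). unfold Wi. rewrite <- (W_interior x Hi).
    apply W_bounds. lra.
Qed.

End Interior.

Section InteriorOrbits.
Context {alpha : R} {Ha : admissible alpha}.
Set Default Proof Using "All".

(** The equations for [(th, v, w)] in the regularized time, cut off outside the
    box [d <= th <= PI / 2 - d], [|v|, |w| <= V], so as to be globally
    Lipschitz. *)
Definition field (d V : R) (X : E3) : E3 :=
  let x := clamp d (PI / 2 - d) (th_of X) in
  let y := clamp (- V) V (v_of X) in
  let z := clamp (- V) V (w_of X) in
  state (gf alpha x * z)
        ((1 - alpha / 2) * (gf alpha x * (z * z)))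
        (gf alpha x * ((alpha / 2 - 1) * (y * z) + U' alpha x)).

Lemma BL_clamp (p : E3 -> R) (a b : R) : a <= b ->
  (forall X Y, Rabs (p X - p Y) <= norm (minus X Y)) ->
  BL (fun _ : E3 => True) (fun X => clamp a b (p X)).
Proof.
  intros Hab Hp. exists (Rabs a + Rabs b), 1. split; [lra|]. split.
  - intros X _. assert (K := clamp_in a b (p X) Hab).
    assert (K1 := Rle_abs (- a)). assert (K2 := Rle_abs b). rewrite Rabs_Ropp in K1.
    assert (K3 := Rabs_pos a). assert (K4 := Rabs_pos b). apply Rabs_le. lra.
  - intros X Y _ _. rewrite Rmult_1_l.
    apply Rle_trans with (1 := clamp_lipschitz _ _ _ _). apply Hp.
Qed.

Lemma field_lipschitz (d V : R) : 0 < d < PI / 4 -> 0 <= V ->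
  exists M L, 0 <= L /\ (forall X, norm (field d V X) <= M) /\
    forall X Y, norm (minus (field d V X) (field d V Y)) <= L * norm (minus X Y).
Proof.
  intros Hd HV. assert (HPI := PI_RGT_0).
  assert (Bx : BL (fun _ : E3 => True) (fun X => clamp d (PI / 2 - d) (th_of X))).
  { apply BL_clamp; [lra|]. intros X Y.
    destruct (minus_E3 X Y) as [<- _]. apply norm_E3_ge. }
  assert (By : BL (fun _ : E3 => True) (fun X => clamp (- V) V (v_of X))).
  { apply BL_clamp; [lra|]. intros X Y.
    destruct (minus_E3 X Y) as [_ [<- _]]. apply norm_E3_ge. }
  assert (Bz : BL (fun _ : E3 => True) (fun X => clamp (- V) V (w_of X))).
  { apply BL_clamp; [lra|]. intros X Y.
    destruct (minus_E3 X Y) as [_ [_ <-]]. apply norm_E3_ge. }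
  assert (Hin : forall X : E3, True -> d <= clamp d (PI / 2 - d) (th_of X) <= PI / 2 - d).
  { intros X _. apply clamp_in. lra. }
  assert (Bg := BL_comp _ _ _ _ (BL_gf d Hd) Bx Hin).
  assert (Bu := BL_comp _ _ _ _ (BL_U' d Hd) Bx Hin).
  assert (B1 : BL (fun _ : E3 => True) (fun X => th_of (field d V X))).
  { unfold field, state, th_of; simpl. now apply BL_mult. }
  assert (B2 : BL (fun _ : E3 => True) (fun X => v_of (field d V X))).
  { unfold field, state, v_of; simpl. apply BL_mult; [apply BL_const|].
    apply BL_mult; trivial. now apply BL_mult. }
  assert (B3 : BL (fun _ : E3 => True) (fun X => w_of (field d V X))).
  { unfold field, state, w_of; simpl. apply BL_mult; trivial.
    apply BL_plus; trivial. apply BL_mult; [apply BL_const|]. now apply BL_mult. }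
  destruct B1 as [M1 [L1 [P1 [Q1 R1]]]], B2 as [M2 [L2 [P2 [Q2 R2]]]],
    B3 as [M3 [L3 [P3 [Q3 R3]]]].
  exists (M1 + M2 + M3), (L1 + L2 + L3). split; [lra|]. split.
  - intros X. apply Rle_trans with (1 := norm_E3_le _).
    specialize (Q1 X I). specialize (Q2 X I). specialize (Q3 X I). lra.
  - intros X Y. apply Rle_trans with (1 := norm_E3_le _).
    destruct (minus_E3 (field d V X) (field d V Y)) as [-> [-> ->]].
    rewrite !Rmult_plus_distr_r.
    repeat apply Rplus_le_compat; [now apply R1|now apply R2|now apply R3].
Qed.

Lemma field_inside (d V : R) (X : E3) :
  d <= th_of X <= PI / 2 - d -> Rabs (v_of X) <= V -> Rabs (w_of X) <= V ->
  th_of (field d V X) = gf alpha (th_of X) * w_of X /\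
  v_of (field d V X) = (1 - alpha / 2) * (gf alpha (th_of X) * w_of X ^ 2) /\
  w_of (field d V X) = gf alpha (th_of X) *
     ((alpha / 2 - 1) * v_of X * w_of X + U' alpha (th_of X)).
Proof.
  intros H1 H2 H3. apply Rabs_le_between in H2. apply Rabs_le_between in H3.
  unfold field. rewrite (clamp_id _ _ (th_of X)), (clamp_id _ _ (v_of X)),
    (clamp_id _ _ (w_of X)) by lra.
  unfold state, th_of, v_of, w_of; simpl. repeat split; ring.
Qed.

Lemma constant_of_derive (f : R -> R) (a b x y : R) :
  (forall t, a < t < b -> is_derive f t 0) -> a < x < b -> a < y < b -> f x = f y.
Proof.
  intros H.
  assert (W : forall x y, a < x < b -> a < y < b -> x <= y -> f x = f y).
  { clear x y. intros x y Hx Hy Hxy. apply Rle_antisym.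
    - apply mono_le; trivial.
      + intros t Ht. apply (continuous_of_derive f t 0), H. lra.
      + intros t Ht. exists 0. split; [apply H|]; lra.
    - apply mono_ge; trivial.
      + intros t Ht. apply (continuous_of_derive f t 0), H. lra.
      + intros t Ht. exists 0. split; [apply H|]; lra. }
  intros Hx Hy. destruct (Rle_dec x y); [now apply W|]. symmetry. apply W; trivial. lra.
Qed.

Lemma displacement_bound (f : R -> R) (M h t : R) :
  (forall s, Rabs s < h -> exists l : R, is_derive f s l /\ Rabs l <= M) ->
  Rabs t < h -> Rabs (f t - f 0) <= M * Rabs t.
Proof.
  intros H Ht. apply Rabs_def2 in Ht as Ht'.
  assert (Hc : forall s, Rabs s < h -> continuous f s).
  { intros s Hs. destruct (H s Hs) as [l [Hl _]]. now apply (continuous_of_derive f s l). }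
  destruct (Rle_dec 0 t).
  - rewrite (Rabs_right t) by lra. replace (M * t) with (M * (t - 0)) by ring.
    apply lipschitz_of_derive; trivial.
    + intros x Hx. apply Hc. apply Rabs_def1; lra.
    + intros x Hx. apply H. apply Rabs_def1; lra.
  - rewrite (Rabs_left t) by lra. rewrite Rabs_minus_sym.
    replace (M * - t) with (M * (0 - t)) by ring.
    apply lipschitz_of_derive; [lra| |].
    + intros x Hx. apply Hc. apply Rabs_def1; lra.
    + intros x Hx. apply H. apply Rabs_def1; lra.
Qed.

(** Picard-Lindelof for the truncated field, over a time so short that the
    solution does not leave the box. The energy relation is an integral of the
    motion, so the solution stays on the manifold. *)
Lemma local_orbit_interior (d V : R) : 0 < d < PI / 4 -> 0 <= V ->
  exists h, 0 < h /\ forall x y z,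
    parabolic_manifold alpha (x, y, z) -> d <= x <= PI / 2 - d -> Rabs y <= V ->
    exists th v u, th 0 = x /\ v 0 = y /\ u 0 = z /\
      forall s, Rabs s < h -> orbit_at alpha th v u s.
Proof.
  intros Hd HV. assert (HPI := PI_RGT_0).
  destruct (BL_U d Hd) as [MU [_ [_ [HMU _]]]].
  assert (HMU0 : 0 <= MU).
  { apply Rle_trans with (2 := HMU d ltac:(lra)). apply Rabs_pos. }
  (* room for the speed, as w ^ 2 <= 2 U <= 2 MU initially *)
  pose (B := V + 2 * MU + 2).
  destruct (field_lipschitz (d / 2) B) as [M [L [HL0 [HM HL]]]]; [lra|unfold B; lra|].
  assert (HM0 : 0 <= M) by (apply Rle_trans with (2 := HM zero); apply norm_ge_0).
  pose (h := Rmin (/ (2 * (L + 1))) (d / (4 * (M + 1)))).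
  assert (Hh1 : h <= / (2 * (L + 1))) by apply Rmin_l.
  assert (Hh2 : h <= d / (4 * (M + 1))) by apply Rmin_r.
  assert (Hh : 0 < h).
  { apply Rmin_pos; [apply Rinv_0_lt_compat; lra|apply Rdiv_lt_0_compat; lra]. }
  exists h. split; trivial. intros x y z Hp Hx Hy.
  apply parabolic_iff in Hp. destruct Hp as [Hx0 Hz].
  assert (Hxi : 0 < x < PI / 2) by lra.
  pose (w0 := velocity alpha x z).
  assert (Hw0 := velocity_sq x y z Hxi Hz). fold w0 in Hw0.
  destruct (picard (fun _ => field (d / 2) B) L M h 0 (state x y w0)) as [X [HX0 [HXc HX]]]; trivial.
  { intros X HX t. apply filterlim_locally. intros eps.
    assert (Hnf : 0 < @norm_factor R_AbsRing E3) by apply norm_factor_gt_0.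
    assert (He : 0 < eps / ((L + 1) * @norm_factor R_AbsRing E3)).
    { apply Rdiv_lt_0_compat; [apply cond_pos|]. apply Rmult_lt_0_compat; lra. }
    generalize (proj1 (filterlim_locally X (X t)) (HX t) (mkposreal _ He)).
    apply filter_imp. intros s Hs. apply (@norm_compat2 R_AbsRing E3) in Hs. simpl in Hs.
    apply (@norm_compat1 R_AbsRing E3). apply Rle_lt_trans with (1 := HL _ _).
    replace (norm_factor * (eps / ((L + 1) * norm_factor))) with (eps / (L + 1)) in Hs by (field; lra).
    apply Rle_lt_trans with ((L + 1) * norm (minus (X s) (X t))).
    - apply Rmult_le_compat_r; [apply norm_ge_0|lra].
    - apply (Rmult_lt_compat_l (L + 1)) in Hs; [|lra].
      replace ((L + 1) * (eps / (L + 1))) with (pos eps) in Hs by (field; lra). exact Hs. }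
  { apply Rle_trans with (/ (2 * (L + 1)) * L); [now apply Rmult_le_compat_r|].
    replace (/ (2 * (L + 1)) * L) with (/ 2 - / 2 / (L + 1)) by (field; lra).
    assert (0 < / 2 / (L + 1)) by (apply Rdiv_lt_0_compat; lra). lra. }
  pose (th s := th_of (X s)). pose (v s := v_of (X s)). pose (w s := w_of (X s)).
  assert (HX' : forall t, Rabs t < h -> is_derive X t (field (d / 2) B (X t))).
  { intros t Ht. apply HX. now rewrite Rminus_0_r. }
  assert (Eth0 : th 0 = x) by (unfold th; now rewrite HX0).
  assert (Ev0 : v 0 = y) by (unfold v; now rewrite HX0).
  assert (Ew0 : w 0 = w0) by (unfold w; now rewrite HX0).
  assert (Hdisp : forall p : E3 -> R,
     (forall t, Rabs t < h -> is_derive (fun s => p (X s)) t (p (field (d / 2) B (X t)))) ->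
     (forall Y, Rabs (p Y) <= norm Y) ->
     forall t, Rabs t < h -> Rabs (p (X t) - p (X 0)) <= d / 4 /\ Rabs (p (X t) - p (X 0)) <= 1).
  { intros p Hp1 Hp2 t Ht.
    assert (K : Rabs (p (X t) - p (X 0)) <= M * Rabs t).
    { apply (displacement_bound (fun s => p (X s)) M h t); trivial.
      intros s Hs. eexists. split; [now apply Hp1|].
      apply Rle_trans with (1 := Hp2 _). apply HM. }
    assert (K1 : M * Rabs t <= M * (d / (4 * (M + 1)))) by (apply Rmult_le_compat_l; lra).
    replace (M * (d / (4 * (M + 1)))) with (d / 4 - d / 4 / (M + 1)) in K1 by (field; lra).
    assert (0 < d / 4 / (M + 1)) by (apply Rdiv_lt_0_compat; lra).
    assert (PI <= 4) by apply PI_4. lra. }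
  assert (Hbox : forall t, Rabs t < h ->
     d / 2 <= th t <= PI / 2 - d / 2 /\ Rabs (v t) <= B /\ Rabs (w t) <= B).
  { intros t Ht.
    destruct (Hdisp th_of (fun t Ht => proj1 (derive_E3 X t _ (HX' t Ht)))
      (fun Y => proj1 (norm_E3_ge Y)) t Ht) as [K1 _].
    destruct (Hdisp v_of (fun t Ht => proj1 (proj2 (derive_E3 X t _ (HX' t Ht))))
      (fun Y => proj1 (proj2 (norm_E3_ge Y))) t Ht) as [_ K2].
    destruct (Hdisp w_of (fun t Ht => proj2 (proj2 (derive_E3 X t _ (HX' t Ht))))
      (fun Y => proj2 (proj2 (norm_E3_ge Y))) t Ht) as [_ K3].
    fold (th t) (th 0) in K1. fold (v t) (v 0) in K2. fold (w t) (w 0) in K3.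
    rewrite Eth0 in K1. rewrite Ev0 in K2. rewrite Ew0 in K3.
    apply Rabs_le_between in K1. apply Rabs_le_between in K2. apply Rabs_le_between in K3.
    apply Rabs_le_between in Hy.
    assert (HU := HMU x Hx). apply Rabs_le_between in HU.
    assert (- (MU + 1) <= w0 <= MU + 1) by (split; nra).
    split; [lra|]. unfold B. split; apply Rabs_le; lra. }
  assert (Hode : forall t, Rabs t < h ->
    is_derive th t (gf alpha (th t) * w t) /\
    is_derive v t ((1 - alpha / 2) * (gf alpha (th t) * w t ^ 2)) /\
    is_derive w t (gf alpha (th t) * ((alpha / 2 - 1) * v t * w t + U' alpha (th t)))).
  { intros t Ht. destruct (Hbox t Ht) as [B1 [B2 B3]].
    destruct (field_inside (d / 2) B (X t) B1 B2 B3) as [F1 [F2 F3]].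
    destruct (derive_E3 X t _ (HX' t Ht)) as [D1 [D2 D3]].
    rewrite F1 in D1. rewrite F2 in D2. rewrite F3 in D3.
    split; [exact D1|]. split; [exact D2|exact D3]. }
  assert (Hen : forall t, Rabs t < h -> w t ^ 2 = 2 * U alpha (th t) - v t ^ 2).
  { intros t Ht.
    assert (K : w t ^ 2 + v t ^ 2 - 2 * U alpha (th t) = w 0 ^ 2 + v 0 ^ 2 - 2 * U alpha (th 0)).
    { apply Rabs_def2 in Ht.
      apply (constant_of_derive (fun t => w t ^ 2 + v t ^ 2 - 2 * U alpha (th t)) (- h) h); [|lra|lra].
      intros s Hs. destruct (Hode s) as [D1 [D2 D3]]; [apply Rabs_def1; lra|].
      destruct (Hbox s) as [B1 _]; [apply Rabs_def1; lra|].
      eapply derive_minus.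
      - eapply derive_plus; [eapply derive_sq; [exact D3|reflexivity]|
          eapply derive_sq; [exact D2|reflexivity]|reflexivity].
      - eapply derive_scal; [|reflexivity].
        eapply derive_comp; [apply derive_U; lra|exact D1|reflexivity].
      - field. }
    rewrite Eth0, Ev0, Ew0 in K. lra. }
  exists th, v, (fun s => gf alpha (th s) * w s).
  split; trivial. split; trivial. split.
  { rewrite Eth0, Ew0. symmetry. now apply u_eq. }
  assert (Hvel : forall t, Rabs t < h -> velocity alpha (th t) (gf alpha (th t) * w t) = w t).
  { intros t Ht. rewrite velocity_eq. destruct (Hbox t Ht) as [B1 _].
    assert (K := gf_pos (alpha := alpha) (th t) ltac:(lra)). field. lra. }
  intros s Hs. destruct (Hbox s Hs) as [B1 _]. destruct (Hode s Hs) as [D1 [D2 D3]].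
  assert (Hi : 0 < th s < PI / 2) by lra.
  assert (HQ : (gf alpha (th s) * w s) ^ 2 = cf alpha (th s) * Qf alpha (th s) (v s)).
  { rewrite Rpow_mult_distr, (Hen s Hs), <- (gf_sq (th s) Hi), (Qf_interior _ _ Hi).
    field. assert (K := U_pos (alpha := alpha) (th s)). lra. }
  split; [lra|]. split; trivial. split; trivial. split.
  { eapply derive_eq; [exact D2|].
    rewrite Rmult_assoc, (sqrtW_Qf _ _ _ Hi HQ), (Hvel s Hs). reflexivity. }
  split.
  - intros _. rewrite (Hvel s Hs).
    apply (is_derive_ext_loc w); [|exact D3].
    apply Rabs_def2 in Hs. apply (locally_of_lt _ (- h) h); [lra|].
    intros t Ht. symmetry. apply Hvel. apply Rabs_def1; lra.
  - intros Hc. exfalso. now apply (interior_not_collision _ Hi).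
Qed.

End InteriorOrbits.
Arguments field alpha d V X : clear implicits.

(** * Existence of orbits through a collision *)

Section CollisionOrbits.
Context {alpha : R} {Ha : admissible alpha}.
Set Default Proof Using "All".

Let k := 1 - alpha / 2.

Lemma k_bounds : / 2 <= k < 1.
Proof. unfold k. specialize alpha_bounds. lra. Qed.

(** Inverts the coordinate [zeta = +- tan^k th], negative before and positive
    after the collision, in which the motion crosses [th = 0] with nonzero
    speed. *)
Definition angle (zeta : R) : R := atan (rpow (Rabs zeta) (/ (1 - alpha / 2))).

Lemma inv_k_pos : 0 < / k.
Proof. specialize k_bounds. intros. apply Rinv_0_lt_compat. lra. Qed.

Lemma angle_range (z : R) : 0 <= angle z < PI / 2.
Proof.
  unfold angle. split; [|apply atan_bound].
  rewrite <- atan_0. destruct (rpow_nonneg (Rabs z) (/ (1 - alpha / 2))) as [H|H].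
  - left. now apply atan_increasing.
  - rewrite <- H. lra.
Qed.

Lemma angle_0 : angle 0 = 0.
Proof. unfold angle. rewrite Rabs_R0, rpow_of_nonpos, atan_0; lra. Qed.

Lemma angle_le (y z : R) : Rabs y <= Rabs z -> angle y <= angle z.
Proof.
  intros H. unfold angle.
  destruct (rpow_le (Rabs y) (Rabs z) (/ k) inv_k_pos H) as [K|K]; fold k.
  - left. now apply atan_increasing.
  - rewrite K. lra.
Qed.

Lemma angle_pos (z : R) : z <> 0 -> 0 < angle z.
Proof.
  intros H. unfold angle. rewrite <- atan_0. apply atan_increasing.
  rewrite rpow_of_pos by now apply Rabs_pos_lt. apply Rpower_pos.
Qed.

Lemma angle_even (z : R) : angle (- z) = angle z.
Proof. unfold angle. now rewrite Rabs_Ropp. Qed.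

Lemma rpow_rpow_inv (x : R) : 0 <= x -> rpow (rpow x k) (/ k) = x.
Proof.
  intros H. specialize k_bounds. intros Hk. destruct (Req_dec x 0) as [->|N].
  - rewrite (rpow_of_nonpos 0 k) by lra. now apply rpow_of_nonpos.
  - rewrite (rpow_of_pos x) by lra. rewrite rpow_of_pos by apply Rpower_pos.
    rewrite Rpower_mult, Rinv_r, Rpower_1; lra.
Qed.

Lemma angle_rpow_tan (x : R) : 0 <= x < PI / 2 -> angle (rpow (tan x) k) = x.
Proof.
  intros H. unfold angle. fold k. assert (HPI := PI_RGT_0).
  assert (0 <= tan x).
  { destruct (Req_dec x 0) as [->|N]; [rewrite tan_0; lra|]. left. apply tan_gt_0; lra. }
  rewrite Rabs_right by (apply Rle_ge, rpow_nonneg).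
  rewrite rpow_rpow_inv by trivial. apply atan_tan. lra.
Qed.

Lemma angle_continuous (z : R) : continuous angle z.
Proof.
  apply (continuous_comp (fun z => rpow (Rabs z) (/ (1 - alpha / 2))) atan).
  - apply (continuous_comp Rabs (fun y => rpow y (/ (1 - alpha / 2)))).
    + apply continuity_pt_filterlim, Rcontinuity_abs.
    + apply rpow_continuous, inv_k_pos.
  - eapply continuous_of_derive. apply is_derive_Reals, derivable_pt_lim_atan.
Qed.

Lemma derive_angle_pos (z : R) : 0 < z ->
  is_derive angle z (/ k * Rpower z (/ k - 1) / (1 + Rpower z (/ k) ^ 2)).
Proof.
  intros H. apply (is_derive_ext_loc (fun z => atan (Rpower z (/ k)))).
  - apply (locally_of_lt _ 0 (z + 1)); [lra|]. intros t Ht. unfold angle. fold k.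
    rewrite Rabs_right by lra. now rewrite rpow_of_pos by lra.
  - eapply derive_comp.
    + apply is_derive_Reals, derivable_pt_lim_atan.
    + apply is_derive_Reals, derivable_pt_lim_power, H.
    + unfold Rsqr. field. assert (0 <= Rpower z (/ k) * Rpower z (/ k)) by nra.
      specialize k_bounds. lra.
Qed.

Lemma sqrt_cf_angle (z : R) : 0 < z ->
  sqrt (cf alpha (angle z)) =
    Rpower z (/ k - 1) * Rpower 2 (alpha / 2) / Rpower (1 + Rpower z (/ k) ^ 2) (alpha / 2).
Proof.
  intros H. unfold cf, angle. fold k. rewrite Rabs_right by lra.
  rewrite (rpow_of_pos z) by trivial.
  set (x := Rpower z (/ k)). assert (Hx : 0 < x) by apply Rpower_pos.
  assert (Hx2 : 0 < 1 + x ^ 2) by nra.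
  assert (E : sin (2 * atan x) = 2 * x * / (1 + x ^ 2)).
  { rewrite sin_2a, sin_atan, cos_atan. unfold Rsqr.
    replace (1 + x * x) with (1 + x ^ 2) by ring.
    replace (2 * (x / sqrt (1 + x ^ 2)) * (1 / sqrt (1 + x ^ 2)))
      with (2 * x * / (sqrt (1 + x ^ 2) * sqrt (1 + x ^ 2))).
    - now rewrite sqrt_sqrt by lra.
    - field. assert (0 < sqrt (1 + x ^ 2)) by now apply sqrt_lt_R0. lra. }
  assert (Hi : 0 < / (1 + x ^ 2)) by now apply Rinv_0_lt_compat.
  rewrite E, rpow_of_pos by nra.
  rewrite <- Rpower_sqrt by apply Rpower_pos. rewrite Rpower_mult.
  replace (alpha * / 2) with (alpha / 2) by reflexivity.
  rewrite <- !Rpower_mult_distr by nra.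
  replace (Rpower x (alpha / 2)) with (Rpower z (/ k - 1)).
  2:{ unfold x. rewrite Rpower_mult. f_equal. specialize k_bounds. intros.
      unfold k in *. field. lra. }
  replace (Rpower (/ (1 + x ^ 2)) (alpha / 2)) with (/ Rpower (1 + x ^ 2) (alpha / 2)).
  2:{ rewrite <- Rpower_Ropp. unfold Rpower. rewrite ln_Rinv by trivial. f_equal. ring. }
  unfold Rdiv. ring.
Qed.

Definition sg (z : R) : R := if Rlt_dec z 0 then - 1 else 1.

Lemma velocity_sg (x y s : R) : 0 < x < PI / 2 -> 0 <= Qf alpha x y ->
  velocity alpha x (s * sqrt (cf alpha x * Qf alpha x y)) = s * sqrt (2 * U alpha x - y ^ 2).
Proof.
  intros Hx HQ. specialize (cf_pos x Hx). intros Hc.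
  assert (0 <= cf alpha x * Qf alpha x y) by nra.
  rewrite velocity_eq. specialize (gf_pos x Hx). intros Hg.
  assert (E : sqrt (2 * U alpha x - y ^ 2) = sqrt (cf alpha x * Qf alpha x y) / gf alpha x).
  { rewrite <- (velocity_sq x y (sqrt (cf alpha x * Qf alpha x y))); trivial.
    - rewrite velocity_eq. apply sqrt_pow2. apply Rdiv_le_0_compat; trivial. apply sqrt_pos.
    - rewrite pow2_sqrt; trivial. }
  rewrite E. field. lra.
Qed.

Lemma sqrt_lipschitz (a b : R) : 1 <= a -> 1 <= b -> Rabs (sqrt a - sqrt b) <= Rabs (a - b).
Proof.
  intros Ha0 Hb. assert (K1 : 1 <= sqrt a) by (rewrite <- sqrt_1; apply sqrt_le_1; lra).
  assert (K2 : 1 <= sqrt b) by (rewrite <- sqrt_1; apply sqrt_le_1; lra).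
  assert (E : a - b = (sqrt a - sqrt b) * (sqrt a + sqrt b)).
  { rewrite <- (sqrt_sqrt a) at 1 by lra. rewrite <- (sqrt_sqrt b) at 1 by lra. ring. }
  rewrite E, Rabs_mult. rewrite (Rabs_right (sqrt a + sqrt b)) by lra.
  assert (0 <= Rabs (sqrt a - sqrt b)) by apply Rabs_pos. nra.
Qed.

Lemma Qf_lipschitz (x y y' V : R) : 0 <= x <= PI / 2 -> Rabs y <= V -> Rabs y' <= V ->
  Rabs (Qf alpha x y - Qf alpha x y') <= 2 * V * Rabs (y - y').
Proof.
  intros Hx Hy Hy'. unfold Qf. assert (HW := W_bounds x Hx). assert (Hc := cf_bounds x).
  replace (2 - y ^ 2 * cf alpha x / W alpha x - (2 - y' ^ 2 * cf alpha x / W alpha x))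
    with (- (cf alpha x / W alpha x) * ((y + y') * (y - y'))) by (field; lra).
  assert (Hr : 0 <= cf alpha x / W alpha x <= 1).
  { split; [apply Rdiv_le_0_compat; lra|]. apply Rmult_le_reg_r with (W alpha x); [lra|].
    replace (cf alpha x / W alpha x * W alpha x) with (cf alpha x) by (field; lra). lra. }
  rewrite !Rabs_mult, Rabs_Ropp, (Rabs_right (cf alpha x / W alpha x)) by lra.
  assert (K : Rabs (y + y') <= 2 * V) by (apply Rle_trans with (1 := Rabs_triang _ _); lra).
  assert (P1 := Rabs_pos (y + y')). assert (P2 := Rabs_pos (y - y')).
  apply Rle_trans with (1 * (Rabs (y + y') * Rabs (y - y'))); [|nra].
  apply Rmult_le_compat_r; nra.
Qed.

Lemma Rpower_between (x a : R) : 1 <= x <= 2 -> 0 <= a <= 1 -> 1 <= Rpower x a <= 2.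
Proof.
  intros Hx Ha0. split.
  - rewrite <- (Rpower_O x) by lra. apply Rle_Rpower; lra.
  - apply Rle_trans with (Rpower x 1); [apply Rle_Rpower; lra|]. rewrite Rpower_1; lra.
Qed.

(** With [zeta] as independent variable, [d v / d zeta] is Lipschitz in [v],
    though only Holder in [zeta]. Picard-Lindelof gives [v] as a function of
    [zeta], and the time is then recovered from the scalar equation for [zeta].
    *)
Lemma local_orbit_collision_0 (V : R) : 0 <= V ->
  exists h d, 0 < h /\ 0 < d < PI / 4 /\ forall x y z,
    parabolic_manifold alpha (x, y, z) -> x <= d -> Rabs y <= V ->
    exists th v u, th 0 = x /\ v 0 = y /\ u 0 = z /\
      forall s, Rabs s < h -> orbit_at alpha th v u s.
Proof.
  intros HV. assert (HPI := PI_RGT_0). assert (Hk := k_bounds).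
  assert (Ha0 := alpha_bounds). assert (Hik := inv_k_pos).
  assert (Hik1 : 1 < / k) by (rewrite <- Rinv_1; apply Rinv_lt_contravar; lra).
  pose (cz := clamp (- 1) 1).
  pose (X1 z := Rpower (1 + rpow (Rabs (cz z)) (/ k) ^ 2) k).
  pose (q z y := clamp 1 2 (Qf alpha (angle z) (clamp (- (V + 1)) (V + 1) y))).
  (* [A] is d zeta / d s and [F] is d v / d zeta, cut off away from the collision *)
  pose (A z y := k * Rpower 2 (alpha / 2) * X1 z * sqrt (q z y)).
  pose (F z y := sqrt (W alpha (angle z)) * sqrt (q z y) / (Rpower 2 (alpha / 2) * X1 z)).
  assert (Hang : forall z, 0 <= angle z <= PI / 2) by (intros z; specialize (angle_range z); lra).
  assert (H2 : 1 <= Rpower 2 (alpha / 2) <= 2) by (apply Rpower_between; lra).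
  assert (Hcz : forall z, 0 <= Rabs (cz z) <= 1).
  { intros z. split; [apply Rabs_pos|]. apply Rabs_le. unfold cz.
    apply clamp_in. lra. }
  assert (HX1 : forall z, 1 <= X1 z <= 2).
  { intros z. apply Rpower_between; [|lra].
    assert (0 <= rpow (Rabs (cz z)) (/ k) <= 1); [|nra].
    split; [apply rpow_nonneg|]. rewrite <- (rpow_1 (/ k)). now apply rpow_le; [|apply Hcz]. }
  assert (Hq : forall z y, 1 <= q z y <= 2) by (intros; apply clamp_in; lra).
  assert (Hsq : forall z y, 1 <= sqrt (q z y) <= 2).
  { intros z y. specialize (Hq z y). split.
    - rewrite <- sqrt_1. apply sqrt_le_1; lra.
    - replace 2 with (sqrt (2 * 2)) by (apply sqrt_square; lra). apply sqrt_le_1; lra. }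
  assert (HsW : forall z, 1 <= sqrt (W alpha (angle z)) <= 2) by (intros z; apply sqrtW_bounds, Hang).
  assert (HD : forall z, 1 <= Rpower 2 (alpha / 2) * X1 z <= 4) by (intros z; specialize (HX1 z); nra).
  assert (HA : forall z y, / 2 <= A z y <= 8).
  { intros z y. specialize (Hsq z y). specialize (HD z). unfold A. rewrite !(Rmult_assoc k).
    assert (1 <= Rpower 2 (alpha / 2) * X1 z * sqrt (q z y) <= 8) by nra. nra. }
  assert (HF : forall z y, Rabs (F z y) <= 4).
  { intros z y. specialize (Hsq z y). specialize (HD z). specialize (HsW z). unfold F.
    rewrite Rabs_right.
    - apply Rmult_le_reg_r with (Rpower 2 (alpha / 2) * X1 z); [lra|].
      unfold Rdiv. rewrite Rmult_assoc, Rinv_l by lra. nra.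
    - apply Rle_ge, Rdiv_le_0_compat; nra. }
  pose (L := 4 * (V + 1)).
  assert (HFL : forall z y y', Rabs (F z y - F z y') <= L * Rabs (y - y')).
  { intros z y y'. unfold F.
    replace (sqrt (W alpha (angle z)) * sqrt (q z y) / (Rpower 2 (alpha / 2) * X1 z)
       - sqrt (W alpha (angle z)) * sqrt (q z y') / (Rpower 2 (alpha / 2) * X1 z))
      with (sqrt (W alpha (angle z)) / (Rpower 2 (alpha / 2) * X1 z) * (sqrt (q z y) - sqrt (q z y')))
      by (field; specialize (HX1 z); lra).
    assert (K0 : 0 <= sqrt (W alpha (angle z)) / (Rpower 2 (alpha / 2) * X1 z) <= 2).
    { specialize (HD z). specialize (HsW z). split; [apply Rdiv_le_0_compat; lra|].
      apply Rmult_le_reg_r with (Rpower 2 (alpha / 2) * X1 z); [lra|].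
      unfold Rdiv. rewrite Rmult_assoc, Rinv_l by lra. nra. }
    assert (K1 : Rabs (sqrt (q z y) - sqrt (q z y')) <= 2 * (V + 1) * Rabs (y - y')).
    { apply Rle_trans with (Rabs (q z y - q z y')); [apply sqrt_lipschitz; apply Hq|].
      apply Rle_trans with (1 := clamp_lipschitz _ _ _ _).
      apply Rle_trans with (2 * (V + 1) * Rabs (clamp (- (V + 1)) (V + 1) y - clamp (- (V + 1)) (V + 1) y')).
      - apply Qf_lipschitz; [apply Hang| |]; apply Rabs_le, clamp_in; lra.
      - apply Rmult_le_compat_l; [lra|]. apply clamp_lipschitz. }
    rewrite Rabs_mult, (Rabs_right (sqrt _ / _)) by lra.
    assert (P := Rabs_pos (sqrt (q z y) - sqrt (q z y'))).
    assert (P2 := Rabs_pos (y - y')). unfold L. nra. }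
  assert (HX1c : forall z, continuous X1 z).
  { intros z. apply (continuous_comp (fun z => 1 + rpow (Rabs (cz z)) (/ k) ^ 2) (fun x => Rpower x k)).
    - apply: continuous_plus; [apply: continuous_const|].
      apply (continuous_comp (fun z => rpow (Rabs (cz z)) (/ k)) (fun x => x ^ 2)).
      + apply (continuous_comp (fun z => Rabs (cz z)) (fun x => rpow x (/ k))).
        * apply (continuous_comp cz Rabs); [apply clamp_continuous|].
          apply continuity_pt_filterlim, Rcontinuity_abs.
        * now apply rpow_continuous.
      + apply (ex_derive_continuous (fun x : R => x ^ 2)). auto_derive; trivial.
    - eapply continuous_of_derive. apply is_derive_Reals, derivable_pt_lim_power.
      assert (0 <= rpow (Rabs (cz z)) (/ k) ^ 2) by apply pow2_ge_0. lra. }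
  assert (Hqc : forall Y : R -> R, (forall z, continuous Y z) -> forall z, continuous (fun z => sqrt (q z (Y z))) z).
  { intros Y HY z. apply (continuous_comp (fun z => q z (Y z)) sqrt).
    - apply (continuous_comp (fun z => Qf alpha (angle z) (clamp (- (V + 1)) (V + 1) (Y z))) (clamp 1 2)).
      + apply (Qf_continuous angle (fun z => clamp (- (V + 1)) (V + 1) (Y z)));
          [apply Hang|apply angle_continuous|].
        apply (continuous_comp Y (clamp (- (V + 1)) (V + 1))); [apply HY|apply clamp_continuous].
      + apply clamp_continuous.
    - apply continuity_pt_filterlim, continuity_pt_sqrt. specialize (Hq z (Y z)). lra. }
  assert (HFc : forall Y : R -> R, (forall z, continuous Y z) -> forall z, continuous (fun z => F z (Y z)) z).
  { intros Y HY z. unfold F. apply: continuous_mult.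
    - apply: continuous_mult; [|now apply Hqc].
      apply (continuous_comp (fun z => W alpha (angle z)) sqrt).
      + apply (continuous_comp angle (W alpha)); [apply angle_continuous|apply W_continuous].
      + apply continuity_pt_filterlim, continuity_pt_sqrt.
        specialize (W_bounds _ (Hang z)). lra.
    - apply (continuous_comp (fun z => Rpower 2 (alpha / 2) * X1 z) Rinv).
      + apply: continuous_mult; [apply: continuous_const|apply HX1c].
      + apply continuity_pt_filterlim, continuity_pt_inv; [apply continuity_pt_id|].
        unfold id. specialize (HD z). lra. }
  assert (HAc : forall Y : R -> R, (forall z, continuous Y z) -> forall z, continuous (fun z => A z (Y z)) z).
  { intros Y HY z. unfold A. apply: continuous_mult; [|now apply Hqc].
    apply: continuous_mult; [apply: continuous_const|apply HX1c]. }
  pose (hz := / (8 * (V + 1))).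
  assert (Hhz : 0 < hz) by (apply Rinv_0_lt_compat; lra).
  assert (Hhz1 : hz <= / 8) by (apply Rinv_le_contravar; lra).
  destruct (Qf_ge_1_near_collision (V + 1)) as [x1 [Hx1 HQx]]; [lra|].
  destruct (proj1 (continuous_abs angle 0) (angle_continuous 0) x1) as [e [He0 He]]; [lra|].
  rewrite angle_0 in He.
  pose (z1 := Rmin e hz).
  assert (Hz1 : 0 < z1) by now apply Rmin_pos.
  assert (Hz1e : z1 <= e) by apply Rmin_l. assert (Hz1h : z1 <= hz) by apply Rmin_r.
  assert (HQ1 : forall z y, Rabs z < z1 -> Rabs y <= V + 1 -> 1 <= Qf alpha (angle z) y).
  { intros z y Hz Hy. specialize (He z). rewrite !Rminus_0_r in He.
    specialize (He ltac:(lra)). apply Rabs_def2 in He. apply HQx; trivial.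
    specialize (Hang z). lra. }
  pose (h := z1 / 16). exists h.
  exists (Rmin (angle (z1 / 2) / 2) (PI / 8)).
  assert (Hap : 0 < angle (z1 / 2)) by (apply angle_pos; lra).
  split; [unfold h; lra|]. split.
  { split; [apply Rmin_pos; lra|]. apply Rle_lt_trans with (1 := Rmin_r _ _). lra. }
  intros x y z Hp Hx Hy.
  assert (Hxa := Rle_trans _ _ _ Hx (Rmin_l _ _)). assert (Hxb := Rle_trans _ _ _ Hx (Rmin_r _ _)).
  apply parabolic_iff in Hp. destruct Hp as [Hx0 Hz].
  pose (r := rpow (tan x) k).
  assert (Hr0 : 0 <= r) by apply rpow_nonneg.
  assert (Har : angle r = x) by (apply angle_rpow_tan; lra).
  assert (Hr : r < z1 / 2).
  { apply Rnot_le_lt. intros K. assert (angle (z1 / 2) <= angle r); [|lra].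
    apply angle_le. rewrite !Rabs_right; lra. }
  pose (z0 := sg z * r).
  assert (Habs0 : Rabs z0 = r).
  { unfold z0, sg. destruct (Rlt_dec z 0).
    - rewrite Rabs_left1; lra.
    - rewrite Rabs_right; lra. }
  assert (Ha00 : angle z0 = x).
  { unfold z0, sg. destruct (Rlt_dec z 0).
    - replace (- 1 * r) with (- r) by ring. now rewrite angle_even.
    - now rewrite Rmult_1_l. }
  destruct (picard (E := R_CompleteNormedModule) F L 4 hz z0 y) as [vh [Hv0 [Hvc Hvd]]]; trivial.
  { unfold L. lra. }
  { unfold hz, L. apply Req_le. field. lra. }
  destruct (autonomous_solution (fun z => A z (vh z)) (/ 2) 8 z0) as [Z [HZ0 HZd]].
  { lra. }
  { intros. apply HA. }
  { now apply HAc. }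
  assert (HZ : forall s, Rabs s < h -> Rabs (Z s - z0) < z1 / 2 /\ Rabs (Z s) < z1).
  { intros s Hs.
    assert (K : Rabs (Z s - Z 0) <= 8 * Rabs s).
    { apply (displacement_bound Z 8 h s); trivial. intros t _. eexists. split; [apply HZd|].
      specialize (HA (Z t) (vh (Z t))). rewrite Rabs_right; lra. }
    rewrite HZ0 in K. unfold h in Hs. split; [lra|].
    replace (Z s) with (Z s - z0 + z0) by ring.
    apply Rle_lt_trans with (1 := Rabs_triang _ _). lra. }
  assert (HvV : forall s, Rabs s < h -> Rabs (vh (Z s)) <= V + 1).
  { intros s Hs. destruct (HZ s Hs) as [K1 K2].
    assert (K : Rabs (vh (Z s - z0 + z0) - vh (0 + z0)) <= 4 * Rabs (Z s - z0)).
    { apply (displacement_bound (fun t => vh (t + z0)) 4 hz); [|lra].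
      intros t Ht. exists (F (t + z0) (vh (t + z0))). split; [|apply HF].
      eapply derive_comp; [apply Hvd|auto_derive; trivial|].
      - replace (t + z0 - z0) with t by ring. exact Ht.
      - exact (eq_sym (Rmult_1_r _)). }
    replace (Z s - z0 + z0) with (Z s) in K by ring. rewrite Rplus_0_l, Hv0 in K.
    replace (vh (Z s)) with (vh (Z s) - y + y) by ring.
    apply Rle_trans with (1 := Rabs_triang _ _). lra. }
  pose (th s := angle (Z s)). pose (v s := vh (Z s)).
  pose (u s := sg (Z s) * sqrt (cf alpha (th s) * Qf alpha (th s) (v s))).
  assert (HQ : forall s, Rabs s < h -> 1 <= Qf alpha (th s) (v s) <= 2).
  { intros s Hs. destruct (HZ s Hs) as [K1 K2]. split.
    - apply HQ1; trivial. now apply HvV.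
    - apply Qf_le_2, Hang. }
  assert (Hqq : forall s, Rabs s < h -> q (Z s) (vh (Z s)) = Qf alpha (th s) (v s)).
  { intros s Hs. unfold q. specialize (HvV s Hs). apply Rabs_le_between in HvV.
    rewrite (clamp_id (- (V + 1))) by lra. apply clamp_id. apply (HQ s Hs). }
  assert (HczZ : forall s, Rabs s < h -> cz (Z s) = Z s).
  { intros s Hs. destruct (HZ s Hs) as [K1 K2]. apply Rabs_def2 in K2. apply clamp_id. lra. }
  assert (Hint : forall s, Z s <> 0 -> 0 < th s < PI / 2).
  { intros s Hs. split; [now apply angle_pos|apply angle_range]. }
  assert (Husq : forall s, Rabs s < h -> u s ^ 2 = cf alpha (th s) * Qf alpha (th s) (v s)).
  { intros s Hs. specialize (HQ s Hs). assert (Hc := cf_bounds (th s)).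
    unfold u. rewrite Rpow_mult_distr, pow2_sqrt by nra.
    unfold sg. destruct (Rlt_dec (Z s) 0); ring. }
  (* the coordinate was chosen so that [th] moves with speed [sqrt (cf * Qf)] *)
  assert (Hspeed : forall s, Rabs s < h -> forall r, 0 < r -> Rabs (Z s) = r ->
     / k * Rpower r (/ k - 1) / (1 + Rpower r (/ k) ^ 2) * A (Z s) (vh (Z s))
       = sqrt (cf alpha (th s) * Qf alpha (th s) (v s))).
  { intros s Hs r' Hr' Er. rewrite sqrt_mult.
    2: apply cf_bounds. 2: specialize (HQ s Hs); lra.
    assert (Eth : th s = angle r').
    { unfold th. rewrite <- Er. unfold Rabs. destruct (Rcase_abs (Z s)); trivial.
      symmetry. apply angle_even. }
    rewrite Eth at 1. rewrite (sqrt_cf_angle r' Hr').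
    unfold A, X1. rewrite (Hqq s Hs), (HczZ s Hs), Er. rewrite (rpow_of_pos r') by trivial.
    set (P := 1 + Rpower r' (/ k) ^ 2).
    assert (HP : 0 < P) by (unfold P; assert (0 <= Rpower r' (/ k) ^ 2) by apply pow2_ge_0; lra).
    assert (EP : Rpower P k * Rpower P (alpha / 2) = P).
    { rewrite <- Rpower_plus. unfold k. replace (1 - alpha / 2 + alpha / 2) with 1 by ring.
      now apply Rpower_1. }
    assert (HP2 := Rpower_pos P (alpha / 2)).
    apply (Rmult_eq_reg_r (P * Rpower P (alpha / 2))); [|nra].
    transitivity (Rpower r' (/ k - 1) * Rpower 2 (alpha / 2) * sqrt (Qf alpha (th s) (v s))
                  * (Rpower P k * Rpower P (alpha / 2))).
    - field. lra.
    - rewrite EP. field. lra. }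
  assert (Dth : forall s, Rabs s < h -> Z s <> 0 -> is_derive th s (u s)).
  { intros s Hs HZs. unfold u, sg. destruct (Rlt_dec (Z s) 0) as [N|N].
    - rewrite <- (Hspeed s Hs (- Z s)); [|lra|now apply Rabs_left].
      apply (is_derive_ext (fun t => angle (- Z t))).
      { intros t. apply angle_even. }
      eapply (derive_comp angle (fun t => - Z t)).
      + apply derive_angle_pos. lra.
      + apply: is_derive_opp. apply HZd.
      + unfold opp; simpl. ring.
    - rewrite <- (Hspeed s Hs (Z s)); [|lra|apply Rabs_right; lra].
      eapply (derive_comp angle Z); [apply derive_angle_pos; lra|apply HZd|ring]. }
  assert (Dv : forall s, Rabs s < h ->
     is_derive v s ((1 - alpha / 2) * sqrt (W alpha (th s)) * Qf alpha (th s) (v s))).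
  { intros s Hs. eapply (derive_comp vh Z); [|apply HZd|].
    - apply Hvd. destruct (HZ s Hs) as [K1 K2]. lra.
    - fold k. rewrite <- (Hqq s Hs). fold (th s). unfold F, A.
      specialize (Hq (Z s) (vh (Z s))). rewrite <- (sqrt_sqrt (q (Z s) (vh (Z s)))) at 1 by lra.
      fold (th s). field. specialize (HX1 (Z s)). lra. }
  assert (CZ : forall s, continuous Z s).
  { intros s. eapply continuous_of_derive, HZd. }
  assert (Cth : forall s, continuous th s).
  { intros s. apply (continuous_comp Z angle); [apply CZ|apply angle_continuous]. }
  assert (ZM : forall s t, s < t -> Z s < Z t).
  { intros s t Hst. apply mono_lt; trivial. intros r' _. eexists. split; [apply HZd|].
    specialize (HA (Z r') (vh (Z r'))). lra. }
  exists th, v, u. split; [unfold th; now rewrite HZ0|]. split; [unfold v; now rewrite HZ0|].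
  split.
  { unfold u, th, v. rewrite HZ0, Ha00, Hv0, <- Hz.
    unfold z0, sg. destruct (Rlt_dec z 0) as [N|N].
    - assert (0 < r).
      { unfold r. destruct (Req_dec x 0) as [E|E].
        - exfalso. rewrite E, (cf_collision 0) in Hz by now left. nra.
        - rewrite rpow_of_pos; [apply Rpower_pos|]. apply tan_gt_0; lra. }
      destruct (Rlt_dec (- 1 * r) 0); [|lra].
      replace (z ^ 2) with ((- z) ^ 2) by ring. rewrite sqrt_pow2 by lra. ring.
    - destruct (Rlt_dec (1 * r) 0); [lra|]. rewrite sqrt_pow2 by lra. ring. }
  intros s Hs. assert (Hloc : exists e, 0 < e /\ forall t, Rabs (t - s) < e -> Rabs t < h).
  { exists (h - Rabs s). split; [lra|]. intros t Ht.
    replace t with (t - s + s) by ring. apply Rle_lt_trans with (1 := Rabs_triang _ _). lra. }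
  destruct Hloc as [e1 [He1 Hloc]].
  split; [apply Hang|]. split; [now apply Husq|]. split; [|split; [now apply Dv|split]].
  - destruct (Req_dec (Z s) 0) as [E|N]; [|now apply Dth].
    assert (Ets : th s = 0) by (unfold th; now rewrite E, angle_0).
    assert (Eus : u s = 0).
    { unfold u. rewrite Ets, (cf_collision 0) by now left. rewrite Rmult_0_l, sqrt_0. ring. }
    rewrite Eus. apply (derive_of_limit th s 0 1); [lra|intros; apply Cth|].
    intros eps Heps.
    destruct (proj1 (continuous_abs (fun t => cf alpha (th t)) s)
      (continuous_comp th (cf alpha) s (Cth s) (cf_continuous _)) (eps ^ 2 / 2)) as [d [Hd0 Hd]]; [nra|].
    rewrite Ets, (cf_collision 0) in Hd by now left.
    exists (Rmin d e1). split; [now apply Rmin_pos|]. intros t Hts Ht.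
    assert (K1 := Rlt_le_trans _ _ _ Ht (Rmin_l _ _)).
    assert (K2 := Rlt_le_trans _ _ _ Ht (Rmin_r _ _)).
    assert (Hth := Hloc t K2). exists (u t). split.
    + apply Dth; trivial. intros Et. destruct (Rtotal_order t s) as [X|[X|X]]; [|lra|];
        apply ZM in X; lra.
    + specialize (Hd t K1). specialize (HQ t Hth). assert (Hc := cf_bounds (th t)).
      rewrite Rminus_0_r in *. rewrite Rabs_right in Hd by lra.
      assert (K := Husq t Hth). apply Rabs_lt_of_sq; trivial. nra.
  - intros Hi. assert (HZs : Z s <> 0).
    { intros E. unfold th in Hi. rewrite E, angle_0 in Hi. lra. }
    assert (Hsign : locally s (fun t => sg (Z t) = sg (Z s) /\ Z t <> 0)).
    { destruct (Rtotal_order (Z s) 0) as [N|[N|N]]; [|lra|].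
      - apply (CZ s (fun y => sg y = sg (Z s) /\ y <> 0)).
        apply (locally_of_lt _ (Z s - 1) 0); [lra|]. intros t Ht. unfold sg.
        destruct (Rlt_dec t 0); [|lra]. destruct (Rlt_dec (Z s) 0); lra.
      - apply (CZ s (fun y => sg y = sg (Z s) /\ y <> 0)).
        apply (locally_of_lt _ 0 (Z s + 1)); [lra|]. intros t Ht. unfold sg.
        destruct (Rlt_dec t 0); [lra|]. destruct (Rlt_dec (Z s) 0); lra. }
    assert (Hh : locally s (fun t => Rabs t < h)).
    { exists (mkposreal _ He1). intros t Ht. now apply Hloc. }
    assert (Hpos : 0 < 2 * U alpha (th s) - v s ^ 2).
    { specialize (HQ s Hs). rewrite (Qf_interior _ _ Hi) in HQ.
      assert (KU := U_pos (th s)). apply Rnot_le_lt. intros K.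
      assert ((2 * U alpha (th s) - v s ^ 2) / U alpha (th s) <= 0); [|lra].
      apply Rmult_le_reg_r with (U alpha (th s)); trivial. unfold Rdiv.
      rewrite Rmult_assoc, Rinv_l by lra. lra. }
    assert (Hvs : velocity alpha (th s) (u s) = sg (Z s) * sqrt (2 * U alpha (th s) - v s ^ 2)).
    { apply velocity_sg; trivial. specialize (HQ s Hs). lra. }
    apply (is_derive_ext_loc (fun t => sg (Z s) * sqrt (2 * U alpha (th t) - v t ^ 2))).
    + generalize (filter_and _ _ Hsign Hh). apply filter_imp. intros t [[S1 S2] S3].
      symmetry. rewrite <- S1. apply velocity_sg; [now apply Hint|].
      specialize (HQ t S3). lra.
    + assert (Hq0 := Husq s Hs). assert (Hsq2 := sqrtW_Qf _ _ _ Hi Hq0).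
      assert (Hu := u_eq (th s) (u s) Hi).
      set (w := velocity alpha (th s) (u s)) in *.
      set (g := gf alpha (th s)) in *.
      eapply derive_scal.
      * eapply derive_sqrt; [|exact Hpos|reflexivity].
        eapply derive_minus.
        { eapply derive_scal; [|reflexivity].
          eapply derive_comp; [apply derive_U; trivial|now apply Dth|reflexivity]. }
        { eapply derive_sq; [now apply Dv|reflexivity]. }
        { reflexivity. }
      * rewrite (Rmult_assoc (1 - alpha / 2)), Hsq2, Hu.
        assert (Hs0 : 0 < sqrt (2 * U alpha (th s) - v s ^ 2)) by now apply sqrt_lt_R0.
        set (rt := sqrt (2 * U alpha (th s) - v s ^ 2)) in *.
        rewrite Hvs.
        assert (Hsg : sg (Z s) * sg (Z s) = 1) by (unfold sg; destruct (Rlt_dec (Z s) 0); ring).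
        apply (Rmult_eq_reg_r rt); [|lra].
        match goal with |- _ = ?b => transitivity ((sg (Z s) * sg (Z s)) * (g * (U' alpha (th s) * rt
          + (alpha / 2 - 1) * v s * (sg (Z s) * rt) * rt))) end.
        { rewrite Hsg. ring. }
        { field. lra. }
  - intros Hc. assert (E : Z s = 0).
    { apply NNPP. intros N. apply (interior_not_collision (th s)); trivial. now apply Hint. }
    exists (mkposreal _ He1). intros r' Hr' Hr0'.
    apply Rabs_def2 in Hr'. simpl in Hr'. unfold minus, plus, opp in Hr'; simpl in Hr'.
    assert (Z (s - r') < 0) by (rewrite <- E; apply ZM; lra).
    assert (0 < Z (s + r')) by (rewrite <- E; apply ZM; lra).
    assert (Hup : forall t, Rabs t < h -> Z t <> 0 -> 0 < sqrt (cf alpha (th t) * Qf alpha (th t) (v t))).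
    { intros t Ht Nt. apply sqrt_lt_R0. specialize (HQ t Ht).
      assert (0 < cf alpha (th t)) by now apply cf_pos, Hint. nra. }
    assert (K1 := Hup (s - r') ltac:(apply Hloc; apply Rabs_def1; lra) ltac:(lra)).
    assert (K2 := Hup (s + r') ltac:(apply Hloc; apply Rabs_def1; lra) ltac:(lra)).
    unfold u, sg. destruct (Rlt_dec (Z (s - r')) 0); [|lra].
    destruct (Rlt_dec (Z (s + r')) 0); [lra|]. nra.
Qed.

End CollisionOrbits.

(** * Completeness of the flow *)

Section Completeness.
Context {alpha : R} {Ha : admissible alpha}.
Set Default Proof Using "All".

(** The time of existence depends only on a bound for [|v|], uniformly up to the
    collisions; as [v] grows at a bounded rate, orbits can be continued for
    ever. *)
Lemma local_orbit (V : R) : 0 <= V ->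
  exists h, 0 < h /\ forall x y z,
    parabolic_manifold alpha (x, y, z) -> Rabs y <= V ->
    exists th v u, th 0 = x /\ v 0 = y /\ u 0 = z /\
      forall s, Rabs s < h -> orbit_at alpha th v u s.
Proof.
  intros HV. destruct (local_orbit_collision_0 V HV) as [h1 [d [Hh1 [Hd H1]]]].
  destruct (local_orbit_interior d V Hd HV) as [h2 [Hh2 H2]].
  exists (Rmin h1 h2). split; [now apply Rmin_pos|]. intros x y z Hp Hy.
  assert (K1 := Rmin_l h1 h2). assert (K2 := Rmin_r h1 h2).
  destruct (Rle_dec x d) as [X1|X1]; [|destruct (Rle_dec (PI / 2 - d) x) as [X2|X2]].
  - destruct (H1 x y z Hp X1 Hy) as [th [v [u [E1 [E2 [E3 Ho]]]]]].
    exists th, v, u. do 3 (split; trivial). intros s Hs. apply Ho. lra.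
  - destruct (H1 (PI / 2 - x) y (- z)) as [th [v [u [E1 [E2 [E3 Ho]]]]]]; trivial; try lra.
    { apply parabolic_iff in Hp. apply parabolic_iff. split; [lra|].
      unfold Qf. rewrite cf_sym, W_sym. destruct Hp as [_ Hp]. unfold Qf in Hp.
      rewrite <- Hp. ring. }
    exists (fun s => PI / 2 - th s), v, (fun s => - u s).
    split; [lra|]. split; trivial. split; [lra|]. intros s Hs.
    apply orbit_at_reflect, Ho. lra.
  - destruct (H2 x y z Hp ltac:(lra) Hy) as [th [v [u [E1 [E2 [E3 Ho]]]]]].
    exists th, v, u. do 3 (split; trivial). intros s Hs. apply Ho. lra.
Qed.

(** Bundled, so that segments can be chosen recursively. *)
Definition curve : Type := ((R -> R) * (R -> R) * (R -> R))%type.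
Definition cth (o : curve) : R -> R := fst (fst o).
Definition cv (o : curve) : R -> R := snd (fst o).
Definition cu (o : curve) : R -> R := snd o.
Definition orbit_on (o : curve) (a b : R) : Prop :=
  forall s, a < s < b -> orbit_at alpha (cth o) (cv o) (cu o) s.
Definition agree (o o' : curve) (s : R) : Prop :=
  cth o s = cth o' s /\ cv o s = cv o' s /\ cu o s = cu o' s.

(** The gain of [1] is reached in [2 N] steps of length [h / 2], with a common
    [h] since [v] is bounded over the total time. Each step starts [h / 2]
    before the end of the previous segment, to leave room for gluing. *)
Lemma orbit_extend (a T : R) (o : curve) : a < 0 -> 0 < T -> orbit_on o a T ->
  exists o', orbit_on o' a (T + 1) /\ forall s, s <= T / 2 -> agree o' o s.
Proof.
  intros Hna HT Ho. pose (V := Rabs (cv o 0) + 4 * (T + 2)).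
  assert (HV : 0 <= V) by (unfold V; specialize (Rabs_pos (cv o 0)); lra).
  destruct (local_orbit V HV) as [h0 [Hh0 Hloc]].
  destruct (archimed_cor1 (Rmin h0 T)) as [N [HN HN0]]; [now apply Rmin_pos|].
  assert (HNp : 0 < INR N) by now apply lt_0_INR.
  pose (h := / INR N). fold h in HN.
  assert (Hh : 0 < h) by now apply Rinv_0_lt_compat.
  assert (K1 := Rmin_l h0 T). assert (K2 := Rmin_r h0 T).
  assert (HhN : INR N * h = 1) by (unfold h; field; lra).
  assert (Hj : forall j, (j <= 2 * N)%nat -> exists o',
     orbit_on o' a (T + INR j * h / 2) /\ forall s, s <= T / 2 -> agree o' o s).
  { induction j as [|j IHj]; intros Hle.
    - exists o. split; [|now repeat split]. simpl. intros s Hs. apply Ho. lra.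
    - destruct IHj as [o1 [Ho1 Ha1]]; [now apply Nat.le_trans with (S j); [apply Nat.le_succ_diag_r|]|].
      assert (Hj : INR j * h <= 2).
      { replace 2 with (INR (2 * N) * h).
        - apply Rmult_le_compat_r; [lra|]. apply le_INR.
          now apply Nat.le_trans with (S j); [apply Nat.le_succ_diag_r|].
        - rewrite mult_INR. simpl. rewrite Rmult_assoc, HhN. ring. }
      assert (Hj0 : 0 <= INR j * h) by (apply Rmult_le_pos; [apply pos_INR|lra]).
      pose (b := T + INR j * h / 2 - h / 2).
      assert (Hb : T / 2 < b) by (unfold b; lra).
      assert (Hbo : orbit_at alpha (cth o1) (cv o1) (cu o1) b) by (apply Ho1; unfold b; lra).
      destruct (Hloc (cth o1 b) (cv o1 b) (cu o1 b)) as [th [v [u [E1 [E2 [E3 Hl]]]]]].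
      { apply parabolic_iff. destruct Hbo as [B1 [B2 _]]. now split. }
      { destruct (orbit_on_bounds (cth o1) (cv o1) (cu o1) 0 b) as [_ Hv]; [lra| |].
        - intros s Hs. apply Ho1. unfold b in Hs. lra.
        - destruct (Ha1 0 ltac:(lra)) as [_ [E0 _]]. rewrite E0 in Hv.
          unfold V. assert (Q1 := Rle_abs (cv o 0)). assert (Q2 := Rle_abs (- cv o 0)).
          rewrite Rabs_Ropp in Q2. unfold b in *. apply Rabs_le. lra. }
      exists (glue b (cth o1) (fun s => th (s + - b)), glue b (cv o1) (fun s => v (s + - b)),
              glue b (cu o1) (fun s => u (s + - b))).
      split.
      + intros s Hs. rewrite S_INR in Hs.
        apply (orbit_glue (cth o1) (cv o1) (cu o1) _ _ _ a b (T + (INR j + 1) * h / 2) (h / 2));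
          trivial; try lra.
        * unfold b. lra.
        * intros t Ht. apply Ho1. unfold b in Ht. lra.
        * intros t Ht. apply orbit_at_shift. apply Hl. apply Rabs_def1; unfold b in *; lra.
        * rewrite Rplus_opp_r. auto.
        * rewrite Rplus_opp_r. auto.
        * rewrite Rplus_opp_r. auto.
      + intros s Hs. destruct (Ha1 s Hs) as [A1 [A2 A3]].
        unfold agree, cth, cv, cu, glue in *; simpl in *.
        destruct (Rle_dec s b); [now repeat split|lra]. }
  destruct (Hj (2 * N)%nat (le_n _)) as [o' [Ho' Ha']]. exists o'. split; trivial.
  replace (T + 1) with (T + INR (2 * N) * h / 2); trivial.
  rewrite mult_INR. simpl. rewrite Rmult_assoc, HhN. field.
Qed.

(** Dependent choice of longer and longer segments; two successive ones agree on
    half of their length, which still exhausts the line. *)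
Lemma orbit_forward (x y z : R) : parabolic_manifold alpha (x, y, z) ->
  exists o h, 0 < h /\ cth o 0 = x /\ cv o 0 = y /\ cu o 0 = z /\
    forall s, - h < s -> orbit_at alpha (cth o) (cv o) (cu o) s.
Proof.
  intros Hp. destruct (local_orbit (Rabs y) (Rabs_pos y)) as [h [Hh Hl]].
  destruct (Hl x y z Hp (Rle_refl _)) as [th [v [u [E1 [E2 [E3 Ho]]]]]].
  pose (T n := h + INR n).
  assert (HT : forall n, 0 < T n) by (intros n; unfold T; specialize (pos_INR n); lra).
  pose (good n o := orbit_on o (- h) (T n)).
  assert (Hstep : forall n (X : {o | good n o}),
     exists X' : {o | good (S n) o}, forall s, s <= T n / 2 -> agree (proj1_sig X') (proj1_sig X) s).
  { intros n [o Hgo]. destruct (orbit_extend (- h) (T n) o) as [o' [Ho' Ha']]; trivial; [lra|].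
    assert (Hg' : good (S n) o').
    { unfold good, T. rewrite S_INR, <- Rplus_assoc. exact Ho'. }
    now exists (exist _ o' Hg'). }
  assert (H0 : good 0%nat (th, v, u)).
  { intros s Hs. apply Ho. unfold T in Hs. simpl in Hs. apply Rabs_def1; lra. }
  pose (X := nat_rect (fun n => {o | good n o}) (exist _ (th, v, u) H0)
    (fun n X => proj1_sig (constructive_indefinite_description _ (Hstep n X)))).
  pose (o n := proj1_sig (X n)).
  assert (Hg : forall n, orbit_on (o n) (- h) (T n)) by (intros n; exact (proj2_sig (X n))).
  assert (Hs1 : forall n s, s <= T n / 2 -> agree (o (S n)) (o n) s).
  { intros n. exact (proj2_sig (constructive_indefinite_description _ (Hstep n (X n)))). }
  assert (Hs2 : forall p n s, s <= T n / 2 -> agree (o (n + p)%nat) (o n) s).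
  { induction p as [|p IHp]; intros n s Hs; [rewrite Nat.add_0_r; now repeat split|].
    rewrite Nat.add_succ_r.
    assert (Hm : s <= T (n + p)%nat / 2).
    { unfold T in *. rewrite plus_INR. specialize (pos_INR p). lra. }
    destruct (Hs1 _ _ Hm) as [A1 [A2 A3]]. destruct (IHp n s Hs) as [B1 [B2 B3]].
    repeat split; congruence. }
  pose (N s := Z.to_nat (up (2 * Rabs s))).
  assert (HN : forall s, s <= T (N s) / 2).
  { intros s. unfold T, N. assert (Hs := Rabs_pos s).
    destruct (archimed (2 * Rabs s)) as [A1 _].
    rewrite INR_IZR_INZ, Z2Nat.id.
    - specialize (Rle_abs s). lra.
    - apply le_IZR. lra. }
  pose (oo := ((fun s => cth (o (N s)) s), (fun s => cv (o (N s)) s), (fun s => cu (o (N s)) s)) : curve).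
  assert (Hoo : forall n s, s <= T n / 2 -> agree oo (o n) s).
  { intros n s Hs. change (agree (o (N s)) (o n) s).
    destruct (Nat.le_ge_cases n (N s)) as [L|L].
    - replace (N s) with (n + (N s - n))%nat by (rewrite Nat.add_comm; now apply Nat.sub_add).
      now apply Hs2.
    - assert (K := Hs2 (n - N s)%nat (N s) s (HN s)).
      replace (N s + (n - N s))%nat with n in K by (rewrite Nat.add_comm; symmetry; now apply Nat.sub_add).
      destruct K as [K1 [K2 K3]]. now repeat split. }
  exists oo, h. split; trivial.
  destruct (Hoo 0%nat 0) as [A1 [A2 A3]]; [unfold T; simpl; lra|].
  rewrite A1, A2, A3. do 3 (split; trivial).
  intros s Hs. pose (n := N (Rabs s + 1)).
  assert (Hn := HN (Rabs s + 1)). fold n in Hn. specialize (Rle_abs s). intros Hsa.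
  apply (orbit_at_ext (cth (o n)) (cv (o n)) (cu (o n))).
  - apply (locally_of_lt _ (s - 1) (s + 1)); [lra|]. intros t Ht.
    destruct (Hoo n t) as [B1 [B2 B3]]; [lra|]. now repeat split.
  - apply Hg. specialize (HT n). specialize (Rabs_pos s). lra.
Qed.

Theorem complete_orbit (x y z : R) : parabolic_manifold alpha (x, y, z) ->
  exists th v u, th 0 = x /\ v 0 = y /\ u 0 = z /\ forall s, orbit_at alpha th v u s.
Proof.
  intros Hp. destruct (orbit_forward x y z Hp) as [o [h [Hh [E1 [E2 [E3 Ho]]]]]].
  destruct (orbit_forward x (- y) (- z)) as [o' [h' [Hh' [E1' [E2' [E3' Ho']]]]]].
  { apply parabolic_iff in Hp. apply parabolic_iff. destruct Hp as [Hp1 Hp2]. split; trivial.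
    unfold Qf in *. replace ((- y) ^ 2) with (y ^ 2) by ring. rewrite <- Hp2. ring. }
  exists (glue 0 (fun t => cth o' (- t)) (cth o)), (glue 0 (fun t => - cv o' (- t)) (cv o)),
    (glue 0 (fun t => - cu o' (- t)) (cu o)).
  assert (E0 : forall f g : R -> R, glue 0 f g 0 = f 0).
  { intros f g. unfold glue. destruct (Rle_dec 0 0); [trivial|lra]. }
  rewrite !E0, Ropp_0. split; trivial. split; [lra|]. split; [lra|].
  intros s. apply (orbit_glue _ _ _ _ _ _ (- Rabs s - 1) 0 (Rabs s + 1) (Rmin h h')).
  - specialize (Rabs_pos s). lra.
  - now apply Rmin_pos.
  - intros t Ht. apply orbit_at_reverse, Ho'. specialize (Rmin_r h h'). lra.
  - intros t Ht. apply Ho. specialize (Rmin_l h h'). lra.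
  - rewrite Ropp_0. congruence.
  - rewrite Ropp_0. lra.
  - rewrite Ropp_0. lra.
  - assert (K1 := Rle_abs s). assert (K2 := Rle_abs (- s)). rewrite Rabs_Ropp in K2. lra.
Qed.

End Completeness.

(** * Continuous dependence on the initial point *)

Lemma first_zero (f : R -> R) (a b : R) : a <= b ->
  (forall x, a <= x <= b -> continuous f x) -> 0 < f a -> f b <= 0 ->
  exists c, a < c <= b /\ f c = 0 /\ forall x, a <= x < c -> 0 < f x.
Proof.
  intros Hab Hc Hpa Hpb.
  pose (S x := a <= x <= b /\ forall y, a <= y <= x -> 0 < f y).
  destruct (completeness S) as [c [Hc1 Hc2]].
  { exists b. intros x [Hx _]. lra. }
  { exists a. split; [lra|]. intros y Hy. now replace y with a by lra. }
  assert (Hac : a <= c).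
  { apply Hc1. split; [lra|]. intros y Hy. now replace y with a by lra. }
  assert (Hcb : c <= b) by (apply Hc2; intros x [Hx _]; lra).
  assert (Hbelow : forall x, a <= x < c -> 0 < f x).
  { intros x Hx. apply NNPP. intros N. assert (c <= x); [|lra].
    apply Hc2. intros y [Hy1 Hy2]. apply Rnot_lt_le. intros K. apply N, Hy2. lra. }
  assert (Hfc : f c = 0).
  { destruct (Rtotal_order (f c) 0) as [L|[L|L]]; trivial; exfalso.
    - destruct (proj1 (continuous_abs f c) (Hc c ltac:(lra)) (- f c)) as [d [Hd0 Hd]]; [lra|].
      assert (a <> c) by (intros ->; lra).
      pose (x := Rmax a (c - d / 2)).
      assert (a <= x < c) by (unfold x, Rmax; destruct (Rle_dec a (c - d / 2)); lra).
      assert (c - d / 2 <= x) by apply Rmax_r.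
      specialize (Hbelow x H0). specialize (Hd x). rewrite Rabs_left in Hd by lra.
      specialize (Hd ltac:(lra)). apply Rabs_def2 in Hd. lra.
    - destruct (proj1 (continuous_abs f c) (Hc c ltac:(lra)) (f c)) as [d [Hd0 Hd]]; [lra|].
      assert (c <> b) by (intros ->; lra).
      pose (x := Rmin b (c + d / 2)).
      assert (c < x <= b) by (unfold x, Rmin; destruct (Rle_dec b (c + d / 2)); lra).
      assert (x <= c + d / 2) by apply Rmin_r.
      assert (x <= c); [|lra]. apply Hc1. split; [lra|]. intros y Hy.
      destruct (Rlt_dec y c) as [K|K]; [apply Hbelow; lra|].
      specialize (Hd y). rewrite Rabs_right in Hd by lra.
      specialize (Hd ltac:(lra)). apply Rabs_def2 in Hd. lra. }
  exists c. split; [|now split]. split; trivial.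
  destruct Hac as [L|E]; trivial. exfalso. rewrite E in Hpa. lra.
Qed.

Section Continuity.
Context {alpha : R} {Ha : admissible alpha}.
Set Default Proof Using "All".

Definition near (x y z x' y' z' e : R) : Prop :=
  Rabs (x' - x) < e /\ Rabs (y' - y) < e /\ Rabs (z' - z) < e.

(** Dependence on the initial point need only be controlled at the short times
    [0 < t < h], where [h] depends on the base point. *)
Definition continuous_dependence (th v u : R -> R) : Prop :=
  exists h, 0 < h /\ forall t, 0 < t < h -> forall e, 0 < e -> exists d, 0 < d /\
    forall th' v' u', (forall s, orbit_at alpha th' v' u' s) ->
      near (th 0) (v 0) (u 0) (th' 0) (v' 0) (u' 0) d ->
      near (th t) (v t) (u t) (th' t) (v' t) (u' t) e.

(** Gronwall's inequality for the squared distance in the coordinates [(th, v,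
    w)]. *)
Lemma dependence_interior (th v u : R -> R) :
  (forall s, orbit_at alpha th v u s) -> 0 < th 0 < PI / 2 ->
  continuous_dependence th v u.
Proof.
  intros Ho Hi. assert (HPI := PI_RGT_0).
  pose (d := Rmin (th 0) (PI / 2 - th 0) / 3).
  assert (Hm1 := Rmin_l (th 0) (PI / 2 - th 0)). assert (Hm2 := Rmin_r (th 0) (PI / 2 - th 0)).
  assert (Hm3 : 0 < Rmin (th 0) (PI / 2 - th 0)) by (apply Rmin_pos; lra).
  assert (Hd : 0 < d < PI / 4) by (unfold d; lra).
  assert (Hd2 : 3 * d <= th 0 <= PI / 2 - 3 * d) by (unfold d; lra).
  destruct (BL_U d Hd) as [MU [_ [_ [HMU _]]]].
  assert (HMU0 : 0 <= MU).
  { apply Rle_trans with (2 := HMU d ltac:(lra)). apply Rabs_pos. }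
  pose (B := Rabs (v 0) + 2 * MU + 2).
  assert (HB0 : 0 <= B) by (unfold B; specialize (Rabs_pos (v 0)); lra).
  destruct (field_lipschitz d B Hd HB0) as [M [L [HL0 [_ HL]]]].
  pose (h := Rmin (d / 2) (/ 8)).
  assert (Hh1 : h <= d / 2) by apply Rmin_l. assert (Hh2 : h <= / 8) by apply Rmin_r.
  assert (Hh : 0 < h) by (apply Rmin_pos; lra).
  exists h. split; trivial. intros t Ht e He.
  pose (w o s := velocity alpha (cth o s) (cu o s)).
  pose (X o s := state (cth o s) (cv o s) (w o s)).
  assert (Hode : forall o : curve, (forall s, orbit_at alpha (cth o) (cv o) (cu o) s) ->
     Rabs (cth o 0 - th 0) < d -> Rabs (cv o 0 - v 0) < 1 -> forall s, 0 <= s <= t ->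
     is_derive (cth o) s (th_of (field alpha d B (X o s))) /\
     is_derive (cv o) s (v_of (field alpha d B (X o s))) /\
     is_derive (w o) s (w_of (field alpha d B (X o s))) /\
     cu o s = th_of (field alpha d B (X o s))).
  { intros o Hoo H1 H2 s Hs. apply Rabs_def2 in H1. apply Rabs_def2 in H2.
    destruct (orbit_on_bounds (cth o) (cv o) (cu o) 0 s) as [K1 K2]; [lra|now intros|].
    apply Rabs_le_between in K1.
    assert (Hr : d <= cth o s <= PI / 2 - d) by lra.
    assert (Hri : 0 < cth o s < PI / 2) by lra.
    assert (Hv : Rabs (cv o s) <= B).
    { unfold B. assert (Q1 := Rle_abs (v 0)). assert (Q2 := Rle_abs (- v 0)).
      rewrite Rabs_Ropp in Q2. apply Rabs_le. lra. }
    destruct (Hoo s) as [O1 [O2 [O3 [O4 [O5 _]]]]].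
    assert (Hw2 := velocity_sq _ _ _ Hri O2). fold (w o s) in Hw2.
    assert (Hw : Rabs (w o s) <= B).
    { assert (HU := HMU _ Hr). apply Rabs_le_between in HU. unfold B.
      assert (Q1 := Rabs_pos (v 0)). apply Rabs_le. split; nra. }
    destruct (field_inside d B (X o s) Hr Hv Hw) as [F1 [F2 F3]].
    rewrite F1, F2, F3. change (th_of (X o s)) with (cth o s).
    change (v_of (X o s)) with (cv o s). change (w_of (X o s)) with (w o s).
    assert (Hu := u_eq (cth o s) (cu o s) Hri). fold (w o s) in Hu.
    split; [now rewrite <- Hu|]. split; [|split; [exact (O5 Hri)|trivial]].
    eapply derive_eq; [exact O4|].
    now rewrite Rmult_assoc, (sqrtW_Qf _ _ _ Hri O2). }
  pose (g := (th, v, u) : curve).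
  assert (Hg := Hode g Ho). change (cth g) with th in Hg. change (cv g) with v in Hg.
  change (cu g) with u in Hg.
  rewrite !Rminus_diag_eq, !Rabs_R0 in Hg by trivial.
  specialize (Hg ltac:(lra) ltac:(lra)).
  pose (C := 6 * L). pose (Ex := exp (C * (t - 0))).
  assert (HEx : 1 <= Ex).
  { unfold Ex. rewrite <- exp_0. destruct (Req_dec (C * (t - 0)) 0) as [->|N]; [lra|].
    left. apply exp_increasing. unfold C in *. assert (0 <= 6 * L * (t - 0)) by nra. lra. }
  pose (rho := e / (1 + L)).
  assert (Hrho : 0 < rho) by (apply Rdiv_lt_0_compat; lra).
  assert (Hrho2 : rho * (1 + L) = e) by (unfold rho; field; lra).
  pose (mu := rho / (2 * Ex)).
  assert (Hmu : 0 < mu) by (apply Rdiv_lt_0_compat; lra).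
  assert (Hmu2 : 3 * mu ^ 2 * Ex < rho ^ 2).
  { assert (E : mu * (2 * Ex) = rho) by (unfold mu; field; lra). rewrite <- E. nra. }
  (* the velocity depends continuously on [(th, u)] off the collisions *)
  assert (Hgi : continuous (fun x => / gf alpha x) (th 0)).
  { apply (continuous_comp (gf alpha) Rinv); [apply gf_continuous; lra|].
    apply continuity_pt_filterlim, continuity_pt_inv; [apply continuity_pt_id|].
    unfold id. specialize (gf_pos (th 0) Hi). lra. }
  pose (m := / gf alpha (th 0)).
  assert (Hmp : 0 < m) by (apply Rinv_0_lt_compat, gf_pos, Hi).
  destruct (proj1 (continuous_abs _ _) Hgi (mu / 4)) as [d1 [Hd1 Hgi1]]; [lra|].
  pose (de := Rmin (Rmin d 1) (Rmin d1 (Rmin mu (mu / (2 * m))))).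
  assert (L1 : de <= d) by (unfold de; apply Rle_trans with (1 := Rmin_l _ _), Rmin_l).
  assert (L2 : de <= 1) by (unfold de; apply Rle_trans with (1 := Rmin_l _ _), Rmin_r).
  assert (L3 : de <= d1) by (unfold de; apply Rle_trans with (1 := Rmin_r _ _), Rmin_l).
  assert (L4 : de <= mu).
  { unfold de. apply Rle_trans with (1 := Rmin_r _ _), Rle_trans with (1 := Rmin_r _ _), Rmin_l. }
  assert (L5 : de <= mu / (2 * m)).
  { unfold de. apply Rle_trans with (1 := Rmin_r _ _), Rle_trans with (1 := Rmin_r _ _), Rmin_r. }
  exists de. split.
  { unfold de. repeat apply Rmin_pos; try lra. apply Rdiv_lt_0_compat; lra. }
  intros th' v' u' Ho' [N1 [N2 N3]].
  pose (g' := (th', v', u') : curve).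
  assert (Hg' := Hode g' Ho'). change (cth g') with th' in Hg'. change (cv g') with v' in Hg'.
  change (cu g') with u' in Hg'.
  specialize (Hg' ltac:(lra) ltac:(lra)).
  assert (Hw0 : Rabs (w g' 0 - w g 0) <= mu).
  { unfold w. rewrite !velocity_eq. change (cth g) with th. change (cu g) with u.
    change (cth g') with th'. change (cu g') with u'. unfold Rdiv.
    replace (u' 0 * / gf alpha (th' 0) - u 0 * / gf alpha (th 0))
      with (u' 0 * (/ gf alpha (th' 0) - / gf alpha (th 0)) + m * (u' 0 - u 0)) by (unfold m; ring).
    apply Rle_trans with (1 := Rabs_triang _ _). rewrite !Rabs_mult.
    rewrite (Rabs_right m) by lra.
    destruct (Ho' 0) as [O1 [O2 _]]. assert (K1 := u_bound _ _ _ O1 O2).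
    specialize (Hgi1 (th' 0) ltac:(lra)).
    assert (K2 : m * Rabs (u' 0 - u 0) <= mu / 2).
    { apply Rle_trans with (m * (mu / (2 * m))); [apply Rmult_le_compat_l; lra|].
      apply Req_le. field. lra. }
    assert (P1 := Rabs_pos (/ gf alpha (th' 0) - / gf alpha (th 0))). nra. }
  pose (D s := (th' s - th s) ^ 2 + (v' s - v s) ^ 2 + (w g' s - w g s) ^ 2).
  assert (HDn : forall s, D s = norm (minus (X g' s) (X g s)) ^ 2).
  { intros s. rewrite norm_E3_sq. destruct (minus_E3 (X g' s) (X g s)) as [-> [-> ->]]. reflexivity. }
  assert (HDd : forall s, 0 <= s <= t -> exists l : R, is_derive D s l /\ Rabs l <= C * Rabs (D s)).
  { intros s Hs. destruct (Hg s Hs) as [A1 [A2 [A3 _]]]. destruct (Hg' s Hs) as [B1 [B2 [B3 _]]].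
    eexists. split.
    - eapply derive_plus; [eapply derive_plus|..].
      + eapply derive_sq; [eapply derive_minus; [exact B1|exact A1|reflexivity]|reflexivity].
      + eapply derive_sq; [eapply derive_minus; [exact B2|exact A2|reflexivity]|reflexivity].
      + reflexivity.
      + eapply derive_sq; [eapply derive_minus; [exact B3|exact A3|reflexivity]|reflexivity].
      + reflexivity.
    - rewrite HDn.
      assert (Hlip := HL (X g' s) (X g s)).
      destruct (minus_E3 (field alpha d B (X g' s)) (field alpha d B (X g s))) as [<- [<- <-]].
      destruct (norm_E3_ge (minus (field alpha d B (X g' s)) (field alpha d B (X g s)))) as [G1 [G2 G3]].
      destruct (norm_E3_ge (minus (X g' s) (X g s))) as [I1 [I2 I3]].
      destruct (minus_E3 (X g' s) (X g s)) as [E1 [E2 E3]].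
      change (th' s - th s) with (th_of (X g' s) - th_of (X g s)).
      change (v' s - v s) with (v_of (X g' s) - v_of (X g s)).
      change (w g' s - w g s) with (w_of (X g' s) - w_of (X g s)).
      rewrite <- E1, <- E2, <- E3.
      set (n := norm (minus (X g' s) (X g s))) in *.
      set (a1 := th_of (minus (field alpha d B (X g' s)) (field alpha d B (X g s)))) in *.
      set (a2 := v_of (minus (field alpha d B (X g' s)) (field alpha d B (X g s)))) in *.
      set (a3 := w_of (minus (field alpha d B (X g' s)) (field alpha d B (X g s)))) in *.
      set (b1 := th_of (minus (X g' s) (X g s))) in *.
      set (b2 := v_of (minus (X g' s) (X g s))) in *.
      set (b3 := w_of (minus (X g' s) (X g s))) in *.
      assert (Hn : 0 <= n) by apply norm_ge_0.
      set (na := norm (minus (field alpha d B (X g' s)) (field alpha d B (X g s)))) in *.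
      clearbody n na a1 a2 a3 b1 b2 b3.
      assert (Hab : forall a b, Rabs a <= na -> Rabs b <= n -> Rabs (2 * b * a) <= 2 * L * n ^ 2).
      { intros a b Hna Hb. rewrite !Rabs_mult, (Rabs_right 2) by lra.
        assert (P1 := Rabs_pos a). assert (P2 := Rabs_pos b).
        assert (Rabs b * Rabs a <= n * (L * n)) by (apply Rmult_le_compat; lra). lra. }
      rewrite (Rabs_right (n ^ 2)) by (apply Rle_ge, pow2_ge_0).
      assert (Z1 := Hab a1 b1 G1 I1). assert (Z2 := Hab a2 b2 G2 I2).
      assert (Z3 := Hab a3 b3 G3 I3).
      apply Rle_trans with (1 := Rabs_triang _ _).
      assert (Z4 := Rabs_triang (2 * b1 * a1) (2 * b2 * a2)). unfold C. lra. }
  assert (HD0 : D 0 <= 3 * mu ^ 2).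
  { unfold D. rewrite <- (pow2_abs (th' 0 - th 0)), <- (pow2_abs (v' 0 - v 0)), <- (pow2_abs (w g' 0 - w g 0)).
    assert (P1 := Rabs_pos (th' 0 - th 0)). assert (P2 := Rabs_pos (v' 0 - v 0)).
    assert (P3 := Rabs_pos (w g' 0 - w g 0)).
    assert (Rabs (th' 0 - th 0) ^ 2 <= mu ^ 2) by nra.
    assert (Rabs (v' 0 - v 0) ^ 2 <= mu ^ 2) by nra.
    assert (Rabs (w g' 0 - w g 0) ^ 2 <= mu ^ 2) by nra. lra. }
  assert (HDt : D t < rho ^ 2).
  { assert (K : Rabs (D t) <= Rabs (D 0) * exp (C * (t - 0))).
    { apply gronwall; [lra| |].
      - intros s Hs. destruct (HDd s Hs) as [l [Hl _]]. now apply (continuous_of_derive D s l).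
      - intros s Hs. apply HDd. lra. }
    fold Ex in K. assert (P0 : forall s, 0 <= D s).
    { intros s. rewrite HDn. apply pow2_ge_0. }
    rewrite !Rabs_right in K by (apply Rle_ge, P0). specialize (P0 0). nra. }
  rewrite HDn in HDt.
  assert (Hn : norm (minus (X g' t) (X g t)) < rho).
  { assert (P := norm_ge_0 (minus (X g' t) (X g t))).
    set (n := norm (minus (X g' t) (X g t))) in *. clearbody n. nra. }
  destruct (norm_E3_ge (minus (X g' t) (X g t))) as [G1 [G2 _]].
  destruct (minus_E3 (X g' t) (X g t)) as [E1 [E2 _]].
  rewrite E1 in G1. rewrite E2 in G2.
  change (th_of (X g' t) - th_of (X g t)) with (th' t - th t) in G1.
  change (v_of (X g' t) - v_of (X g t)) with (v' t - v t) in G2.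
  assert (Hre : rho <= e) by nra.
  split; [|split].
  - apply Rle_lt_trans with (1 := G1). apply Rlt_le_trans with (1 := Hn), Hre.
  - apply Rle_lt_trans with (1 := G2). apply Rlt_le_trans with (1 := Hn), Hre.
  - destruct (Hg t ltac:(lra)) as [_ [_ [_ ->]]]. destruct (Hg' t ltac:(lra)) as [_ [_ [_ ->]]].
    destruct (minus_E3 (field alpha d B (X g' t)) (field alpha d B (X g t))) as [<- _].
    apply Rle_lt_trans with (L * rho); [|nra].
    apply Rle_trans with (2 := Rmult_le_compat_l L _ _ HL0 (Rlt_le _ _ Hn)).
    apply Rle_trans with (2 := HL _ _). apply norm_E3_ge.
Qed.

End Continuity.
Arguments continuous_dependence alpha th v u : clear implicits.

Lemma clamp_le (a b x y : R) : x <= y -> clamp a b x <= clamp a b y.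
Proof.
  intros H. unfold clamp, Rmax, Rmin.
  destruct (Rle_dec b x), (Rle_dec b y); repeat destruct (Rle_dec a _); lra.
Qed.

(** The inverse is extended by constants outside [f a, f b], to be continuous on
    the whole line. *)
Lemma increasing_inverse (f : R -> R) (a b : R) : a < b ->
  (forall x, a <= x <= b -> continuous f x) ->
  (forall x y, a <= x -> x < y -> y <= b -> f x < f y) ->
  exists g : R -> R, (forall y, a <= g y <= b) /\
    (forall y, f a <= y <= f b -> f (g y) = y) /\
    (forall x, a <= x <= b -> g (f x) = x) /\
    (forall y, continuous g y) /\
    (forall x l, a < x < b -> is_derive f x l -> 0 < l -> is_derive g (f x) (/ l)).
Proof.
  intros Hab Hc Hm.
  assert (Hle : forall x y, a <= x -> x <= y -> y <= b -> f x <= f y).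
  { intros x y H1 [H2| ->] H3; [left; now apply Hm|lra]. }
  assert (Hfab : f a < f b) by (apply Hm; lra).
  assert (Hex : forall y, exists x, a <= x <= b /\ f x = clamp (f a) (f b) y).
  { intros y. assert (Hy := clamp_in (f a) (f b) y ltac:(lra)). set (z := clamp (f a) (f b) y) in *.
    destruct (Req_dec z (f a)) as [->|N1]; [now exists a; split; [lra|]|].
    destruct (Req_dec z (f b)) as [->|N2]; [now exists b; split; [lra|]|].
    destruct (IVT_interv (fun x => f x - z) a b) as [x [Hx1 Hx2]]; try lra.
    - intros x Hx. apply continuity_pt_minus; [now apply continuity_pt_filterlim, Hc|].
      apply continuity_pt_const. intros ? ?. reflexivity.
    - exists x. split; trivial. lra. }
  pose (g y := proj1_sig (constructive_indefinite_description _ (Hex y))).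
  assert (Hg : forall y, a <= g y <= b /\ f (g y) = clamp (f a) (f b) y).
  { intros y. unfold g. now destruct (constructive_indefinite_description _ (Hex y)). }
  assert (Hfg : forall y, f a <= y <= f b -> f (g y) = y).
  { intros y Hy. rewrite (proj2 (Hg y)). now apply clamp_id. }
  assert (Hgf : forall x, a <= x <= b -> g (f x) = x).
  { intros x Hx. assert (E : f (g (f x)) = f x) by (apply Hfg; split; apply Hle; lra).
    assert (K := proj1 (Hg (f x))).
    destruct (Rtotal_order (g (f x)) x) as [L|[L|L]]; trivial.
    - assert (f (g (f x)) < f x) by (apply Hm; lra). lra.
    - assert (f x < f (g (f x))) by (apply Hm; lra). lra. }
  assert (Hgc : forall y, continuous g y).
  { intros y. apply continuous_abs. intros e He. destruct (Hg y) as [G1 G2].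
    set (s := g y) in *.
    assert (Up : exists d, 0 < d /\ forall z, z < y + d -> g z < s + e).
    { destruct (Rle_dec (s + e) b) as [L|L].
      - exists (f (s + e) - f s). assert (f s < f (s + e)) by (apply Hm; lra).
        split; [lra|]. intros z Hz. apply Rnot_le_lt. intros K.
        destruct (Hg z) as [Z1 Z2]. assert (f (s + e) <= f (g z)) by (apply Hle; lra).
        assert (Hcl := clamp_lipschitz (f a) (f b) z y). rewrite <- Z2, <- G2 in Hcl.
        assert (Q := Rle_abs (f (g z) - f s)).
        assert (z <= y \/ y < z) as [H3|H3] by lra.
        + assert (H4 := clamp_le (f a) (f b) z y H3). lra.
        + rewrite (Rabs_right (z - y)) in Hcl by lra. lra.
      - exists 1. split; [lra|]. intros z _. destruct (Hg z) as [Z1 _]. lra. }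
    assert (Lo : exists d, 0 < d /\ forall z, y - d < z -> s - e < g z).
    { destruct (Rle_dec a (s - e)) as [L|L].
      - exists (f s - f (s - e)). assert (f (s - e) < f s) by (apply Hm; lra).
        split; [lra|]. intros z Hz. apply Rnot_le_lt. intros K.
        destruct (Hg z) as [Z1 Z2]. assert (f (g z) <= f (s - e)) by (apply Hle; lra).
        assert (Hcl := clamp_lipschitz (f a) (f b) y z). rewrite <- Z2, <- G2 in Hcl.
        assert (Q := Rle_abs (f s - f (g z))).
        assert (y <= z \/ z < y) as [H3|H3] by lra.
        + assert (H4 := clamp_le (f a) (f b) y z H3). lra.
        + rewrite (Rabs_right (y - z)) in Hcl by lra. lra.
      - exists 1. split; [lra|]. intros z _. destruct (Hg z) as [Z1 _]. lra. }
    destruct Up as [d1 [D1 U1]], Lo as [d2 [D2 U2]].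
    exists (Rmin d1 d2). split; [now apply Rmin_pos|]. intros z Hz.
    assert (K1 := Rmin_l d1 d2). assert (K2 := Rmin_r d1 d2). apply Rabs_def2 in Hz.
    specialize (U1 z ltac:(lra)). specialize (U2 z ltac:(lra)). apply Rabs_def1; lra. }
  exists g. split; [intros y; apply Hg|]. split; trivial. split; trivial. split; trivial.
  intros x l Hx Hd Hl. apply is_derive_Reals. intros e He.
  apply is_derive_Reals in Hd.
  assert (He' : 0 < Rmin (l / 2) (e * l ^ 2 / 4)).
  { apply Rmin_pos; [lra|]. assert (0 < e * l ^ 2) by (apply Rmult_lt_0_compat; nra). lra. }
  destruct (Hd _ He') as [d Hd1].
  assert (M1 := Rmin_l (l / 2) (e * l ^ 2 / 4)). assert (M2 := Rmin_r (l / 2) (e * l ^ 2 / 4)).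
  destruct (proj1 (continuous_abs g (f x)) (Hgc (f x)) d (cond_pos d)) as [d2 [D2 Hd2]].
  rewrite (Hgf x) in Hd2 by lra.
  assert (A1 : f a < f x) by (apply Hm; lra). assert (A2 : f x < f b) by (apply Hm; lra).
  assert (Hm0 : 0 < Rmin d2 (Rmin (f x - f a) (f b - f x))) by (repeat apply Rmin_pos; lra).
  exists (mkposreal _ Hm0). intros k Hk0 Hk. simpl in Hk.
  assert (B1 := Rlt_le_trans _ _ _ Hk (Rmin_l _ _)).
  assert (B2 := Rlt_le_trans _ _ _ Hk (Rmin_r _ _)).
  assert (B3 := Rlt_le_trans _ _ _ B2 (Rmin_l _ _)). assert (B4 := Rlt_le_trans _ _ _ B2 (Rmin_r _ _)).
  apply Rabs_def2 in B3. apply Rabs_def2 in B4.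
  specialize (Hd2 (f x + k)). replace (f x + k - f x) with k in Hd2 by ring. specialize (Hd2 B1).
  rewrite (Hgf x) by lra.
  assert (E : f (g (f x + k)) = f x + k) by (apply Hfg; lra).
  set (j := g (f x + k) - x) in *.
  assert (Ej : g (f x + k) = x + j) by (unfold j; ring).
  rewrite Ej in E. assert (Hj0 : j <> 0).
  { intros Z. rewrite Z, Rplus_0_r in E. lra. }
  specialize (Hd1 j Hj0 Hd2). rewrite E in Hd1.
  replace (f x + k - f x) with k in Hd1 by ring.
  set (r := k / j) in *. assert (Hr : l / 2 < r) by (apply Rabs_def2 in Hd1; lra).
  replace (j / k) with (/ r) by (unfold r; field; split; trivial).
  replace (/ r - / l) with (- (r - l) * / (r * l)) by (field; lra).
  rewrite Rabs_mult, Rabs_Ropp, (Rabs_right (/ (r * l))).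
  2:{ apply Rle_ge, Rlt_le, Rinv_0_lt_compat. nra. }
  apply Rmult_lt_reg_r with (r * l); [nra|]. rewrite Rmult_assoc, Rinv_l, Rmult_1_r by nra.
  assert (l ^ 2 / 2 <= r * l) by nra. assert (e * (l ^ 2 / 2) <= e * (r * l)) by (apply Rmult_le_compat_l; lra).
  assert (0 < e * l ^ 2) by (apply Rmult_lt_0_compat; nra). lra.
Qed.

Section CollisionDependence.
Context {alpha : R} {Ha : admissible alpha}.
Set Default Proof Using "All".

Lemma cf_ge_id (x : R) : 0 <= x <= PI / 6 -> x <= cf alpha x.
Proof.
  intros Hx. assert (HPI := PI_RGT_0).
  assert (Hs : x <= sin (2 * x)).
  { cut (sin (2 * 0) - 0 <= sin (2 * x) - x); [rewrite Rmult_0_r, sin_0; lra|].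
    assert (D : forall t : R, is_derive (fun t => sin (2 * t) - t) t (2 * cos (2 * t) - 1)).
    { intros t. auto_derive; trivial. ring. }
    apply (mono_le (fun t => sin (2 * t) - t)); [lra| |].
    - intros t _. eapply continuous_of_derive, D.
    - intros t Ht. eexists. split; [apply D|].
      assert (cos (PI / 3) <= cos (2 * t)) by (apply cos_decr_1; lra).
      rewrite cos_PI3 in H. lra. }
  destruct (Req_dec x 0) as [->|N]; [apply cf_bounds|].
  assert (Ha0 := alpha_bounds). assert (Hs1 := SIN_bound (2 * x)).
  apply Rle_trans with (1 := Hs). unfold cf. rewrite rpow_of_pos by lra.
  rewrite <- (Rpower_1 (sin (2 * x))) at 1 by lra. unfold Rpower.
  assert (Hln : ln (sin (2 * x)) <= 0).
  { rewrite <- ln_1. destruct (Req_dec (sin (2 * x)) 1) as [->|]; [lra|].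
    left. apply ln_increasing; lra. }
  destruct (Req_dec (1 * ln (sin (2 * x))) (alpha * ln (sin (2 * x)))) as [->|N2]; [lra|].
  left. apply exp_increasing. nra.
Qed.

Lemma orbit_u_continuous (th v u : R -> R) :
  (forall s, orbit_at alpha th v u s) -> forall s, continuous u s.
Proof.
  intros Ho s. apply (u_continuous th v u). exists (mkposreal 1 Rlt_0_1). intros t _. apply Ho.
Qed.

Section Launch.
Variables (th v u : R -> R) (x1 V : R).
Hypothesis Ho : forall s, orbit_at alpha th v u s.
Hypothesis Hx1 : 0 < x1 <= PI / 6.
Hypothesis HQ : forall x y, 0 <= x <= x1 -> Rabs y <= V -> 1 <= Qf alpha x y.

Lemma u_zero_collision (s : R) : 0 <= th s <= x1 -> Rabs (v s) <= V -> u s = 0 -> th s = 0.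
Proof.
  intros H1 H2 E. assert (HPI := PI_RGT_0). destruct (Ho s) as [_ [O2 _]]. rewrite E in O2.
  specialize (HQ _ _ H1 H2). apply NNPP. intros N.
  assert (0 < cf alpha (th s)) by (apply cf_pos; lra). nra.
Qed.

Lemma upward_persists (a T : R) : a <= T ->
  (forall s, a <= s <= T -> th s <= x1 /\ Rabs (v s) <= V) -> 0 < u a ->
  forall s, a <= s <= T -> 0 < u s.
Proof.
  intros HaT Hr Hu s Hs. apply Rnot_le_lt. intros K.
  destruct (first_zero u a s) as [c [Hc1 [Hc2 Hc3]]]; trivial; [lra|intros; apply (orbit_u_continuous th v u Ho)|].
  assert (Hth : th a < th c).
  { apply mono_lt; [lra| |].
    - intros x _. now apply (orbit_at_continuous th v u x).
    - intros x Hx. exists (u x). split; [apply Ho|apply Hc3; lra]. }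
  destruct (Hr c ltac:(lra)) as [R1 R2]. destruct (Ho a) as [O1 _].
  assert (th c = 0) by (apply u_zero_collision; trivial; lra). lra.
Qed.

Lemma upward_after_collision (a T : R) : a <= T ->
  (forall s, a <= s <= T -> th s <= x1 /\ Rabs (v s) <= V) -> th a = 0 ->
  forall s, a < s <= T -> 0 < u s.
Proof.
  intros HaT Hr Hta s Hs.
  destruct (collision_sign_0 th v u (a - 1) (a + 1) a) as [e [He0 He]]; trivial; [lra|].
  pose (b := a + Rmin (e / 2) (s - a)).
  assert (K1 := Rmin_l (e / 2) (s - a)). assert (K2 := Rmin_r (e / 2) (s - a)).
  assert (K3 : 0 < Rmin (e / 2) (s - a)) by (apply Rmin_pos; lra).
  apply (upward_persists b T); [unfold b; lra| |apply He; lra|unfold b; lra].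
  intros t Ht. apply Hr. unfold b in Ht. lra.
Qed.

(** An orbit starting low enough, even if it first falls into the collision,
    soon moves upward: since [u ^ 2 >= th], the root of [th] decreases at a rate
    of at least [1 / 2] during the fall. *)
Lemma launch (T1 T : R) : 0 < T1 <= T -> th 0 < T1 ^ 2 / 4 ->
  (forall s, 0 <= s <= T -> th s <= x1 /\ Rabs (v s) <= V) ->
  exists t1, 0 <= t1 <= T1 /\ th t1 <= th 0 /\ forall s, t1 < s <= T -> 0 < u s.
Proof.
  intros HT Hth0 Hr.
  assert (Hpos : forall s, 0 <= th s) by (intros s; now destruct (Ho s) as [O1 _]).
  destruct (Rlt_dec 0 (u 0)) as [P|NP].
  { exists 0. split; [lra|]. split; [lra|]. intros s Hs. apply (upward_persists 0 T); trivial; lra. }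
  assert (Hcol : forall t1, 0 <= t1 <= T1 -> u t1 = 0 ->
    exists t1, 0 <= t1 <= T1 /\ th t1 <= th 0 /\ forall s, t1 < s <= T -> 0 < u s).
  { intros t1 Ht1 E. exists t1. split; trivial.
    assert (Et : th t1 = 0).
    { apply u_zero_collision; trivial; [split; [apply Hpos|]|]; apply Hr; lra. }
    split; [specialize (Hpos 0); lra|].
    intros s Hs. apply (upward_after_collision t1 T); trivial; [lra|]. intros r Hrr. apply Hr. lra. }
  destruct (Req_dec (u 0) 0) as [E|N]; [now apply (Hcol 0); [lra|]|].
  destruct (classic (exists s, 0 <= s <= T1 /\ 0 <= u s)) as [[s [Hs1 Hs2]]|Hfall].
  { destruct (first_zero (fun t => - u t) 0 s) as [c [Hc1 [Hc2 _]]]; try lra.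
    - intros x _. apply: continuous_opp. apply (orbit_u_continuous th v u Ho).
    - apply (Hcol c); lra. }
  exfalso.
  assert (Hneg : forall s, 0 <= s <= T1 -> u s < 0).
  { intros s Hs. apply Rnot_le_lt. intros K. apply Hfall. now exists s. }
  assert (Cth : forall s, continuous th s) by (intros s; now apply (orbit_at_continuous th v u s)).
  assert (Hthp : forall s, 0 <= s < T1 -> 0 < th s).
  { intros s Hs. cut (th T1 < th s); [specialize (Hpos T1); lra|].
    cut (- th s < - th T1); [lra|]. apply (mono_lt (fun t => - th t)); [lra| |].
    - intros x _. apply: continuous_opp. apply Cth.
    - intros x Hx. exists (- u x). split; [apply: is_derive_opp; apply Ho|].
      specialize (Hneg x ltac:(lra)). lra. }
  assert (G : sqrt (th T1) - sqrt (th 0) <= - / 2 * (T1 - 0)).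
  { apply (growth_le (fun s => sqrt (th s))); [lra| |].
    - intros s _. apply (continuous_comp th sqrt); [apply Cth|].
      apply continuity_pt_filterlim, continuity_pt_sqrt, Hpos.
    - intros s Hs. assert (Hp := Hthp s ltac:(lra)). exists (u s / (2 * sqrt (th s))). split.
      + eapply derive_sqrt; [exact (proj1 (orbit_at_derive _ _ _ _ (Ho s)))|trivial|reflexivity].
      + assert (Hsq := sqrt_lt_R0 _ Hp). assert (Hu := Hneg s ltac:(lra)).
        destruct (Ho s) as [O1 [O2 _]]. destruct (Hr s ltac:(lra)) as [R1 R2].
        assert (HQs := HQ (th s) (v s) ltac:(lra) R2).
        assert (Hcs := cf_ge_id (th s) ltac:(lra)).
        assert (Hus : th s <= u s ^ 2) by nra.
        assert (Hss := sqrt_sqrt (th s) ltac:(lra)).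
        assert (u s <= - sqrt (th s)) by nra.
        apply Rmult_le_reg_r with (2 * sqrt (th s)); [lra|].
        unfold Rdiv. rewrite Rmult_assoc, Rinv_l by lra. lra. }
  assert (S1 := sqrt_pos (th T1)).
  assert (S2 := sqrt_sqrt (th 0) (Hpos 0)). assert (S3 := sqrt_pos (th 0)). nra.
Qed.

End Launch.

(** At a collision the equations are not Lipschitz, so the two orbits are
    compared at equal angles instead of equal times: [tau s] is the time at
    which the reference orbit is at the angle [th' s]. The difference [D] of the
    values of [v] at equal angles obeys a Gronwall inequality, and it bounds the
    drift of [tau s - s]. *)
Lemma dependence_collision_0 (th v u : R -> R) :
  (forall s, orbit_at alpha th v u s) -> th 0 = 0 -> continuous_dependence alpha th v u.
Proof.
  intros Ho Hth0. assert (HPI := PI_RGT_0). assert (Ha0 := alpha_bounds).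
  pose (V := Rabs (v 0) + 8).
  assert (HV : 8 <= V) by (unfold V; specialize (Rabs_pos (v 0)); lra).
  destruct (Qf_ge_1_near_collision V) as [x1 [Hx1 HQ]]; [lra|].
  assert (Cth : forall s, continuous th s) by (intros s; now apply (orbit_at_continuous th v u s)).
  pose (h0 := Rmin 1 (x1 / 2)).
  assert (Hh1 : h0 <= 1) by apply Rmin_l. assert (Hh2 : h0 <= x1 / 2) by apply Rmin_r.
  assert (Hh0 : 0 < h0) by (apply Rmin_pos; lra).
  assert (Hreg : forall s, 0 <= s <= h0 -> th s <= x1 /\ Rabs (v s) <= V).
  { intros s Hs. destruct (orbit_on_bounds th v u 0 s) as [B1 B2]; [lra|intros; auto|].
    rewrite Hth0 in B1. apply Rabs_le_between in B1. split; [lra|].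
    unfold V. assert (Q1 := Rle_abs (v 0)). assert (Q2 := Rle_abs (- v 0)).
    rewrite Rabs_Ropp in Q2. apply Rabs_le. lra. }
  assert (Hup : forall s, 0 < s <= h0 -> 0 < u s).
  { apply (upward_after_collision th v u x1 V Ho Hx1 HQ 0 h0); trivial. lra. }
  assert (Hmono : forall x y, 0 <= x -> x < y -> y <= h0 -> th x < th y).
  { intros x y H1 H2 H3. apply mono_lt; trivial. intros s Hs. exists (u s).
    split; [apply Ho|apply Hup; lra]. }
  destruct (increasing_inverse th 0 h0 Hh0) as [sig [I1 [I2 [I3 [I4 I5]]]]]; trivial.
  rewrite Hth0 in I2. pose (Th := th h0). fold Th in I2.
  assert (HTh : 0 < Th) by (unfold Th; rewrite <- Hth0; apply Hmono; lra).
  assert (HThx : Th <= x1) by (apply Hreg; lra).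
  pose (h := Rmin h0 (Th / 3)).
  assert (Hha : h <= h0) by apply Rmin_l. assert (Hhb : h <= Th / 3) by apply Rmin_r.
  exists h. split; [apply Rmin_pos; lra|]. intros t Ht e He.
  (* near the final point, [u] is a continuous function of [(th, v)] *)
  assert (Hsqrt_u : forall th' v' u' s, orbit_at alpha th' v' u' s -> 0 < u' s ->
     u' s = sqrt (cf alpha (th' s) * Qf alpha (th' s) (v' s))).
  { intros th' v' u' s [_ [O2 _]] P. rewrite <- O2. symmetry. apply sqrt_pow2. lra. }
  assert (HG : exists rho, 0 < rho <= e /\ forall x y, Rabs (x - th t) < rho -> Rabs (y - v t) < rho ->
     Rabs (sqrt (cf alpha x * Qf alpha x y) - sqrt (cf alpha (th t) * Qf alpha (th t) (v t))) < e).
  { pose (G p := sqrt (cf alpha (fst p) * Qf alpha (fst p) (snd p))).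
    assert (CG : continuous (G : R * R -> R) (th t, v t)).
    { destruct (Ho t) as [O1 [O2 _]].
      apply (continuous_comp (fun p : R * R => cf alpha (fst p) * Qf alpha (fst p) (snd p)) sqrt).
      - apply: continuous_mult.
        + apply (continuous_comp (fun p : R * R => fst p) (cf alpha)); [apply continuous_fst|apply cf_continuous].
        + apply (Qf_continuous (T := prod_UniformSpace R_UniformSpace R_UniformSpace) fst snd (th t, v t));
            [exact O1|apply continuous_fst|apply continuous_snd].
      - apply continuity_pt_filterlim, continuity_pt_sqrt. simpl. rewrite <- O2. apply pow2_ge_0. }
    destruct (proj1 (filterlim_locally G _) CG (mkposreal _ He)) as [d Hd].
    exists (Rmin d e). split.
    - split; [apply Rmin_pos; [apply cond_pos|lra]|apply Rmin_r].
    - intros x y Hx Hy. assert (K := Rmin_l d e).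
      apply (Hd (x, y)). split; simpl; unfold ball; simpl; unfold AbsRing_ball, abs, minus, plus, opp; simpl.
      + unfold Rminus in Hx. lra.
      + unfold Rminus in Hy. lra. }
  destruct HG as [rho [Hrho HG]].
  pose (C := 8 * V). pose (K := exp (C * 1)).
  assert (HK : 1 <= K).
  { assert (exp 0 < exp (C * 1)) by (apply exp_increasing; unfold C; lra).
    rewrite exp_0 in H. unfold K. lra. }
  pose (C2 := 9 * K + 4 * (2 + 18 * V * K)).
  assert (HVK : 8 <= V * K) by nra.
  assert (HC2 : 0 < C2) by (unfold C2; lra).
  pose (mu := rho / (2 * C2)).
  assert (Hmu : 0 < mu) by (apply Rdiv_lt_0_compat; lra).
  assert (HmuC : C2 * mu < rho).
  { replace (C2 * mu) with (rho / 2) by (unfold mu; field; lra). lra. }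
  pose (T1 := Rmin (t / 2) mu).
  assert (HT1 : 0 < T1) by (apply Rmin_pos; lra).
  assert (HT1t : T1 <= t / 2) by apply Rmin_l. assert (HT1m : T1 <= mu) by apply Rmin_r.
  assert (Hs0 : sig 0 = 0) by (rewrite <- Hth0 at 1; apply I3; lra).
  destruct (proj1 (continuous_abs sig 0) (I4 0) mu Hmu) as [d2 [Hd20 Hd2]].
  rewrite Hs0 in Hd2.
  pose (de := Rmin (Rmin mu 1) (Rmin (Th / 4) (Rmin d2 (T1 ^ 2 / 4)))).
  assert (L1 : de <= mu) by (unfold de; apply Rle_trans with (1 := Rmin_l _ _), Rmin_l).
  assert (L2 : de <= 1) by (unfold de; apply Rle_trans with (1 := Rmin_l _ _), Rmin_r).
  assert (L3 : de <= Th / 4) by (unfold de; apply Rle_trans with (1 := Rmin_r _ _), Rmin_l).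
  assert (L4 : de <= d2).
  { unfold de. apply Rle_trans with (1 := Rmin_r _ _), Rle_trans with (1 := Rmin_r _ _), Rmin_l. }
  assert (L5 : de <= T1 ^ 2 / 4).
  { unfold de. apply Rle_trans with (1 := Rmin_r _ _), Rle_trans with (1 := Rmin_r _ _), Rmin_r. }
  exists de. split.
  { unfold de. repeat apply Rmin_pos; nra. }
  intros th' v' u' Ho' [N1 [N2 N3]].
  rewrite Hth0, Rminus_0_r in N1. apply Rabs_def2 in N1. apply Rabs_def2 in N2.
  assert (Hpos' : forall s, 0 <= th' s) by (intros s; now destruct (Ho' s) as [O1 _]).
  assert (Cth' : forall s, continuous th' s) by (intros s; now apply (orbit_at_continuous th' v' u' s)).
  assert (Cv' : forall s, continuous v' s) by (intros s; now apply (orbit_at_continuous th' v' u' s)).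
  assert (Cv : forall s, continuous v s) by (intros s; now apply (orbit_at_continuous th v u s)).
  assert (Hreg' : forall s, 0 <= s <= t -> th' s < Th /\ Rabs (v' s) <= V).
  { intros s Hs. destruct (orbit_on_bounds th' v' u' 0 s) as [B1 B2]; [lra|intros; auto|].
    apply Rabs_le_between in B1. split; [lra|].
    unfold V. assert (Q1 := Rle_abs (v 0)). assert (Q2 := Rle_abs (- v 0)).
    rewrite Rabs_Ropp in Q2. apply Rabs_le. lra. }
  destruct (launch th' v' u' x1 V Ho' Hx1 HQ T1 t) as [t1 [Ht1 [Htl Hup']]]; [lra|lra| |].
  { intros s Hs. destruct (Hreg' s Hs). split; [lra|trivial]. }
  pose (tau s := sig (th' s)).
  assert (Htau : forall s, 0 <= s <= t -> th (tau s) = th' s).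
  { intros s Hs. apply I2. destruct (Hreg' s Hs). specialize (Hpos' s). lra. }
  assert (Ctau : forall s, continuous tau s).
  { intros s. apply (continuous_comp th' sig); [apply Cth'|apply I4]. }
  pose (D s := v' s - v (tau s)).
  assert (Hkin : forall s, t1 < s < t -> 0 < tau s < h0 /\
     exists q q', 1 <= q /\ 1 <= q' <= 2 /\
       q = sqrt (Qf alpha (th' s) (v (tau s))) /\ q' = sqrt (Qf alpha (th' s) (v' s)) /\
       is_derive tau s (q' / q) /\
       is_derive D s ((1 - alpha / 2) * sqrt (W alpha (th' s)) * q' * (q' - q)) /\
       Rabs (q' - q) <= 2 * V * Rabs (D s)).
  { intros s Hs. assert (Hs' : 0 <= s <= t) by lra.
    assert (Ht' : 0 < th' s).
    { assert (th' t1 < th' s); [|specialize (Hpos' t1); lra].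
      apply mono_lt; [lra|intros; apply Cth'|].
      intros r Hr. exists (u' r). split; [apply Ho'|apply Hup'; lra]. }
    destruct (Hreg' s Hs') as [R1 R2].
    assert (Hts : 0 < tau s < h0).
    { assert (Q := I1 (th' s)). fold (tau s) in Q. assert (E := Htau s Hs').
      split; [destruct (proj1 Q) as [L|L]|destruct (proj2 Q) as [L|L]]; trivial; exfalso.
      - rewrite <- L in E. lra.
      - rewrite L in E. fold Th in E. lra. }
    split; trivial. destruct (Hreg (tau s)) as [_ R3]; [lra|].
    assert (Q1 := HQ (th' s) (v (tau s)) ltac:(lra) R3).
    assert (Q2 := HQ (th' s) (v' s) ltac:(lra) R2).
    assert (Q3 := Qf_le_2 (th' s) (v' s) ltac:(lra)).
    assert (Hi : 0 < th' s < PI / 2) by lra.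
    assert (Hcf := cf_pos _ Hi).
    assert (Eu' : u' s = sqrt (cf alpha (th' s)) * sqrt (Qf alpha (th' s) (v' s))).
    { rewrite (Hsqrt_u th' v' u' s (Ho' s)) by (apply Hup'; lra). apply sqrt_mult; lra. }
    assert (Eu : u (tau s) = sqrt (cf alpha (th' s)) * sqrt (Qf alpha (th' s) (v (tau s)))).
    { rewrite (Hsqrt_u th v u (tau s) (Ho _)) by (apply Hup; lra).
      rewrite (Htau s Hs'). apply sqrt_mult; lra. }
    assert (Dtau : is_derive tau s (sqrt (Qf alpha (th' s) (v' s)) / sqrt (Qf alpha (th' s) (v (tau s))))).
    { eapply (derive_comp sig th'); [|exact (proj1 (orbit_at_derive _ _ _ _ (Ho' s)))|].
      - rewrite <- (Htau s Hs'). apply (I5 (tau s) (u (tau s))); [trivial|apply Ho|].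
        apply Hup. lra.
      - rewrite Eu', Eu. assert (P1 := sqrt_lt_R0 _ Hcf).
        assert (P2 : 0 < sqrt (Qf alpha (th' s) (v (tau s)))) by (apply sqrt_lt_R0; lra).
        field. lra. }
    set (q := sqrt (Qf alpha (th' s) (v (tau s)))) in *.
    set (q' := sqrt (Qf alpha (th' s) (v' s))) in *.
    assert (Hq : 1 <= q) by (unfold q; rewrite <- sqrt_1; apply sqrt_le_1; lra).
    assert (Hq' : 1 <= q' <= 2).
    { unfold q'. split; [rewrite <- sqrt_1; apply sqrt_le_1; lra|].
      replace 2 with (sqrt (2 * 2)) by (apply sqrt_square; lra). apply sqrt_le_1; lra. }
    exists q, q'. do 5 (split; trivial). split.
    - eapply derive_minus; [exact (proj2 (orbit_at_derive _ _ _ _ (Ho' s)))| |].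
      + eapply (derive_comp v tau); [exact (proj2 (orbit_at_derive _ _ _ _ (Ho (tau s))))|exact Dtau|reflexivity].
      + rewrite (Htau s Hs').
        assert (E1 : Qf alpha (th' s) (v (tau s)) = q * q) by (unfold q; rewrite sqrt_sqrt; lra).
        assert (E2 : Qf alpha (th' s) (v' s) = q' * q') by (unfold q'; rewrite sqrt_sqrt; lra).
        rewrite E1, E2. field. lra.
    - apply Rle_trans with (1 := sqrt_lipschitz _ _ Q2 Q1). apply Qf_lipschitz; trivial. lra. }
  assert (HDg : forall s, t1 < s < t -> exists l : R, is_derive D s l /\ Rabs l <= C * Rabs (D s)).
  { intros s Hs. destruct (Hkin s Hs) as [_ [q [q' [P1 [P2 [_ [_ [_ [P3 P4]]]]]]]]].
    eexists. split; [exact P3|].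
    assert (Hsw := sqrtW_bounds (th' s) ltac:(destruct (Ho' s) as [O1 _]; lra)).
    rewrite Rabs_mult. rewrite (Rabs_right (_ * q')) by (apply Rle_ge, Rmult_le_pos; [apply Rmult_le_pos|]; lra).
    assert (0 <= (1 - alpha / 2) * sqrt (W alpha (th' s)) <= 2) by nra.
    assert (0 <= (1 - alpha / 2) * sqrt (W alpha (th' s)) * q' <= 4) by nra.
    assert (P5 := Rabs_pos (q' - q)). unfold C. nra. }
  assert (CD : forall s, continuous D s).
  { intros s. apply: continuous_minus; [apply Cv'|].
    apply (continuous_comp tau v); [apply Ctau|apply Cv]. }
  assert (Htl1 : tau t1 < mu).
  { assert (Q := I1 (th' t1)). fold (tau t1) in Q. assert (Hp1 := Hpos' t1).
    assert (Hd := Hd2 (th' t1)). rewrite !Rminus_0_r in Hd.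
    rewrite (Rabs_right (th' t1)) in Hd by lra. specialize (Hd ltac:(lra)).
    fold (tau t1) in Hd. apply Rabs_def2 in Hd. lra. }
  assert (HD1 : Rabs (D t1) <= 9 * mu).
  { destruct (orbit_on_bounds th' v' u' 0 t1) as [_ B2]; [lra|intros; auto|].
    assert (Q := I1 (th' t1)). fold (tau t1) in Q.
    destruct (orbit_on_bounds th v u 0 (tau t1)) as [_ B3]; [lra|intros; auto|].
    unfold D. apply Rabs_le. lra. }
  assert (HDs : forall s, t1 <= s <= t -> Rabs (D s) <= 9 * mu * K).
  { intros s Hs. assert (G : Rabs (D s) <= Rabs (D t1) * exp (C * (s - t1))).
    { apply gronwall; [lra|intros; apply CD|]. intros r Hr. apply HDg. lra. }
    assert (exp (C * (s - t1)) <= K).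
    { unfold K. destruct (Req_dec (C * (s - t1)) (C * 1)) as [->|N]; [lra|].
      left. apply exp_increasing. unfold C in *. nra. }
    assert (0 < exp (C * (s - t1))) by apply exp_pos.
    assert (P := Rabs_pos (D t1)). nra. }
  assert (HE : Rabs ((tau t - t) - (tau t1 - t1)) <= 18 * V * mu * K * (t - t1)).
  { apply (lipschitz_of_derive (fun s => tau s - s)); [lra| |].
    - intros s _. apply: continuous_minus; [apply Ctau|apply continuous_id].
    - intros s Hs. destruct (Hkin s Hs) as [_ [q [q' [P1 [P2 [_ [_ [P0 [_ P4]]]]]]]]].
      exists (q' / q - 1). split.
      + eapply derive_minus; [exact P0|apply: is_derive_id|reflexivity].
      + replace (q' / q - 1) with ((q' - q) * / q) by (field; lra).
        rewrite Rabs_mult, (Rabs_right (/ q)) by (apply Rle_ge, Rlt_le, Rinv_0_lt_compat; lra).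
        assert (/ q <= 1) by (rewrite <- Rinv_1; apply Rinv_le_contravar; lra).
        assert (0 < / q) by (apply Rinv_0_lt_compat; lra).
        specialize (HDs s ltac:(lra)). assert (P5 := Rabs_pos (q' - q)). nra. }
  assert (HE2 : Rabs (tau t - t) <= (2 + 18 * V * K) * mu).
  { assert (Q := I1 (th' t1)). fold (tau t1) in Q.
    assert (18 * V * mu * K * (t - t1) <= 18 * V * K * mu).
    { assert (0 <= 18 * V * K * mu) by nra.
      replace (18 * V * mu * K * (t - t1)) with (18 * V * K * mu * (t - t1)) by ring.
      rewrite <- (Rmult_1_r (18 * V * K * mu)) at 2. apply Rmult_le_compat_l; lra. }
    apply Rabs_le_between in HE. apply Rabs_le. lra. }
  assert (Hgap : Rabs (th (tau t) - th t) <= 3 / 2 * Rabs (tau t - t) /\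
                 Rabs (v (tau t) - v t) <= 4 * Rabs (tau t - t)).
  { destruct (Rle_dec t (tau t)) as [L|L].
    - destruct (orbit_on_bounds th v u t (tau t)) as [B1 B2]; [lra|intros; auto|].
      rewrite (Rabs_right (tau t - t)) by lra. split; trivial. apply Rabs_le. lra.
    - destruct (orbit_on_bounds th v u (tau t) t) as [B1 B2]; [lra|intros; auto|].
      rewrite (Rabs_left (tau t - t)) by lra. rewrite Rabs_minus_sym.
      split; [lra|]. apply Rabs_le. lra. }
  rewrite (Htau t) in Hgap by lra. destruct Hgap as [G1 G2].
  assert (F1 : Rabs (th' t - th t) < rho).
  { apply Rle_lt_trans with (2 := HmuC). unfold C2.
    assert (0 <= K * mu) by nra.
    assert (P := Rabs_pos (tau t - t)).
    replace ((9 * K + 4 * (2 + 18 * V * K)) * mu) with (9 * (K * mu) + 4 * ((2 + 18 * V * K) * mu)) by ring. lra. }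
  assert (F2 : Rabs (v' t - v t) < rho).
  { replace (v' t - v t) with (D t + (v (tau t) - v t)) by (unfold D; ring).
    apply Rle_lt_trans with (1 := Rabs_triang _ _).
    specialize (HDs t ltac:(lra)). apply Rle_lt_trans with (2 := HmuC). unfold C2.
    replace ((9 * K + 4 * (2 + 18 * V * K)) * mu) with (9 * mu * K + 4 * ((2 + 18 * V * K) * mu)) by ring. lra. }
  split; [lra|]. split; [lra|].
  rewrite (Hsqrt_u th' v' u' t (Ho' t)) by (apply Hup'; lra).
  rewrite (Hsqrt_u th v u t (Ho t)) by (apply Hup; lra).
  now apply HG.
Qed.

Lemma dependence (th v u : R -> R) :
  (forall s, orbit_at alpha th v u s) -> continuous_dependence alpha th v u.
Proof.
  intros Ho. destruct (Ho 0) as [O1 _].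
  destruct (Req_dec (th 0) 0) as [E0|N0]; [now apply dependence_collision_0|].
  destruct (Req_dec (th 0) (PI / 2)) as [E1|N1]; [|apply dependence_interior; trivial; lra].
  destruct (dependence_collision_0 (fun s => PI / 2 - th s) v (fun s => - u s)) as [h [Hh H]].
  - intros s. now apply orbit_at_reflect.
  - lra.
  - exists h. split; trivial. intros t Ht e He. destruct (H t Ht e He) as [d [Hd K]].
    exists d. split; trivial. intros th' v' u' Ho' [M1 [M2 M3]].
    destruct (K (fun s => PI / 2 - th' s) v' (fun s => - u' s)) as [K1 [K2 K3]].
    + intros s. now apply orbit_at_reflect.
    + split; [|split]; trivial.
      * replace (PI / 2 - th' 0 - (PI / 2 - th 0)) with (- (th' 0 - th 0)) by ring. now rewrite Rabs_Ropp.
      * replace (- u' 0 - - u 0) with (- (u' 0 - u 0)) by ring. now rewrite Rabs_Ropp.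
    + split; [|split]; trivial.
      * replace (PI / 2 - th' t - (PI / 2 - th t)) with (- (th' t - th t)) in K1 by ring. now rewrite Rabs_Ropp in K1.
      * replace (- u' t - - u t) with (- (u' t - u t)) in K3 by ring. now rewrite Rabs_Ropp in K3.
Qed.

End CollisionDependence.

(** * Escape along the arms *)

Section Escape.
Context {alpha : R} {Ha : admissible alpha}.
Set Default Proof Using "All".

Lemma U_sym (x : R) : U alpha (PI / 2 - x) = U alpha x.
Proof. unfold U. rewrite (sin_compl (alpha := alpha)), (cos_compl (alpha := alpha)). ring. Qed.

Lemma U_decreasing (x y : R) : 0 < x -> x <= y -> y <= PI / 4 -> U alpha y <= U alpha x.
Proof.
  intros H1 H2 H3. assert (HPI := PI_RGT_0). apply mono_ge; trivial.
  - intros t Ht. eapply continuous_of_derive, derive_U. lra.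
  - intros t Ht. eexists. split; [apply derive_U; lra|].
    assert (K := U'_neg t ltac:(lra)).
    assert (Hsc : sin t <= cos t).
    { rewrite <- (sin_compl (alpha := alpha) t). apply sin_incr_1; lra. }
    assert (H4 := Rpower_pos 2 (- alpha)). assert (Ha0 := alpha_bounds).
    assert (0 <= Rpower 2 (- alpha) * alpha * (cos t - sin t)); [|lra].
    apply Rmult_le_pos; nra.
Qed.

Lemma U_away_from_center (e : R) : 0 < e < PI / 4 ->
  exists n, 0 < n /\ forall x, 0 < x < PI / 2 -> U alpha x < U alpha (PI / 4) + n ->
    Rabs (x - PI / 4) < e.
Proof.
  intros He. assert (HPI := PI_RGT_0). exists (U alpha (PI / 4 - e) - U alpha (PI / 4)). split.
  - assert (K := U_min_strict (PI / 4 - e) ltac:(lra) ltac:(lra)). lra.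
  - intros x Hx HU. apply Rabs_def1; apply Rnot_le_lt; intros K.
    + assert (U alpha (PI / 4 - e) <= U alpha (PI / 2 - x)) by (apply U_decreasing; lra).
      rewrite U_sym in H. lra.
    + assert (U alpha (PI / 4 - e) <= U alpha x) by (apply U_decreasing; lra). lra.
Qed.

Section Orbit.
Variables th v u : R -> R.
Hypothesis Ho : forall s, orbit_at alpha th v u s.

Lemma v_mono (s t : R) : s <= t -> v s <= v t.
Proof.
  intros H. destruct (orbit_on_bounds th v u s t H) as [_ B]; [intros; apply Ho|lra].
Qed.

Lemma th_continuous (s : R) : continuous th s.
Proof. now apply (orbit_at_continuous th v u s). Qed.

Lemma v_continuous (s : R) : continuous v s.
Proof. now apply (orbit_at_continuous th v u s). Qed.

Lemma v_sq_le (s : R) : 0 < th s < PI / 2 -> v s ^ 2 <= 2 * U alpha (th s).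
Proof.
  intros Hi. destruct (Ho s) as [_ [O2 _]]. assert (K := velocity_sq _ _ _ Hi O2).
  assert (P := pow2_ge_0 (velocity alpha (th s) (u s))). lra.
Qed.

(** The hypothesis of Barbalat's lemma for [v]. Uniform continuity of [W] and
    [gf] on the compact interval of angles suffices, because [th] and [v] are
    Lipschitz functions of time. *)
Lemma v_rate_uniformly_continuous (V : R) : 0 < V -> (forall s, 0 <= s -> Rabs (v s) <= V) ->
  forall eps, 0 < eps -> exists d, 0 < d /\ forall s t, 0 <= s -> 0 <= t -> Rabs (s - t) < d ->
    Rabs ((1 - alpha / 2) * sqrt (W alpha (th s)) * Qf alpha (th s) (v s)
          - (1 - alpha / 2) * sqrt (W alpha (th t)) * Qf alpha (th t) (v t)) < eps.
Proof.
  intros HV Hv eps He. assert (Ha0 := alpha_bounds).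
  assert (Hth : forall s, 0 <= th s <= PI / 2) by (intros s; now destruct (Ho s) as [O1 _]).
  assert (He1 : 0 < eps / 8) by lra.
  assert (He2 : 0 < eps / (4 * V ^ 2)) by (apply Rdiv_lt_0_compat; nra).
  destruct (Heine (fun x => sqrt (W alpha x)) _ (compact_P3 0 (PI / 2))) with (eps := mkposreal _ He1)
    as [d1 H1].
  { intros x Hx. apply continuity_pt_filterlim.
    apply (continuous_comp (W alpha) sqrt); [apply W_continuous|].
    apply continuity_pt_filterlim, continuity_pt_sqrt. specialize (W_bounds x Hx). lra. }
  destruct (Heine (gf alpha) _ (compact_P3 0 (PI / 2))) with (eps := mkposreal _ He2) as [d2 H2].
  { intros x Hx. now apply continuity_pt_filterlim, gf_continuous. }
  simpl in H1, H2.
  pose (d := Rmin (Rmin (d1 / 2) (d2 / 2)) (eps / (32 * V))).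
  assert (L1 : d <= d1 / 2) by (apply Rle_trans with (1 := Rmin_l _ _), Rmin_l).
  assert (L2 : d <= d2 / 2) by (apply Rle_trans with (1 := Rmin_l _ _), Rmin_r).
  assert (L3 : d <= eps / (32 * V)) by apply Rmin_r.
  assert (Hd1 := cond_pos d1). assert (Hd2 := cond_pos d2).
  exists d. split.
  { repeat apply Rmin_pos; try lra. apply Rdiv_lt_0_compat; lra. }
  assert (Hlip : forall s t, Rabs (th s - th t) <= 3 / 2 * Rabs (s - t) /\ Rabs (v s - v t) <= 4 * Rabs (s - t)).
  { assert (W : forall s t, s <= t -> Rabs (th t - th s) <= 3 / 2 * (t - s) /\ Rabs (v t - v s) <= 4 * (t - s)).
    { intros s t Hst. destruct (orbit_on_bounds th v u s t Hst) as [B1 B2]; [intros; apply Ho|].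
      split; trivial. apply Rabs_le. lra. }
    intros s t. destruct (Rle_dec s t) as [L|L].
    - rewrite (Rabs_minus_sym (th s)), (Rabs_minus_sym (v s)), (Rabs_left1 (s - t)) by lra.
      destruct (W s t L). lra.
    - rewrite (Rabs_right (s - t)) by lra. apply W. lra. }
  intros s t Hs Ht Hst. destruct (Hlip s t) as [B1 B2].
  specialize (H1 (th s) (th t) (Hth s) (Hth t) ltac:(lra)).
  specialize (H2 (th s) (th t) (Hth s) (Hth t) ltac:(lra)).
  assert (E : forall r, (1 - alpha / 2) * sqrt (W alpha (th r)) * Qf alpha (th r) (v r)
     = (1 - alpha / 2) * (2 * sqrt (W alpha (th r)) - v r ^ 2 * gf alpha (th r))).
  { intros r. unfold Qf, gf. specialize (W_bounds _ (Hth r)). intros HW.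
    assert (P := sqrt_lt_R0 (W alpha (th r)) ltac:(lra)).
    rewrite <- (sqrt_sqrt (W alpha (th r))) at 2 by lra. field. lra. }
  rewrite !E.
  assert (Hg := gf_bounds _ (Hth t)).
  match goal with |- Rabs ?x < _ => replace x with ((1 - alpha / 2) *
    (2 * (sqrt (W alpha (th s)) - sqrt (W alpha (th t)))
     + - (v s ^ 2 * (gf alpha (th s) - gf alpha (th t)))
     + - (gf alpha (th t) * ((v s + v t) * (v s - v t))))) by ring end.
  rewrite Rabs_mult, (Rabs_right (1 - alpha / 2)) by lra.
  apply Rle_lt_trans with (1 * (2 * (eps / 8) + V ^ 2 * (eps / (4 * V ^ 2)) + 2 * V * (4 * d))).
  2:{ assert (2 * V * (4 * d) <= eps / 4).
      { apply Rle_trans with (2 * V * (4 * (eps / (32 * V)))); [apply Rmult_le_compat_l; lra|].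
        apply Req_le. field. lra. }
      replace (V ^ 2 * (eps / (4 * V ^ 2))) with (eps / 4) by (field; lra). lra. }
  apply Rmult_le_compat; [lra|apply Rabs_pos|lra|].
  apply Rle_trans with (1 := Rabs_triang _ _). apply Rplus_le_compat.
  - apply Rle_trans with (1 := Rabs_triang _ _). apply Rplus_le_compat.
    + rewrite Rabs_mult, (Rabs_right 2) by lra. lra.
    + rewrite Rabs_Ropp, Rabs_mult. apply Rmult_le_compat; try apply Rabs_pos; [|left; exact H2].
      rewrite Rabs_right by (apply Rle_ge, pow2_ge_0). rewrite <- (pow2_abs (v s)).
      assert (P := Rabs_pos (v s)). specialize (Hv s Hs). nra.
  - rewrite Rabs_Ropp, !Rabs_mult, (Rabs_right (gf alpha (th t))) by lra.
    assert (Q1 : Rabs (v s + v t) <= 2 * V).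
    { apply Rle_trans with (1 := Rabs_triang _ _). assert (H3 := Hv s Hs).
      assert (H4 := Hv t Ht). lra. }
    assert (P1 := Rabs_pos (v s + v t)). assert (P2 := Rabs_pos (v s - v t)).
    apply Rle_trans with (1 * (Rabs (v s + v t) * Rabs (v s - v t))).
    + apply Rmult_le_compat_r; nra.
    + rewrite Rmult_1_l. apply Rmult_le_compat; lra.
Qed.

(** If [th] stayed away from [PI / 4] while the speed tends to [0], the force
    [U'] would keep a sign and drive the speed to infinity. *)
Lemma no_rest_left (g0 B e S : R) : 0 < g0 -> 0 < e < PI / 4 ->
  (forall s, S < s -> 0 < th s <= PI / 4 - e /\ g0 <= gf alpha (th s) /\ Rabs (v s) <= B) ->
  ~ (forall eps, 0 < eps -> exists S, forall s, S < s -> Rabs (velocity alpha (th s) (u s)) < eps).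
Proof.
  intros Hg0 He Hs Hw. assert (HPI := PI_RGT_0). assert (Ha0 := alpha_bounds).
  pose (c := Rpower 2 (- alpha) * alpha * (cos (PI / 4 - e) - sin (PI / 4 - e))).
  assert (Hsc : sin (PI / 4 - e) < cos (PI / 4 - e)).
  { rewrite <- (sin_compl (alpha := alpha)). apply sin_increasing_1; lra. }
  assert (HP := Rpower_pos 2 (- alpha)).
  assert (Hc : 0 < c) by (unfold c; repeat apply Rmult_lt_0_compat; lra).
  assert (HB : 0 <= B).
  { destruct (Hs (S + 1) ltac:(lra)) as [_ [_ K]]. specialize (Rabs_pos (v (S + 1))). lra. }
  destruct (Hw (c / (2 * (B + 1)))) as [S1 H1]; [apply Rdiv_lt_0_compat; lra|].
  destruct (Hw 1) as [S2 H2]; [lra|].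
  pose (a := Rmax S (Rmax S1 S2) + 1).
  assert (A1 : S < a /\ S1 < a /\ S2 < a).
  { unfold a. assert (Q1 := Rmax_l S (Rmax S1 S2)). assert (Q2 := Rmax_r S (Rmax S1 S2)).
    assert (Q3 := Rmax_l S1 S2). assert (Q4 := Rmax_r S1 S2). lra. }
  pose (T := 4 / (g0 * c)). assert (HT : 0 < T) by (apply Rdiv_lt_0_compat; nra).
  pose (w s := velocity alpha (th s) (u s)).
  assert (Hdw : forall s, a <= s -> exists l : R, is_derive w s l /\ l <= - (g0 * c / 2)).
  { intros s Has. destruct (Hs s ltac:(lra)) as [K1 [K2 K3]].
    destruct (Ho s) as [_ [_ [_ [_ [O5 _]]]]]. eexists. split; [apply O5; lra|].
    assert (K4 := H1 s ltac:(lra)). fold (w s) in K4 |- *.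
    assert (K5 : U' alpha (th s) <= - c).
    { assert (K := U'_neg (th s) ltac:(lra)).
      assert (sin (th s) <= sin (PI / 4 - e)) by (apply sin_incr_1; lra).
      assert (cos (PI / 4 - e) <= cos (th s)) by (apply cos_decr_1; lra).
      unfold c. apply Rle_trans with (1 := K). apply Ropp_le_contravar.
      apply Rmult_le_compat_l; [nra|lra]. }
    assert (K6 : Rabs ((alpha / 2 - 1) * v s * w s) <= c / 2).
    { rewrite !Rabs_mult. rewrite (Rabs_left (alpha / 2 - 1)) by lra.
      apply Rle_trans with (1 * B * (c / (2 * (B + 1)))).
      - assert (P1 := Rabs_pos (v s)). assert (P2 := Rabs_pos (w s)).
        apply Rmult_le_compat; [nra|lra|nra|lra].
      - replace (1 * B * (c / (2 * (B + 1)))) with (c / 2 - c / 2 / (B + 1)) by (field; lra).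
        assert (0 < c / 2 / (B + 1)) by (apply Rdiv_lt_0_compat; lra). lra. }
    assert (K7 := Rle_abs ((alpha / 2 - 1) * v s * w s)). nra. }
  assert (G : w (a + T) - w a <= - (g0 * c / 2) * (a + T - a)).
  { apply growth_le; [lra| |].
    - intros s Hs'. destruct (Hdw s ltac:(lra)) as [l [Hl _]]. now apply (continuous_of_derive w s l).
    - intros s Hs'. apply Hdw. lra. }
  replace (- (g0 * c / 2) * (a + T - a)) with (- 2) in G by (unfold T; field; split; lra).
  assert (K1 := H2 a ltac:(lra)). assert (K2 := H2 (a + T) ltac:(lra)).
  fold (w a) in K1. fold (w (a + T)) in K2. apply Rabs_def2 in K1. apply Rabs_def2 in K2. lra.
Qed.

End Orbit.
End Escape.

Section BoundedOrbits.
Context {alpha : R} {Ha : admissible alpha}.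
Set Default Proof Using "All".

Lemma sides (f : R -> R) (c S : R) : (forall s, continuous f s) ->
  (forall s, S < s -> f s <> c) ->
  (forall s, S < s -> f s < c) \/ (forall s, S < s -> c < f s).
Proof.
  intros Hc Hn.
  assert (W : forall s t, S < s -> s <= t -> (f s < c -> f t < c) /\ (c < f s -> c < f t)).
  { intros s t Hs Hst.
    assert (C : forall x, s <= x <= t -> continuous (fun x => f x - c) x).
    { intros x _. apply: continuous_minus; [apply Hc|apply continuous_const]. }
    assert (N : forall x, s <= x <= t -> f x - c <> 0).
    { intros x Hx. specialize (Hn x ltac:(lra)). lra. }
    split; intros L.
    - assert (f t - c < 0) by (apply (sign_neg (fun x => f x - c) s t); trivial; lra). lra.
    - assert (0 < f t - c) by (apply (sign_pos (fun x => f x - c) s t); trivial; lra). lra. }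
  destruct (Rtotal_order (f (S + 1)) c) as [L|[L|L]].
  - left. intros s Hs. destruct (Rle_dec s (S + 1)) as [K|K].
    + destruct (W s (S + 1) Hs K) as [_ W2]. specialize (Hn s Hs).
      apply Rnot_le_lt. intros [Q|Q]; [specialize (W2 Q); lra|now apply Hn].
    + apply (W (S + 1) s); lra.
  - exfalso. apply (Hn (S + 1)); lra.
  - right. intros s Hs. destruct (Rle_dec s (S + 1)) as [K|K].
    + destruct (W s (S + 1) Hs K) as [W1 _]. specialize (Hn s Hs).
      apply Rnot_le_lt. intros [Q|Q]; [specialize (W1 Q); lra|now apply Hn].
    + apply (W (S + 1) s); lra.
Qed.

Definition eventually_small (f : R -> R) : Prop :=
  forall eps, 0 < eps -> exists S, forall s, S < s -> Rabs (f s) < eps.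

(** By Barbalat's lemma the rate of [v], hence [Qf], tends to [0]. Late parts of
    the orbit are therefore far from the collisions, and there the velocity [w]
    tends to [0]. As [w ^ 2 = 2 U - v ^ 2], the potential has a limit along the
    orbit; if it were above the minimum, the orbit would come to rest on one
    side of [PI / 4], which the force excludes. *)
Lemma bounded_limit (th v u : R -> R) (M : R) :
  (forall s, orbit_at alpha th v u s) -> (forall s, v s <= M) ->
  eventually_small (fun s => th s - PI / 4) /\
  eventually_small (fun s => v s ^ 2 - 2 * U alpha (PI / 4)) /\
  eventually_small u.
Proof.
  intros Ho HM. assert (HPI := PI_RGT_0). assert (Ha0 := alpha_bounds).
  assert (Hth : forall s, 0 <= th s <= PI / 2) by (intros s; now destruct (Ho s) as [O1 _]).
  assert (Hvm := v_mono th v u Ho).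
  pose (V := Rabs (v 0) + Rabs M + 1).
  assert (HV : 1 <= V) by (unfold V; specialize (Rabs_pos (v 0)); specialize (Rabs_pos M); lra).
  assert (Hv : forall s, 0 <= s -> Rabs (v s) <= V).
  { intros s Hs. specialize (Hvm 0 s Hs). specialize (HM s). unfold V.
    assert (Q1 := Rle_abs M). assert (Q2 := Rle_abs (- v 0)). rewrite Rabs_Ropp in Q2.
    assert (Q3 := Rabs_pos M). assert (Q4 := Rabs_pos (v 0)). apply Rabs_le. lra. }
  assert (HQ : forall eps, 0 < eps -> exists S, 0 <= S /\ forall s, S < s -> 0 <= Qf alpha (th s) (v s) < eps).
  { intros eps He.
    destruct (barbalat v (fun s => (1 - alpha / 2) * sqrt (W alpha (th s)) * Qf alpha (th s) (v s)) M)
      with (eps := eps / 2) as [S HS]; trivial; try lra.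
    - intros s. apply Ho.
    - intros s. destruct (Ho s) as [O1 [O2 _]]. now apply (v_rate_bound _ _ (u s)).
    - apply (v_rate_uniformly_continuous th v u Ho V); [lra|trivial].
    - exists (Rmax S 0). split; [apply Rmax_r|]. intros s Hs.
      assert (K1 := Rmax_l S 0). specialize (HS s ltac:(lra)). simpl in HS.
      destruct (Ho s) as [O1 [O2 _]]. assert (K := Qf_nonneg _ _ _ O1 O2).
      assert (P := sqrtW_bounds _ O1).
      assert (/ 2 <= (1 - alpha / 2) * sqrt (W alpha (th s))) by nra. split; trivial. nra. }
  pose (c0 := / V ^ 2). assert (Hc0 : 0 < c0) by (apply Rinv_0_lt_compat; nra).
  destruct (HQ 1 ltac:(lra)) as [S0 [HS00 HS0]].
  assert (Hcf : forall s, S0 < s -> c0 <= cf alpha (th s)).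
  { intros s Hs. specialize (HS0 s Hs). specialize (Hv s ltac:(lra)).
    specialize (W_bounds _ (Hth s)). specialize (cf_bounds (th s)). intros Hc HW.
    unfold Qf in HS0. assert (K : W alpha (th s) < v s ^ 2 * cf alpha (th s)).
    { assert (K : 1 < v s ^ 2 * cf alpha (th s) / W alpha (th s)) by lra.
      apply (Rmult_lt_compat_r (W alpha (th s))) in K; [|lra].
      unfold Rdiv in K. rewrite Rmult_assoc, Rinv_l in K by lra. lra. }
    assert (Hv2 : v s ^ 2 <= V ^ 2).
    { rewrite <- (pow2_abs (v s)). specialize (Rabs_pos (v s)). intros. nra. }
    assert (v s ^ 2 * cf alpha (th s) <= V ^ 2 * cf alpha (th s)) by (apply Rmult_le_compat_r; lra).
    unfold c0. apply Rmult_le_reg_l with (V ^ 2); [nra|]. rewrite Rinv_r by nra. lra. }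
  destruct (proj1 (continuous_abs (cf alpha) 0) (cf_continuous 0) c0 Hc0) as [d [Hd0 Hd]].
  rewrite (cf_collision 0) in Hd by now left.
  assert (Hnear : forall x, 0 <= x < d -> cf alpha x < c0).
  { intros x Hx. specialize (Hd x). rewrite !Rminus_0_r in Hd.
    rewrite (Rabs_right x) in Hd by lra. specialize (Hd ltac:(lra)). apply Rabs_def2 in Hd. lra. }
  assert (Hint : forall s, S0 < s -> d <= th s <= PI / 2 - d).
  { intros s Hs. specialize (Hcf s Hs). specialize (Hth s). split; apply Rnot_lt_le; intros K.
    - specialize (Hnear (th s) ltac:(lra)). lra.
    - specialize (Hnear (PI / 2 - th s) ltac:(lra)). rewrite cf_sym in Hnear. lra. }
  assert (Hgf : forall s, S0 < s -> c0 / 2 <= gf alpha (th s)).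
  { intros s Hs. specialize (Hcf s Hs). specialize (W_bounds _ (Hth s)). intros HW. unfold gf.
    assert (P := sqrtW_bounds _ (Hth s)).
    apply Rmult_le_reg_r with (sqrt (W alpha (th s))); [lra|].
    unfold Rdiv at 2. rewrite Rmult_assoc, Rinv_l by lra. nra. }
  pose (w s := velocity alpha (th s) (u s)).
  assert (Hw2 : forall s, S0 < s -> w s ^ 2 = 2 * U alpha (th s) - v s ^ 2).
  { intros s Hs. specialize (Hint s Hs). destruct (Ho s) as [O1 [O2 _]].
    apply velocity_sq; trivial. lra. }
  assert (Hw : eventually_small w).
  { intros eps He. pose (e := eps ^ 2 / (4 * V ^ 2)).
    assert (He' : 0 < e) by (apply Rdiv_lt_0_compat; nra).
    destruct (HQ e He') as [S1 [HS10 HS1]]. exists (Rmax S0 S1). intros s Hs.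
    assert (K1 := Rmax_l S0 S1). assert (K2 := Rmax_r S0 S1).
    specialize (HS1 s ltac:(lra)). specialize (Hint s ltac:(lra)). specialize (Hcf s ltac:(lra)).
    assert (Hi : 0 < th s < PI / 2) by lra.
    assert (HU := U_pos (th s)).
    assert (E : w s ^ 2 = U alpha (th s) * Qf alpha (th s) (v s)).
    { rewrite (Hw2 s) by lra. rewrite (Qf_interior _ _ Hi). field. lra. }
    assert (HU3 : U alpha (th s) <= 3 * V ^ 2).
    { rewrite (U_eq _ Hi). specialize (W_bounds _ (Hth s)). intros HW.
      apply Rmult_le_reg_r with (cf alpha (th s)); [lra|].
      unfold Rdiv. rewrite Rmult_assoc, Rinv_l by lra.
      assert (1 <= V ^ 2 * cf alpha (th s)); [|nra].
      apply Rle_trans with (V ^ 2 * c0); [unfold c0; rewrite Rinv_r; nra|].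
      apply Rmult_le_compat_l; nra. }
    assert (w s ^ 2 < eps ^ 2).
    { rewrite E. apply Rle_lt_trans with (3 * V ^ 2 * Qf alpha (th s) (v s)); [apply Rmult_le_compat_r; lra|].
      apply Rlt_trans with (3 * V ^ 2 * e).
      - apply Rmult_lt_compat_l; [nra|lra].
      - replace (3 * V ^ 2 * e) with (3 / 4 * eps ^ 2) by (unfold e; field; lra). nra. }
    apply Rabs_def1; nra. }
  assert (Hu : eventually_small u).
  { intros eps He. destruct (Hw eps He) as [S1 HS1]. exists (Rmax S0 S1). intros s Hs.
    assert (K1 := Rmax_l S0 S1). assert (K2 := Rmax_r S0 S1).
    specialize (HS1 s ltac:(lra)). specialize (Hint s ltac:(lra)).
    rewrite (u_eq (th s) (u s)) by lra. fold (w s). rewrite Rabs_mult.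
    assert (Hg := gf_bounds _ (Hth s)).
    rewrite (Rabs_right (gf alpha (th s))) by lra.
    assert (P := Rabs_pos (w s)). nra. }
  destruct (completeness (fun y => exists s, y = v s)) as [l [Hl1 Hl2]].
  { exists M. intros y [s ->]. apply HM. }
  { now exists (v 0), 0. }
  assert (Hlv : forall s, v s <= l) by (intros s; apply Hl1; now exists s).
  assert (HlV : forall s, 0 <= s -> Rabs (v s) <= V /\ Rabs l <= V).
  { intros s Hs. split; [now apply Hv|]. assert (K := Hlv 0). assert (K1 := Hv 0 ltac:(lra)).
    assert (l <= M) by (apply Hl2; intros y [r ->]; apply HM).
    unfold V. assert (Q1 := Rle_abs M). assert (Q2 := Rle_abs (- v 0)). rewrite Rabs_Ropp in Q2.
    assert (Q3 := Rabs_pos M). assert (Q4 := Rabs_pos (v 0)). apply Rabs_le. lra. }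
  assert (Hvl : eventually_small (fun s => v s ^ 2 - l ^ 2)).
  { intros eps He.
    assert (exists s, l - eps / (2 * V) < v s) as [s0 Hs0].
    { apply NNPP. intros N. assert (l <= l - eps / (2 * V)).
      { apply Hl2. intros y [s ->]. apply Rnot_lt_le. intros K. apply N. now exists s. }
      assert (0 < eps / (2 * V)) by (apply Rdiv_lt_0_compat; lra). lra. }
    exists (Rmax s0 0). intros s Hs. assert (K1 := Rmax_l s0 0). assert (K2 := Rmax_r s0 0).
    destruct (HlV s ltac:(lra)) as [B1 B2]. assert (K3 := Hvm s0 s ltac:(lra)). specialize (Hlv s).
    replace (v s ^ 2 - l ^ 2) with ((v s + l) * (v s - l)) by ring. rewrite Rabs_mult.
    assert (Rabs (v s + l) <= 2 * V) by (apply Rle_trans with (1 := Rabs_triang _ _); lra).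
    assert (Rabs (v s - l) < eps / (2 * V)) by (apply Rabs_def1; lra).
    assert (P1 := Rabs_pos (v s + l)). assert (P2 := Rabs_pos (v s - l)).
    apply Rle_lt_trans with (2 * V * Rabs (v s - l)); [apply Rmult_le_compat_r; lra|].
    replace eps with (2 * V * (eps / (2 * V))) by (field; lra). apply Rmult_lt_compat_l; lra. }
  assert (Hsum : eventually_small (fun s => 2 * U alpha (th s) - l ^ 2)).
  { intros eps He. destruct (Hvl (eps / 2) ltac:(lra)) as [S1 HS1].
    destruct (Hw (Rmin 1 (eps / 2))) as [S2 HS2]; [apply Rmin_pos; lra|].
    exists (Rmax S0 (Rmax S1 S2)). intros s Hs.
    assert (Q1 := Rmax_l S0 (Rmax S1 S2)). assert (Q2 := Rmax_r S0 (Rmax S1 S2)).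
    assert (Q3 := Rmax_l S1 S2). assert (Q4 := Rmax_r S1 S2).
    specialize (HS1 s ltac:(lra)). specialize (HS2 s ltac:(lra)).
    assert (E := Hw2 s ltac:(lra)).
    assert (K1 := Rmin_l 1 (eps / 2)). assert (K2 := Rmin_r 1 (eps / 2)).
    assert (P := Rabs_pos (w s)).
    assert (w s ^ 2 < eps / 2) by (rewrite <- (pow2_abs (w s)); nra).
    assert (P2 := pow2_ge_0 (w s)). apply Rabs_def2 in HS1. apply Rabs_def1; lra. }
  assert (Hl : l ^ 2 = 2 * U alpha (PI / 4)).
  { destruct (Rtotal_order (l ^ 2) (2 * U alpha (PI / 4))) as [L|[L|L]]; trivial; exfalso.
    - destruct (Hsum (2 * U alpha (PI / 4) - l ^ 2)) as [S1 HS1]; [lra|].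
      pose (s := Rmax S0 S1 + 1). assert (K1 := Rmax_l S0 S1). assert (K2 := Rmax_r S0 S1).
      specialize (HS1 s ltac:(unfold s; lra)). specialize (Hint s ltac:(unfold s; lra)).
      assert (K := U_min (th s) ltac:(lra)). apply Rabs_def2 in HS1. lra.
    - pose (g := l ^ 2 - 2 * U alpha (PI / 4)).
      destruct (Hsum (g / 2)) as [S1 HS1]; [unfold g; lra|].
      assert (CU : continuous (U alpha) (PI / 4)).
      { eapply continuous_of_derive, derive_U, PI4_interior. }
      destruct (proj1 (continuous_abs _ _) CU (g / 4)) as [e0 [He0 HU]]; [unfold g; lra|].
      pose (e := Rmin e0 (PI / 8)).
      assert (Q1 : e <= e0) by apply Rmin_l. assert (Q2 : e <= PI / 8) by apply Rmin_r.
      assert (He : 0 < e < PI / 4) by (split; [apply Rmin_pos; lra|lra]).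
      pose (S2 := Rmax S0 S1). assert (K1 : S0 <= S2) by apply Rmax_l. assert (K2 : S1 <= S2) by apply Rmax_r.
      assert (Hfar : forall s, S2 < s -> e <= Rabs (th s - PI / 4)).
      { intros s Hs. apply Rnot_lt_le. intros K. specialize (HS1 s ltac:(lra)).
        specialize (HU (th s) ltac:(lra)). apply Rabs_def2 in HS1. apply Rabs_def2 in HU.
        unfold g in *. lra. }
      destruct (sides th (PI / 4) S2) as [Hleft|Hright].
      + now apply (th_continuous th v u).
      + intros s Hs E. specialize (Hfar s Hs). rewrite E, Rminus_diag_eq, Rabs_R0 in Hfar; trivial. lra.
      + apply (no_rest_left th v u Ho (c0 / 2) V e S2); trivial; [lra|].
        intros s Hs. specialize (Hfar s Hs). specialize (Hleft s Hs). specialize (Hint s ltac:(lra)).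
        rewrite Rabs_left in Hfar by lra. split; [lra|]. split; [apply Hgf; lra|]. apply Hv. lra.
      + apply (no_rest_left (fun s => PI / 2 - th s) v (fun s => - u s)
           (fun s => orbit_at_reflect th v u s (Ho s)) (c0 / 2) V e S2); trivial; [lra| |].
        * intros s Hs. specialize (Hfar s Hs). specialize (Hright s Hs). specialize (Hint s ltac:(lra)).
          rewrite Rabs_right in Hfar by lra. split; [lra|]. split; [|apply Hv; lra].
          unfold gf. rewrite cf_sym, W_sym. apply Hgf; lra.
        * intros eps Heps. destruct (Hw eps Heps) as [S3 HS3]. exists S3. intros s Hs.
          specialize (HS3 s Hs). unfold w in HS3. rewrite velocity_eq in *.
          unfold gf in *. rewrite cf_sym, W_sym. unfold Rdiv in *. rewrite Ropp_mult_distr_l_reverse, Rabs_Ropp. trivial. }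
  rewrite Hl in Hvl, Hsum. split; [|split; trivial].
  intros eps He. pose (e := Rmin eps (PI / 8)).
  assert (Q1 : e <= eps) by apply Rmin_l. assert (Q2 : e <= PI / 8) by apply Rmin_r.
  destruct (U_away_from_center e) as [n [Hn HU]]; [split; [apply Rmin_pos; lra|lra]|].
  destruct (Hsum n Hn) as [S1 HS1]. exists (Rmax S0 S1). intros s Hs.
  assert (K1 := Rmax_l S0 S1). assert (K2 := Rmax_r S0 S1).
  specialize (HS1 s ltac:(lra)). specialize (Hint s ltac:(lra)). apply Rabs_def2 in HS1.
  apply Rlt_le_trans with (2 := Q1). apply HU; lra.
Qed.

(** The equilibria are at [v = - vc] and [v = vc]. *)
Definition vc : R := sqrt (2 * U alpha (PI / 4)).

Lemma vc_sq : vc ^ 2 = 2 * U alpha (PI / 4).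
Proof. apply pow2_sqrt. specialize (U_pos (PI / 4)). lra. Qed.

Lemma vc_pos : 0 < vc.
Proof. apply sqrt_lt_R0. specialize (U_pos (PI / 4)). lra. Qed.

Lemma escape_v (th v u : R -> R) (s1 : R) :
  (forall s, orbit_at alpha th v u s) -> vc < v s1 -> is_lim v p_infty p_infty.
Proof.
  intros Ho Hv. assert (Hvm := v_mono th v u Ho). assert (Hvc := vc_pos).
  apply is_lim_spec. intros M.
  assert (exists s, M < v s) as [s Hs].
  { apply NNPP. intros N.
    destruct (bounded_limit th v u M) as [_ [K _]]; trivial.
    { intros s. apply Rnot_lt_le. intros L. apply N. now exists s. }
    destruct (K (v s1 ^ 2 - vc ^ 2)) as [S HS]; [nra|]. rewrite <- vc_sq in HS.
    specialize (HS (Rmax S s1 + 1)). assert (K1 := Rmax_l S s1). assert (K2 := Rmax_r S s1).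
    specialize (HS ltac:(lra)). assert (v s1 <= v (Rmax S s1 + 1)) by (apply Hvm; lra).
    apply Rabs_def2 in HS. nra. }
  exists s. intros t Ht. apply Rlt_le_trans with (1 := Hs). apply Hvm. lra.
Qed.

Lemma not_center_above (th v u : R -> R) (s : R) :
  (forall s, orbit_at alpha th v u s) -> vc < v s -> th s <> PI / 4.
Proof.
  intros Ho Hv E. assert (Hvc := vc_pos). assert (Hvs := vc_sq).
  assert (K := v_sq_le th v u Ho s). rewrite E in K. specialize (K PI4_interior). nra.
Qed.

(** Above the level of the equilibrium the manifold splits into two arms, so an
    orbit that gets there stays on its side and escapes. *)
Lemma escape_0 (th v u : R -> R) (s1 : R) :
  (forall s, orbit_at alpha th v u s) -> vc < v s1 -> th s1 < PI / 4 ->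
  is_lim v p_infty p_infty /\ is_lim th p_infty 0.
Proof.
  intros Ho Hv Hth1. assert (HPI := PI_RGT_0). assert (Hvm := v_mono th v u Ho).
  assert (Hlim := escape_v th v u s1 Ho Hv). split; trivial.
  assert (Hside : forall s, s1 <= s -> th s < PI / 4).
  { intros s Hs. cut (th s - PI / 4 < 0); [lra|].
    apply (sign_neg (fun s => th s - PI / 4) s1 s); trivial; [| |lra].
    - intros x _. apply: continuous_minus; [now apply (th_continuous th v u)|apply continuous_const].
    - intros x Hx. assert (K := not_center_above th v u x Ho).
      specialize (Hvm s1 x ltac:(lra)). specialize (K ltac:(lra)). lra. }
  apply is_lim_spec. intros eps. pose (e := Rmin eps (PI / 8)).
  assert (Q1 : e <= eps) by apply Rmin_l. assert (Q2 : e <= PI / 8) by apply Rmin_r.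
  assert (He : 0 < e) by (apply Rmin_pos; [apply cond_pos|lra]).
  assert (Hce : 0 < cf alpha e) by (apply cf_pos; lra).
  pose (N := 6 / cf alpha e + 1).
  assert (HN : 1 <= N).
  { unfold N. assert (0 < 6 / cf alpha e) by (apply Rdiv_lt_0_compat; lra). lra. }
  apply is_lim_spec in Hlim. destruct (Hlim N) as [S HS].
  exists (Rmax S s1). intros s Hs. assert (K1 := Rmax_l S s1). assert (K2 := Rmax_r S s1).
  specialize (HS s ltac:(lra)). specialize (Hside s ltac:(lra)).
  destruct (Ho s) as [O1 [O2 _]]. rewrite Rminus_0_r, Rabs_right by lra.
  apply Rlt_le_trans with (2 := Q1). apply Rnot_le_lt. intros K.
  assert (Hmon : cf alpha e <= cf alpha (th s)).
  { apply rpow_le; [apply Ha|]. apply sin_incr_1; lra. }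
  assert (HQ := Qf_nonneg _ _ _ O1 O2). unfold Qf in HQ.
  specialize (W_bounds _ O1). intros HW.
  assert (HvW : v s ^ 2 * cf alpha (th s) <= 2 * W alpha (th s)).
  { apply Rmult_le_reg_r with (/ W alpha (th s)); [apply Rinv_0_lt_compat; lra|].
    rewrite (Rmult_assoc 2), Rinv_r by lra. unfold Rdiv in HQ. lra. }
  assert (N <= v s ^ 2) by nra.
  assert (N * cf alpha e <= 6).
  { apply Rle_trans with (v s ^ 2 * cf alpha (th s)); [|lra].
    apply Rmult_le_compat; lra. }
  unfold N in H0. rewrite Rmult_plus_distr_r in H0. unfold Rdiv in H0.
  rewrite Rmult_assoc, Rinv_l in H0 by lra. lra.
Qed.

Lemma escape_PI2 (th v u : R -> R) (s1 : R) :
  (forall s, orbit_at alpha th v u s) -> vc < v s1 -> PI / 4 < th s1 ->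
  is_lim v p_infty p_infty /\ is_lim th p_infty (PI / 2).
Proof.
  intros Ho Hv Hth1.
  destruct (escape_0 (fun s => PI / 2 - th s) v (fun s => - u s) s1) as [H1 H2]; trivial.
  - intros s. now apply orbit_at_reflect.
  - lra.
  - split; trivial. apply is_lim_spec. apply is_lim_spec in H2. intros eps.
    destruct (H2 eps) as [S HS]. exists S. intros s Hs. specialize (HS s Hs).
    replace (th s - PI / 2) with (- (PI / 2 - th s - 0)) by ring. now rewrite Rabs_Ropp.
Qed.

End BoundedOrbits.

(** * Openness of the stable and unstable sets *)

(** Real induction towards the past: at the infimum of the good times, the step
    gives [P], and openness goes beyond. *)
Lemma backward_induction (P : R -> Prop) (s1 : R) : P s1 ->
  (forall s, exists h, 0 < h /\ forall t, 0 < t < h -> P (s + t) -> P s) ->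
  (forall s, P s -> exists e, 0 < e /\ forall t, Rabs (t - s) < e -> P t) ->
  forall s, s <= s1 -> P s.
Proof.
  intros H1 Hstep Hopen s0 Hs0. apply NNPP. intros N.
  destruct (completeness (fun s => s <= s1 /\ ~ P s)) as [m [Hm1 Hm2]].
  { exists s1. intros s [Hs _]. exact Hs. }
  { now exists s0. }
  assert (Hms : m <= s1) by (apply Hm2; intros s [Hs _]; exact Hs).
  assert (Habove : forall t, m < t <= s1 -> P t).
  { intros t Ht. apply NNPP. intros K. assert (t <= m) by (apply Hm1; now split). lra. }
  assert (Pm : P m).
  { destruct Hms as [L| ->]; trivial. destruct (Hstep m) as [h [Hh Hst]].
    pose (t := Rmin (h / 2) (s1 - m)).
    assert (K1 := Rmin_l (h / 2) (s1 - m)). assert (K2 := Rmin_r (h / 2) (s1 - m)).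
    assert (K3 : 0 < t) by (apply Rmin_pos; lra). fold t in K1, K2.
    apply (Hst t); [lra|]. apply Habove. lra. }
  destruct (Hopen m Pm) as [e [He Ho]].
  assert (m <= m - e); [|lra]. apply Hm2. intros s [Hs K]. apply Rnot_lt_le. intros L.
  apply K, Ho. assert (s <= m) by (apply Hm1; now split). apply Rabs_def1; lra.
Qed.

Section Openness.
Context {alpha : R} {Ha : admissible alpha}.
Set Default Proof Using "All".

Definition escapes (th0 : R) (th v : R -> R) : Prop :=
  is_lim v p_infty p_infty /\ is_lim th p_infty th0.

Lemma escapes_shift (th0 : R) (th v : R -> R) (c : R) :
  escapes th0 (fun s => th (s + c)) (fun s => v (s + c)) -> escapes th0 th v.
Proof.
  intros [H1 H2]. apply is_lim_spec in H1. apply is_lim_spec in H2.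
  split; apply is_lim_spec.
  - intros M. destruct (H1 M) as [S HS]. exists (S + c). intros s Hs.
    specialize (HS (s - c) ltac:(lra)). now replace (s - c + c) with s in HS by ring.
  - intros e. destruct (H2 e) as [S HS]. exists (S + c). intros s Hs.
    specialize (HS (s - c) ltac:(lra)). now replace (s - c + c) with s in HS by ring.
Qed.

(** The stability of escape, which is what continuous dependence transports
    along an orbit. *)
Definition captured (th0 x y z : R) : Prop :=
  exists d, 0 < d /\ forall th v u, (forall s, orbit_at alpha th v u s) ->
    near x y z (th 0) (v 0) (u 0) d -> escapes th0 th v.

(** Late on an escaping orbit, all nearby points lie above the level [vc] and on
    the same side of [PI / 4]. *)
Lemma captured_late (th0 : R) (th v u : R -> R) : collision th0 ->
  (forall s, orbit_at alpha th v u s) -> escapes th0 th v ->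
  exists s1, 0 <= s1 /\ captured th0 (th s1) (v s1) (u s1).
Proof.
  intros Hc Ho [H1 H2]. assert (HPI := PI_RGT_0).
  apply is_lim_spec in H1. apply is_lim_spec in H2.
  destruct (H1 (vc (alpha := alpha) + 1)) as [S1 HS1].
  assert (He : 0 < PI / 8) by lra.
  destruct (H2 (mkposreal _ He)) as [S2 HS2]. simpl in HS2.
  pose (s1 := Rmax 0 (Rmax S1 S2) + 1).
  assert (Q1 := Rmax_l 0 (Rmax S1 S2)). assert (Q2 := Rmax_r 0 (Rmax S1 S2)).
  assert (Q3 := Rmax_l S1 S2). assert (Q4 := Rmax_r S1 S2).
  exists s1. split; [unfold s1; lra|].
  specialize (HS1 s1 ltac:(unfold s1; lra)). specialize (HS2 s1 ltac:(unfold s1; lra)).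
  exists (Rmin 1 (PI / 8)). assert (K1 := Rmin_l 1 (PI / 8)). assert (K2 := Rmin_r 1 (PI / 8)).
  split; [apply Rmin_pos; lra|]. intros th' v' u' Ho' [N1 [N2 _]].
  apply Rabs_def2 in N1. apply Rabs_def2 in N2. apply Rabs_def2 in HS2.
  destruct Hc as [->| ->].
  - apply (escape_0 th' v' u' 0); trivial; lra.
  - apply (escape_PI2 th' v' u' 0); trivial; lra.
Qed.

(** Capture is brought back in time by continuous dependence. *)
Lemma captured_along (th0 : R) (th v u : R -> R) : collision th0 ->
  (forall s, orbit_at alpha th v u s) -> escapes th0 th v ->
  captured th0 (th 0) (v 0) (u 0).
Proof.
  intros Hc Ho He. destruct (captured_late th0 th v u Hc Ho He) as [s1 [Hs1 H1]].
  apply (backward_induction (fun s => captured th0 (th s) (v s) (u s)) s1); trivial.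
  - intros s. destruct (dependence (fun t => th (t + s)) (fun t => v (t + s)) (fun t => u (t + s)))
      as [h [Hh Hdep]].
    { intros t. apply orbit_at_shift, Ho. }
    exists h. split; trivial. intros t Ht [d [Hd K]].
    destruct (Hdep t Ht d Hd) as [d' [Hd' K']]. exists d'. split; trivial.
    intros th' v' u' Ho' N. rewrite Rplus_0_l in K'. specialize (K' th' v' u' Ho' N).
    rewrite (Rplus_comm t s) in K'.
    apply (escapes_shift th0 th' v' t).
    apply (K (fun r => th' (r + t)) (fun r => v' (r + t)) (fun r => u' (r + t))).
    + intros r. now apply orbit_at_shift.
    + rewrite Rplus_0_l. exact K'.
  - intros s [d [Hd K]].
    assert (Cth := th_continuous th v u Ho s). assert (Cv := v_continuous th v u Ho s).
    assert (Cu := orbit_u_continuous th v u Ho s).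
    destruct (proj1 (continuous_abs _ _) Cth (d / 2)) as [e1 [E1 F1]]; [lra|].
    destruct (proj1 (continuous_abs _ _) Cv (d / 2)) as [e2 [E2 F2]]; [lra|].
    destruct (proj1 (continuous_abs _ _) Cu (d / 2)) as [e3 [E3 F3]]; [lra|].
    exists (Rmin e1 (Rmin e2 e3)). split; [repeat apply Rmin_pos; trivial|].
    intros t Ht. assert (Q1 := Rmin_l e1 (Rmin e2 e3)). assert (Q2 := Rmin_r e1 (Rmin e2 e3)).
    assert (Q3 := Rmin_l e2 e3). assert (Q4 := Rmin_r e2 e3).
    specialize (F1 t ltac:(lra)). specialize (F2 t ltac:(lra)). specialize (F3 t ltac:(lra)).
    exists (d / 2). split; [lra|]. intros th' v' u' Ho' [N1 [N2 N3]].
    apply (K th' v' u' Ho'). apply Rabs_def2 in F1. apply Rabs_def2 in F2. apply Rabs_def2 in F3.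
    apply Rabs_def2 in N1. apply Rabs_def2 in N2. apply Rabs_def2 in N3.
    split; [|split]; apply Rabs_def1; lra.
Qed.

(** Completeness of the flow enters here: a nearby point of the manifold must
    have an orbit. *)
Lemma Ws_open (th0 x y z : R) : collision th0 -> Ws alpha th0 (x, y, z) ->
  exists d, 0 < d /\ forall x' y' z', parabolic_manifold alpha (x', y', z') ->
    near x y z x' y' z' d -> Ws alpha th0 (x', y', z').
Proof.
  intros Hc [th [v [u [[Ho E] He]]]].
  assert (Ho' := proj1 (is_orbit_iff th v u) Ho).
  destruct (captured_along th0 th v u Hc Ho' He) as [d [Hd K]].
  injection E as E1 E2 E3. rewrite E1, E2, E3 in K.
  exists d. split; trivial. intros x' y' z' Hp N.
  destruct (complete_orbit x' y' z' Hp) as [th' [v' [u' [F1 [F2 [F3 Ho2]]]]]].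
  exists th', v', u'. split.
  - split; [now apply is_orbit_iff|]. now rewrite F1, F2, F3.
  - apply (K th' v' u' Ho2). now rewrite F1, F2, F3.
Qed.

Lemma Wu_iff_Ws_reversed (th0 x y z : R) :
  Wu alpha th0 (x, y, z) <-> Ws alpha th0 (x, - y, - z).
Proof.
  split; intros [th [v [u [[Ho E] [L1 L2]]]]]; injection E as E1 E2 E3;
    exists (fun s => th (- s)), (fun s => - v (- s)), (fun s => - u (- s));
    apply is_lim_spec in L1; apply is_lim_spec in L2.
  - split; [split; [|rewrite Ropp_0, E1, E2, E3; trivial]|split; apply is_lim_spec].
    + apply is_orbit_iff. intros s. apply orbit_at_reverse. revert s Ho.
      intros s Ho. now apply is_orbit_iff.
    + intros M. destruct (L1 (- M)) as [S HS]. exists (- S). intros s Hs.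
      specialize (HS (- s) ltac:(lra)). lra.
    + intros e. destruct (L2 e) as [S HS]. exists (- S). intros s Hs. apply HS. lra.
  - split; [split; [|rewrite Ropp_0, E1, E2, E3, !Ropp_involutive; trivial]|split; apply is_lim_spec].
    + apply is_orbit_iff. intros s. apply orbit_at_reverse. now apply is_orbit_iff.
    + intros M. destruct (L1 (- M)) as [S HS]. exists (- S). intros s Hs.
      specialize (HS (- s) ltac:(lra)). lra.
    + intros e. destruct (L2 e) as [S HS]. exists (- S). intros s Hs. apply HS. lra.
Qed.

Lemma Wu_Ws_open (th0 th1 : R) : collision th0 -> collision th1 ->
  open_in (parabolic_manifold alpha) (fun p => Wu alpha th0 p /\ Ws alpha th1 p).
Proof.
  intros H0 H1. pose (A p := Wu alpha th0 p /\ Ws alpha th1 p).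
  pose (M := parabolic_manifold alpha).
  assert (HAM : forall p, A p -> M p).
  { intros p [_ [th [v [u [[Ho E] _]]]]]. rewrite <- E. apply (Ho 0). }
  assert (HA : forall p, A p -> exists d : posreal, forall p', M p' -> ball p d p' -> A p').
  { intros [[x y] z] [HWu HWs]. apply Wu_iff_Ws_reversed in HWu.
    destruct (Ws_open _ _ _ _ H1 HWs) as [d1 [D1 K1]].
    destruct (Ws_open _ _ _ _ H0 HWu) as [d2 [D2 K2]].
    exists (mkposreal _ (Rmin_pos _ _ D1 D2)). intros [[x' y'] z'] HM [[B1 B2] B3].
    simpl in B1, B2, B3.
    assert (N1 : Rabs (x' - x) < Rmin d1 d2) by exact B1.
    assert (N2 : Rabs (y' - y) < Rmin d1 d2) by exact B2.
    assert (N3 : Rabs (z' - z) < Rmin d1 d2) by exact B3.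
    assert (Q1 := Rmin_l d1 d2). assert (Q2 := Rmin_r d1 d2). split.
    - apply Wu_iff_Ws_reversed. apply K2.
      + unfold M in HM. apply parabolic_iff in HM. apply parabolic_iff. destruct HM as [M1 M2].
        split; trivial. unfold Qf in *. replace ((- y') ^ 2) with (y' ^ 2) by ring.
        rewrite <- M2. ring.
      + split; [lra|]. split.
        * replace (- y' - - y) with (- (y' - y)) by ring. rewrite Rabs_Ropp. lra.
        * replace (- z' - - z) with (- (z' - z)) by ring. rewrite Rabs_Ropp. lra.
    - apply K1; trivial. split; [lra|]. split; lra. }
  exists (fun q => exists p (d : posreal), A p /\ (forall p', M p' -> ball p d p' -> A p') /\ ball p d q).
  split.
  - intros q [p [d [Hp [HK [[B1 B2] B3]]]]].
    destruct p as [[x y] z]. destruct q as [[x' y'] z']. simpl in B1, B2, B3.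
    assert (N1 : Rabs (x' - x) < d) by exact B1.
    assert (N2 : Rabs (y' - y) < d) by exact B2.
    assert (N3 : Rabs (z' - z) < d) by exact B3.
    pose (r := Rmin (d - Rabs (x' - x)) (Rmin (d - Rabs (y' - y)) (d - Rabs (z' - z)))).
    assert (Hr : 0 < r) by (repeat apply Rmin_pos; lra).
    assert (R1 : r <= d - Rabs (x' - x)) by apply Rmin_l.
    assert (R2 : r <= d - Rabs (y' - y)) by (apply Rle_trans with (1 := Rmin_r _ _), Rmin_l).
    assert (R3 : r <= d - Rabs (z' - z)) by (apply Rle_trans with (1 := Rmin_r _ _), Rmin_r).
    exists (mkposreal _ Hr). intros [[x2 y2] z2] [[C1 C2] C3]. simpl in C1, C2, C3.
    exists ((x, y), z), d. split; trivial. split; trivial.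
    assert (W : forall a b c : R, Rabs (c - b) < r -> r <= d - Rabs (b - a) -> Rabs (c - a) < d).
    { intros a b c X Y. replace (c - a) with ((c - b) + (b - a)) by ring.
      apply Rle_lt_trans with (1 := Rabs_triang _ _). lra. }
    split; [split|].
    + apply (W x x' x2); [exact C1|exact R1].
    + apply (W y y' y2); [exact C2|exact R2].
    + apply (W z z' z2); [exact C3|exact R3].
  - intros p. split.
    + intros Hp. split; [now apply HAM|]. destruct (HA p Hp) as [d Hd].
      exists p, d. split; trivial. split; trivial. apply ball_center.
    + intros [Hm [p0 [d [_ [HK Hb]]]]]. now apply HK.
Qed.

End Openness.

(** * Barriers for the unstable branches *)

(** [f] cannot climb to a positive value, because it does not increase where it
    is positive. It need only be small somewhere in the past, as an arc that
    comes out of the equilibrium has no first instant. *)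
Lemma barrier_principle (f : R -> R) (s1 : R) :
  (forall e, 0 < e -> exists s2, s2 < s1 /\ f s2 < e /\
     (forall x, s2 <= x <= s1 -> continuous f x) /\
     (forall x, s2 < x < s1 -> 0 < f x -> exists l : R, is_derive f x l /\ l <= 0)) ->
  f s1 <= 0.
Proof.
  intros H. apply Rnot_lt_le. intros K.
  destruct (H (f s1 / 2)) as [s2 [H1 [H2 [H3 H4]]]]; [lra|].
  destruct (first_zero (fun t => f (s1 + - t) - f s1 / 2) 0 (s1 - s2)) as [c [C1 [C2 C3]]].
  - lra.
  - intros x Hx. apply: continuous_minus; [|apply continuous_const].
    apply (continuous_comp (fun t => s1 + - t) f); [|apply H3; lra].
    apply (ex_derive_continuous (fun t : R => s1 + - t)). auto_derive; trivial.
  - rewrite Ropp_0, Rplus_0_r. lra.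
  - replace (s1 + - (s1 - s2)) with s2 by ring. lra.
  - assert (G : f s1 <= f (s1 + - c)).
    { apply mono_ge; [lra|intros; apply H3; lra|]. intros x Hx. apply H4; [lra|].
      specialize (C3 (s1 - x) ltac:(lra)). replace (s1 + - (s1 - x)) with x in C3 by ring. lra. }
    lra.
Qed.

Lemma ratio_le (x y a b : R) : 0 < a -> 0 < b -> 0 <= y -> x ^ 2 * b <= y ^ 2 * a ->
  x / sqrt a <= y / sqrt b.
Proof.
  intros Ha0 Hb Hy H. assert (A := sqrt_lt_R0 a Ha0). assert (B := sqrt_lt_R0 b Hb).
  assert (A2 := sqrt_sqrt a ltac:(lra)). assert (B2 := sqrt_sqrt b ltac:(lra)).
  set (ra := sqrt a) in *. set (rb := sqrt b) in *. clearbody ra rb.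
  apply Rmult_le_reg_r with (ra * rb); [nra|].
  replace (x / ra * (ra * rb)) with (x * rb) by (field; lra).
  replace (y / rb * (ra * rb)) with (y * ra) by (field; lra).
  assert (0 <= y * ra) by nra. apply Rnot_lt_le. intros K.
  assert ((y * ra) ^ 2 < (x * rb) ^ 2) by nra.
  assert ((y * ra) ^ 2 = y ^ 2 * a) by (rewrite <- A2; ring).
  assert ((x * rb) ^ 2 = x ^ 2 * b) by (rewrite <- B2; ring). lra.
Qed.

(** In the next two inequalities [c ^ 2 (1 + E) / (1 + T)] stands for [2 U], and
    the barrier [b] solves the equation of motion with [c ^ 2 E / T] in the
    place of [2 U]. *)
Lemma upper_barrier_ineq (c T E v b : R) : 0 < c -> 0 < T <= E -> 0 < b -> b <= v + c ->
  (c ^ 2 * (1 + E) / (1 + T) - v ^ 2) * b <= (c ^ 2 * E / T - (b - c) ^ 2) * (v + c).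
Proof.
  intros Hc HT Hb Hbv. set (a := v + c) in *.
  pose (D := c ^ 2 * (1 + E) / (1 + T) - c ^ 2).
  assert (HD : 0 <= D).
  { unfold D. replace (c ^ 2 * (1 + E) / (1 + T) - c ^ 2) with (c ^ 2 * ((E - T) / (1 + T))) by (field; lra).
    apply Rmult_le_pos; [nra|]. apply Rdiv_le_0_compat; lra. }
  assert (HD2 : D + c ^ 2 <= c ^ 2 * E / T).
  { unfold D. cut (0 <= c ^ 2 * E / T - c ^ 2 * (1 + E) / (1 + T)); [lra|].
    replace (c ^ 2 * E / T - c ^ 2 * (1 + E) / (1 + T)) with (c ^ 2 * ((E - T) / (T * (1 + T)))) by (field; lra).
    apply Rmult_le_pos; [nra|]. apply Rdiv_le_0_compat; nra. }
  replace (c ^ 2 * (1 + E) / (1 + T) - v ^ 2) with (D + 2 * c * a - a ^ 2) by (unfold D, a; ring).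
  apply Rle_trans with ((D + 2 * c * b - b ^ 2) * a).
  - cut (0 <= (a - b) * (D + a * b)); [nra|]. apply Rmult_le_pos; nra.
  - apply Rmult_le_compat_r; [lra|]. nra.
Qed.

Lemma lower_barrier_ineq (c T E v b : R) : 0 < c -> 0 < T <= E -> 0 < b ->
  0 < v + c -> v + c <= T / (1 + T) * b -> (b - c) ^ 2 <= c ^ 2 * E / T ->
  (T / (1 + T)) ^ 2 * (c ^ 2 * E / T - (b - c) ^ 2) * (v + c)
    <= (c ^ 2 * (1 + E) / (1 + T) - v ^ 2) * (T / (1 + T) * b).
Proof.
  intros Hc HT Hb Ha0 Hba Hy. set (a := v + c) in *. set (y := c ^ 2 * E / T) in *.
  pose (q := T / (1 + T)). fold q in Hba |- *.
  assert (Hq : 0 < q < 1).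
  { unfold q. split; [apply Rdiv_lt_0_compat; lra|].
    apply Rmult_lt_reg_r with (1 + T); [lra|]. unfold Rdiv. rewrite Rmult_assoc, Rinv_l by lra. lra. }
  assert (EU : c ^ 2 * (1 + E) / (1 + T) = (1 - q) * c ^ 2 + q * y) by (unfold q, y; field; lra).
  assert (Hcy : c ^ 2 <= y).
  { unfold y. cut (0 <= c ^ 2 * E / T - c ^ 2); [lra|].
    replace (c ^ 2 * E / T - c ^ 2) with (c ^ 2 * ((E - T) / T)) by (field; lra).
    apply Rmult_le_pos; [nra|]. apply Rdiv_le_0_compat; lra. }
  rewrite EU. pose (D := q * (y - c ^ 2)). assert (HD : 0 <= D) by (apply Rmult_le_pos; lra).
  replace ((1 - q) * c ^ 2 + q * y - v ^ 2) with (D + 2 * c * a - a ^ 2) by (unfold D, a; ring).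
  apply Rle_trans with ((D + 2 * c * (q * b) - (q * b) ^ 2) * a).
  - apply Rmult_le_compat_r; [lra|].
    cut (0 <= q * (1 - q) * (y + 2 * c * (b - c) + c ^ 2)); [unfold D; nra|].
    apply Rmult_le_pos; nra.
  - cut (0 <= (q * b - a) * (D + a * (q * b))); [nra|].
    apply Rmult_le_pos; [lra|]. assert (0 < q * b) by nra. nra.
Qed.

Section Barriers.
Context {alpha : R} {Ha : admissible alpha}.
Set Default Proof Using "All".

(** The value of [sep] at [PI / 4]. *)
Definition sep_min : R := 2 * Rpower 2 (alpha / 2).
Definition kappa : R := vc (alpha := alpha) / sqrt sep_min.

(** The potential without its constant term, up to a factor: the equation of
    motion that it defines separates, and is solved by [height]. *)
Definition sep (x : R) : R := Rpower (sin x) (- alpha) + Rpower (cos x) (- alpha).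

(** The height above the level [v = - vc] of an explicit solution for the
    separable potential, on an arc where [th] moves in the direction [sg];
    [slope] is its speed [|w|]. *)
Definition height (sg x : R) : R :=
  vc (alpha := alpha) - kappa * (rpow (sin x) (1 - alpha / 2) + sg * rpow (cos x) (1 - alpha / 2)).
Definition slope (sg x : R) : R :=
  kappa * (Rpower (cos x) (- (alpha / 2)) * sin x - sg * (Rpower (sin x) (- (alpha / 2)) * cos x)).

Lemma sep_min_ge_2 : 2 <= sep_min.
Proof.
  unfold sep_min. assert (K := alpha_bounds). assert (1 <= Rpower 2 (alpha / 2)); [|lra].
  rewrite <- (Rpower_O 2) by lra. apply Rle_Rpower; lra.
Qed.

Lemma kappa_sq : kappa ^ 2 = vc (alpha := alpha) ^ 2 / sep_min.
Proof.
  unfold kappa. assert (K := sep_min_ge_2). assert (P := sqrt_lt_R0 sep_min ltac:(lra)).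
  replace ((vc / sqrt sep_min) ^ 2) with (vc (alpha := alpha) ^ 2 / (sqrt sep_min * sqrt sep_min)) by (field; lra).
  rewrite sqrt_sqrt by lra. trivial.
Qed.

Lemma kappa_bounds : 0 < kappa < vc (alpha := alpha).
Proof.
  assert (K := sep_min_ge_2). assert (V := vc_pos).
  assert (P : 1 < sqrt sep_min) by (rewrite <- sqrt_1; apply sqrt_lt_1; lra).
  unfold kappa. split; [apply Rdiv_lt_0_compat; lra|].
  apply Rmult_lt_reg_r with (sqrt sep_min); [lra|]. unfold Rdiv.
  rewrite Rmult_assoc, Rinv_l by lra. nra.
Qed.

Lemma Rpower_inv_sqrt2 (a : R) : Rpower (1 / sqrt 2) a = Rpower 2 (- (a / 2)).
Proof.
  assert (P := sqrt_lt_R0 2 ltac:(lra)). unfold Rdiv at 1. rewrite Rmult_1_l.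
  unfold Rpower. rewrite ln_Rinv by trivial.
  rewrite <- (Rpower_sqrt 2) by lra. unfold Rpower. rewrite ln_exp. f_equal. field.
Qed.

Lemma U_sep (x : R) : 2 * U alpha x = vc (alpha := alpha) ^ 2 * (1 + sep x) / (1 + sep_min).
Proof.
  assert (K := sep_min_ge_2). rewrite vc_sq. unfold U. rewrite sin_PI4, cos_PI4, Rpower_inv_sqrt2.
  replace (- (- alpha / 2)) with (alpha / 2) by field.
  fold (sep x). replace (1 + Rpower 2 (alpha / 2) + Rpower 2 (alpha / 2)) with (1 + sep_min) by (unfold sep_min; ring).
  rewrite Rplus_assoc. fold (sep x). field. lra.
Qed.

Lemma sep_gt (x : R) : 0 < x < PI / 2 -> x <> PI / 4 -> sep_min < sep x.
Proof.
  intros Hx N. assert (K := sep_min_ge_2). assert (V := vc_pos).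
  assert (H := U_min_strict x Hx N). assert (H1 := U_sep x).
  assert (H2 : vc (alpha := alpha) ^ 2 < 2 * U alpha x) by (rewrite vc_sq; lra).
  rewrite H1 in H2. apply (Rmult_lt_compat_r (1 + sep_min)) in H2; [|lra].
  unfold Rdiv in H2. rewrite (Rmult_assoc _ (/ (1 + sep_min))), Rinv_l in H2 by lra.
  apply Rnot_le_lt. intros L. nra.
Qed.

Lemma sep_ge (x : R) : 0 < x < PI / 2 -> sep_min <= sep x.
Proof.
  intros Hx. destruct (Req_dec x (PI / 4)) as [->|N]; [|left; now apply sep_gt].
  unfold sep. rewrite sin_PI4, cos_PI4, Rpower_inv_sqrt2.
  replace (- (- alpha / 2)) with (alpha / 2) by field. unfold sep_min. lra.
Qed.

Lemma height_PI4 : height 1 (PI / 4) = 0.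
Proof.
  unfold height. rewrite sin_PI4, cos_PI4. assert (P := sqrt_lt_R0 2 ltac:(lra)).
  rewrite rpow_of_pos by (apply Rdiv_lt_0_compat; lra). rewrite Rpower_inv_sqrt2.
  assert (K := sep_min_ge_2). assert (Q := sqrt_lt_R0 sep_min ltac:(lra)).
  assert (E : sqrt sep_min = 2 * Rpower 2 (- ((1 - alpha / 2) / 2))).
  { assert (E1 : sep_min = Rpower 2 (1 + alpha / 2)).
    { unfold sep_min. rewrite Rpower_plus, Rpower_1 by lra. trivial. }
    rewrite E1, <- Rpower_sqrt by apply Rpower_pos. rewrite Rpower_mult.
    transitivity (Rpower 2 1 * Rpower 2 (- ((1 - alpha / 2) / 2))).
    - rewrite <- Rpower_plus. f_equal. field.
    - rewrite Rpower_1 by lra. trivial. }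
  unfold kappa.
  replace (Rpower 2 (- ((1 - alpha / 2) / 2)) + 1 * Rpower 2 (- ((1 - alpha / 2) / 2)))
    with (sqrt sep_min) by (rewrite E; ring).
  field. lra.
Qed.

(** The energy relation of the separable potential [vc ^ 2 * sep / sep_min]. It
    holds because [sin^2 + cos^2 = 1]. *)
Lemma height_energy (sg x : R) : 0 < x < PI / 2 -> sg ^ 2 = 1 ->
  slope sg x ^ 2 = vc (alpha := alpha) ^ 2 * sep x / sep_min - (height sg x - vc (alpha := alpha)) ^ 2.
Proof.
  intros Hx Hsg. destruct (sin_cos_interior x Hx) as [Hs [Hc _]].
  unfold height. rewrite !rpow_of_pos by trivial.
  replace (1 - alpha / 2) with (1 + - (alpha / 2)) by ring. rewrite !Rpower_plus, !Rpower_1 by trivial.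
  assert (E : sep x = Rpower (sin x) (- (alpha / 2)) ^ 2 + Rpower (cos x) (- (alpha / 2)) ^ 2).
  { unfold sep. replace (- alpha) with (- (alpha / 2) + - (alpha / 2)) by field.
    rewrite !Rpower_plus. ring. }
  rewrite E. unfold slope. assert (K := kappa_sq).
  set (P := Rpower (cos x) (- (alpha / 2))). set (Q := Rpower (sin x) (- (alpha / 2))).
  assert (Htt := sep_min_ge_2).
  replace (vc (alpha := alpha) ^ 2 * (Q ^ 2 + P ^ 2) / sep_min) with (kappa ^ 2 * (Q ^ 2 + P ^ 2)) by (rewrite K; field; lra).
  assert (S := sin2_cos2 x). unfold Rsqr in S.
  assert (Key : (P * sin x - sg * (Q * cos x)) ^ 2 + (sin x * Q + sg * (cos x * P)) ^ 2
     = (Q ^ 2 + P ^ 2) * (sin x * sin x + sg ^ 2 * (cos x * cos x))) by ring.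
  rewrite Hsg, Rmult_1_l, S, Rmult_1_r in Key. rewrite <- Key. ring.
Qed.

Lemma derive_height (sg x : R) : 0 < x < PI / 2 -> sg ^ 2 = 1 ->
  is_derive (height sg) x ((1 - alpha / 2) * (sg * slope sg x)).
Proof.
  intros Hx Hsg. destruct (sin_cos_interior x Hx) as [Hs [Hc _]].
  apply (is_derive_ext_loc (fun x => vc (alpha := alpha) - kappa * (Rpower (sin x) (1 - alpha / 2)
     + sg * Rpower (cos x) (1 - alpha / 2)))).
  - apply (locally_of_lt _ 0 (PI / 2)); trivial. intros t Ht.
    destruct (sin_cos_interior t Ht) as [Hs' [Hc' _]]. unfold height. now rewrite !rpow_of_pos.
  - eapply derive_minus; [apply: is_derive_const| |].
    + eapply derive_scal; [|reflexivity]. eapply derive_plus; [| |reflexivity].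
      * eapply derive_Rpower; [apply is_derive_Reals, derivable_pt_lim_sin|trivial|reflexivity].
      * eapply derive_scal; [|reflexivity].
        eapply derive_Rpower; [apply is_derive_Reals, derivable_pt_lim_cos|trivial|reflexivity].
    + unfold slope, zero; simpl.
      replace (1 - alpha / 2 - 1) with (- (alpha / 2)) by ring.
      replace (sg * (kappa * (Rpower (cos x) (- (alpha / 2)) * sin x
           - sg * (Rpower (sin x) (- (alpha / 2)) * cos x))))
        with (kappa * (sg * (Rpower (cos x) (- (alpha / 2)) * sin x)
           - sg ^ 2 * (Rpower (sin x) (- (alpha / 2)) * cos x))) by ring.
      rewrite Hsg. ring.
Qed.

Lemma height_continuous (sg x : R) : continuous (height sg) x.
Proof.
  assert (Hk : 0 < 1 - alpha / 2) by (specialize alpha_bounds; lra).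
  apply: continuous_minus; [apply: continuous_const|].
  apply: continuous_mult; [apply: continuous_const|].
  apply: continuous_plus.
  - apply (continuous_comp sin (fun y => rpow y (1 - alpha / 2))); [|now apply rpow_continuous].
    apply continuity_pt_filterlim, continuity_sin.
  - apply: continuous_mult; [apply: continuous_const|].
    apply (continuous_comp cos (fun y => rpow y (1 - alpha / 2))); [|now apply rpow_continuous].
    apply continuity_pt_filterlim, continuity_cos.
Qed.

Lemma slope_1_pos (x : R) : PI / 4 < x < PI / 2 -> 0 < slope 1 x.
Proof.
  intros Hx. assert (HPI := PI_RGT_0). assert (Ha0 := alpha_bounds).
  destruct (sin_cos_interior x ltac:(lra)) as [Hs [Hc _]].
  assert (Hsc : cos x < sin x).
  { rewrite <- (sin_compl (alpha := alpha) x). apply sin_increasing_1; lra. }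
  assert (HP : Rpower (sin x) (- (alpha / 2)) <= Rpower (cos x) (- (alpha / 2))).
  { rewrite !Rpower_Ropp. apply Rinv_le_contravar; [apply Rpower_pos|]. apply Rle_Rpower_l; lra. }
  assert (HQ := Rpower_pos (sin x) (- (alpha / 2))). assert (K := kappa_bounds).
  unfold slope. apply Rmult_lt_0_compat; [lra|]. nra.
Qed.

Lemma slope_m1_pos (x : R) : 0 < x < PI / 2 -> 0 < slope (- 1) x.
Proof.
  intros Hx. destruct (sin_cos_interior x Hx) as [Hs [Hc _]].
  assert (HP := Rpower_pos (cos x) (- (alpha / 2))).
  assert (HQ := Rpower_pos (sin x) (- (alpha / 2))). assert (K := kappa_bounds).
  unfold slope. apply Rmult_lt_0_compat; [lra|]. nra.
Qed.

Lemma height_1_pos (x : R) : PI / 4 < x <= PI / 2 -> 0 < height 1 x.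
Proof.
  intros Hx. assert (HPI := PI_RGT_0). assert (Ha0 := alpha_bounds). rewrite <- height_PI4.
  apply mono_lt; [lra|intros; apply height_continuous|].
  intros t Ht. eexists. split; [apply derive_height; [lra|ring]|].
  assert (K := slope_1_pos t ltac:(lra)). rewrite Rmult_1_l. apply Rmult_lt_0_compat; lra.
Qed.

Lemma rpow_sin_cos_bounds (x : R) : 0 <= x <= PI / 2 ->
  0 <= rpow (sin x) (1 - alpha / 2) <= 1 /\ 0 <= rpow (cos x) (1 - alpha / 2) <= 1.
Proof.
  intros Hx. destruct (sin_cos_closed x Hx) as [Hs [Hc _]]. assert (Ha0 := alpha_bounds).
  split; (split; [apply rpow_nonneg|]);
    (apply Rle_trans with (rpow 1 (1 - alpha / 2)); [apply rpow_le; lra|rewrite rpow_1; lra]).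
Qed.

Lemma height_m1_pos (x : R) : 0 <= x <= PI / 2 -> 0 < height (- 1) x.
Proof.
  intros Hx. destruct (rpow_sin_cos_bounds x Hx) as [H1 H2]. assert (K := kappa_bounds).
  unfold height. nra.
Qed.

Lemma height_PI2 (sg : R) : height sg (PI / 2) = vc (alpha := alpha) - kappa.
Proof.
  unfold height. rewrite sin_PI2, cos_PI2, rpow_1, (rpow_of_nonpos 0) by lra. ring.
Qed.

Lemma height_m1_0 : height (- 1) 0 = vc (alpha := alpha) + kappa.
Proof.
  unfold height. rewrite sin_0, cos_0, rpow_1, (rpow_of_nonpos 0) by lra. ring.
Qed.

Definition ratio : R := sep_min / (1 + sep_min).

Lemma ratio_bounds : 0 < ratio < 1.
Proof.
  assert (K := sep_min_ge_2). unfold ratio. split; [apply Rdiv_lt_0_compat; lra|].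
  apply Rmult_lt_reg_r with (1 + sep_min); [lra|]. unfold Rdiv. rewrite Rmult_assoc, Rinv_l by lra. lra.
Qed.

(** At the second collision the lower barrier is already above the level [v =
    0]. *)
Lemma lower_barrier_wins : vc (alpha := alpha) < ratio * height (- 1) 0.
Proof.
  rewrite height_m1_0. assert (K := sep_min_ge_2). assert (V := vc_pos).
  assert (P : 1 < sqrt sep_min) by (rewrite <- sqrt_1; apply sqrt_lt_1; lra).
  assert (S := sqrt_sqrt sep_min ltac:(lra)).
  unfold ratio, kappa. set (r := sqrt sep_min) in *. rewrite <- S.
  apply Rmult_lt_reg_r with (1 + r * r); [nra|].
  replace (r * r / (1 + r * r) * (vc + vc / r) * (1 + r * r))
    with (vc (alpha := alpha) * (r * r + r)) by (field; nra).
  apply Rmult_lt_compat_l; lra.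
Qed.

Definition gap_up (th v : R -> R) (sg s : R) : R :=
  sqrt (v s + vc (alpha := alpha)) - sqrt (height sg (th s)).
Definition gap_low (th v : R -> R) (sg s : R) : R :=
  sqrt (ratio * height sg (th s)) - sqrt (v s + vc (alpha := alpha)).

Section Branch.
Variables th v u : R -> R.
Hypothesis Ho : forall s, orbit_at alpha th v u s.
Hypothesis Habove : forall s, - vc (alpha := alpha) < v s.

Local Notation up := (gap_up th v).
Local Notation low := (gap_low th v).

(** While the orbit moves in the direction [sg], a violation of either barrier
    does not grow. Square roots of the heights above the level of the
    equilibrium are compared, because [dv/dth] there is not a Lipschitz function
    of [v]. *)
Lemma barrier_steps (sg s : R) : sg ^ 2 = 1 -> 0 < th s < PI / 2 -> 0 < sg * u s ->
  0 < slope sg (th s) -> 0 < height sg (th s) ->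
  (0 < up sg s -> exists l : R, is_derive (up sg) s l /\ l <= 0) /\
  (0 < low sg s -> exists l : R, is_derive (low sg) s l /\ l <= 0).
Proof.
  intros Hsg Hi Hu Hsl Hb. destruct (Ho s) as [O1 [O2 [O3 [O4 _]]]].
  assert (Ha0 := alpha_bounds). assert (Hg := gf_pos (th s) Hi).
  assert (Hq := ratio_bounds). assert (V := vc_pos). assert (Htt := sep_min_ge_2).
  set (w := velocity alpha (th s) (u s)) in *.
  assert (Hw2 := velocity_sq _ _ _ Hi O2). fold w in Hw2. rewrite U_sep in Hw2.
  assert (Huw := u_eq (th s) (u s) Hi). fold w in Huw.
  assert (Hw : 0 < sg * w).
  { apply Rmult_lt_reg_l with (gf alpha (th s)); trivial. rewrite Rmult_0_r.
    replace (gf alpha (th s) * (sg * w)) with (sg * (gf alpha (th s) * w)) by ring. now rewrite <- Huw. }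
  assert (Hw3 : (sg * w) ^ 2 = w ^ 2) by (rewrite Rpow_mult_distr, Hsg; ring).
  assert (Dv : is_derive v s ((1 - alpha / 2) * (sg * u s) * (sg * w))).
  { eapply derive_eq; [exact O4|]. rewrite Rmult_assoc, (sqrtW_Qf _ _ _ Hi O2). fold w.
    transitivity ((1 - alpha / 2) * (sg ^ 2 * (gf alpha (th s) * w * w))); [rewrite Hsg; ring|].
    rewrite <- Huw. ring. }
  assert (Da : is_derive (fun s => sqrt (v s + vc (alpha := alpha))) s
     ((1 - alpha / 2) * (sg * u s) / 2 * (sg * w / sqrt (v s + vc (alpha := alpha))))).
  { assert (Hap : 0 < v s + vc (alpha := alpha)) by (specialize (Habove s); lra).
    eapply derive_sqrt; [eapply derive_plus; [exact Dv|apply: is_derive_const|reflexivity]|trivial|].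
    unfold zero; simpl. field. assert (P := sqrt_lt_R0 _ Hap). lra. }
  assert (Db : is_derive (fun s => height sg (th s)) s ((1 - alpha / 2) * (sg * u s) * slope sg (th s))).
  { eapply derive_comp; [now apply derive_height|exact O3|ring]. }
  assert (Hap : 0 < v s + vc (alpha := alpha)) by (specialize (Habove s); lra).
  assert (Een := height_energy sg (th s) Hi Hsg). assert (Eee := sep_ge (th s) Hi).
  assert (Hk : 0 < (1 - alpha / 2) * (sg * u s) / 2).
  { assert (0 < (1 - alpha / 2) * (sg * u s)) by (apply Rmult_lt_0_compat; lra). lra. }
  split; intros Hf.
  - exists ((1 - alpha / 2) * (sg * u s) / 2 * (sg * w / sqrt (v s + vc (alpha := alpha)))
            - (1 - alpha / 2) * (sg * u s) / 2 * (slope sg (th s) / sqrt (height sg (th s)))).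
    split.
    + eapply derive_minus; [exact Da|eapply derive_sqrt; [exact Db|trivial|reflexivity]|].
      field. assert (P := sqrt_lt_R0 _ Hb). assert (P2 := sqrt_lt_R0 _ Hap). lra.
    + rewrite <- Rmult_minus_distr_l.
      assert (K : sg * w / sqrt (v s + vc (alpha := alpha)) <= slope sg (th s) / sqrt (height sg (th s))); [|nra].
      apply ratio_le; trivial; [lra|]. rewrite Hw3, Hw2, Een.
      apply upper_barrier_ineq; trivial; [lra|]. unfold gap_up in Hf. apply sqrt_le_0; lra.
  - assert (Hqb : 0 < ratio * height sg (th s)) by (apply Rmult_lt_0_compat; lra).
    exists ((1 - alpha / 2) * (sg * u s) / 2 * (ratio * slope sg (th s) / sqrt (ratio * height sg (th s)))
            - (1 - alpha / 2) * (sg * u s) / 2 * (sg * w / sqrt (v s + vc (alpha := alpha)))).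
    split.
    + eapply derive_minus; [eapply derive_sqrt; [eapply derive_scal; [exact Db|reflexivity]|trivial|reflexivity]|exact Da|].
      field. assert (P := sqrt_lt_R0 _ Hqb). assert (P2 := sqrt_lt_R0 _ Hap). lra.
    + rewrite <- Rmult_minus_distr_l.
      assert (K : ratio * slope sg (th s) / sqrt (ratio * height sg (th s)) <= sg * w / sqrt (v s + vc (alpha := alpha))); [|nra].
      apply ratio_le; trivial; [lra|]. rewrite Hw3, Hw2, Rpow_mult_distr, Een.
      apply lower_barrier_ineq; trivial; [lra| |].
      * unfold gap_low in Hf. fold ratio. apply sqrt_le_0; lra.
      * assert (P := pow2_ge_0 (slope sg (th s))). lra.
Qed.

Lemma up_low_continuous (sg s : R) : 0 <= height sg (th s) ->
  continuous (up sg) s /\ continuous (low sg) s.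
Proof.
  intros Hb. assert (Hq := ratio_bounds).
  assert (Ca : continuous (fun s => sqrt (v s + vc (alpha := alpha))) s).
  { apply (continuous_comp (fun s => v s + vc (alpha := alpha)) sqrt).
    - apply: continuous_plus; [now apply (v_continuous th v u)|apply continuous_const].
    - apply continuity_pt_filterlim, continuity_pt_sqrt. specialize (Habove s). lra. }
  assert (Cb : continuous (fun s => height sg (th s)) s).
  { apply (continuous_comp th (height sg)); [now apply (th_continuous th v u)|apply height_continuous]. }
  split; apply: continuous_minus; trivial.
  - apply (continuous_comp (fun s => height sg (th s)) sqrt); trivial.
    now apply continuity_pt_filterlim, continuity_pt_sqrt.
  - apply (continuous_comp (fun s => ratio * height sg (th s)) sqrt).
    + apply: continuous_mult; [apply: continuous_const|trivial].
    + apply continuity_pt_filterlim, continuity_pt_sqrt. apply Rmult_le_pos; lra.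
Qed.

(** One-sided in [v], since the orbits considered satisfy [v > - vc]. *)
Definition from_c_minus (th v : R -> R) : Prop :=
  forall e, 0 < e -> exists S, forall s, s < S ->
    Rabs (th s - PI / 4) < e /\ v s + vc (alpha := alpha) < e.

(** Both gaps tend to [0] at the equilibrium, as [height 1] vanishes at [PI /
    4]. *)
Lemma first_arc (T : R) : from_c_minus th v ->
  (forall s, s < T -> 0 < th s < PI / 2 /\ 0 < u s) ->
  forall s, s <= T -> PI / 4 < th s /\ up 1 s <= 0 /\ low 1 s <= 0.
Proof.
  intros Hlim Harc. assert (HPI := PI_RGT_0). assert (Hq := ratio_bounds).
  assert (Hmono : forall s t, s < t -> t <= T -> th s < th t).
  { intros s t Hst Ht. apply mono_lt; trivial; [intros; now apply (th_continuous th v u)|].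
    intros x Hx. exists (u x). split; [apply Ho|apply Harc; lra]. }
  assert (Hright : forall s, s <= T -> PI / 4 < th s).
  { intros s Hs. apply Rnot_le_lt. intros K.
    assert (K1 := Hmono (s - 1) s ltac:(lra) Hs).
    destruct (Hlim (PI / 4 - th (s - 1))) as [S HS]; [lra|].
    pose (r := Rmin (S - 1) (s - 2)). assert (Q1 := Rmin_l (S - 1) (s - 2)). assert (Q2 := Rmin_r (S - 1) (s - 2)).
    destruct (HS r ltac:(unfold r; lra)) as [L _]. apply Rabs_def2 in L.
    assert (K2 := Hmono r (s - 1) ltac:(unfold r; lra) ltac:(lra)). lra. }
  assert (Hb : forall s, s <= T -> 0 < height 1 (th s)).
  { intros s Hs. apply height_1_pos. split; [now apply Hright|]. apply (Ho s). }
  assert (Hst : forall s, s < T -> (0 < up 1 s -> exists l : R, is_derive (up 1) s l /\ l <= 0) /\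
                                  (0 < low 1 s -> exists l : R, is_derive (low 1) s l /\ l <= 0)).
  { intros s Hs. destruct (Harc s Hs) as [A1 A2].
    apply barrier_steps; [ring|trivial|lra| |apply Hb; lra].
    apply slope_1_pos. split; [apply Hright; lra|lra]. }
  intros s1 Hs1. split; [now apply Hright|]. split; apply barrier_principle; intros e He.
  - destruct (Hlim (e ^ 2)) as [S HS]; [nra|]. exists (Rmin (S - 1) (s1 - 1)).
    assert (Q1 := Rmin_l (S - 1) (s1 - 1)). assert (Q2 := Rmin_r (S - 1) (s1 - 1)).
    set (s2 := Rmin (S - 1) (s1 - 1)) in *. split; [lra|]. split; [|split].
    + destruct (HS s2 ltac:(lra)) as [_ L]. unfold gap_up.
      assert (P := sqrt_pos (height 1 (th s2))).
      assert (sqrt (v s2 + vc (alpha := alpha)) < e); [|lra].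
      rewrite <- (sqrt_pow2 e) by lra. apply sqrt_lt_1; trivial.
      * specialize (Habove s2). lra.
      * apply pow2_ge_0.
    + intros x Hx. apply up_low_continuous. left. apply Hb. lra.
    + intros x Hx. apply Hst. lra.
  - destruct (proj1 (continuous_abs _ _) (height_continuous 1 (PI / 4)) (e ^ 2)) as [d [Hd0 Hd]]; [nra|].
    destruct (Hlim d Hd0) as [S HS]. exists (Rmin (S - 1) (s1 - 1)).
    assert (Q1 := Rmin_l (S - 1) (s1 - 1)). assert (Q2 := Rmin_r (S - 1) (s1 - 1)).
    set (s2 := Rmin (S - 1) (s1 - 1)) in *. split; [lra|]. split; [|split].
    + destruct (HS s2 ltac:(lra)) as [L _]. specialize (Hd _ L). rewrite height_PI4 in Hd.
      apply Rabs_def2 in Hd. unfold gap_low. specialize (Hb s2 ltac:(lra)).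
      assert (P := sqrt_pos (v s2 + vc (alpha := alpha))).
      assert (sqrt (ratio * height 1 (th s2)) < e); [|lra].
      rewrite <- (sqrt_pow2 e) by lra. apply sqrt_lt_1; [nra|apply pow2_ge_0|nra].
    + intros x Hx. apply up_low_continuous. left. apply Hb. lra.
    + intros x Hx. apply Hst. lra.
Qed.

(** [height 1] and [height (- 1)] agree at the collision, so the barriers of the
    first arc are passed on to the second. *)
Lemma second_arc (sc T : R) : th sc = PI / 2 -> up 1 sc <= 0 -> low 1 sc <= 0 ->
  (forall s, sc < s < T -> 0 < th s < PI / 2 /\ u s < 0) ->
  forall s, sc < s <= T -> up (- 1) s <= 0 /\ low (- 1) s <= 0.
Proof.
  intros Hsc Hup Hlow Harc.
  assert (Hb : forall s, 0 < height (- 1) (th s)) by (intros s; apply height_m1_pos, (Ho s)).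
  assert (Hst : forall s, sc < s < T -> (0 < up (- 1) s -> exists l : R, is_derive (up (- 1)) s l /\ l <= 0) /\
                                  (0 < low (- 1) s -> exists l : R, is_derive (low (- 1)) s l /\ l <= 0)).
  { intros s Hs. destruct (Harc s Hs) as [A1 A2].
    apply barrier_steps; [ring|trivial|lra|now apply slope_m1_pos|apply Hb]. }
  intros s1 Hs1. split; apply barrier_principle; intros e He; exists sc; (split; [lra|]); split.
  - unfold gap_up in *. rewrite Hsc, height_PI2 in *. lra.
  - split; [intros; apply up_low_continuous; left; apply Hb|]. intros x Hx. apply Hst. lra.
  - unfold gap_low in *. rewrite Hsc, height_PI2 in *. lra.
  - split; [intros; apply up_low_continuous; left; apply Hb|]. intros x Hx. apply Hst. lra.
Qed.

End Branch.
End Barriers.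

(** * No orbit joins the two equilibria *)

Section NoConnection.
Context {alpha : R} {Ha : admissible alpha}.
Set Default Proof Using "All".

Local Notation c := (vc (alpha := alpha)).

Lemma slow_moves (th v u : R -> R) (s : R) : orbit_at alpha th v u s ->
  0 < th s < PI / 2 -> - c < v s < c -> u s <> 0.
Proof.
  intros [_ [O2 _]] Hi Hv E. assert (Hw := velocity_sq _ _ _ Hi O2).
  rewrite velocity_eq, E in Hw. unfold Rdiv in Hw. rewrite Rmult_0_l in Hw.
  assert (K := U_min (th s) Hi). assert (V := vc_sq (alpha := alpha)). simpl in Hw. nra.
Qed.

(** The upper barrier of the first arc is below [v = 0], so the first collision
    comes before [s0]; the lower barrier of the second arc is above [v = 0] at
    its end, so the second collision comes after [s0]. Hence [u s0 < 0]. On the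
    second arc the upper barrier is at most [0] as long as [th >= PI / 4], and
    the orbit is strictly below it, so [th s0 < PI / 4]. *)
Lemma crossing_sign_rightward (th v u : R -> R) (s0 : R) :
  (forall s, orbit_at alpha th v u s) -> (forall s, - c < v s) ->
  from_c_minus (alpha := alpha) th v -> (exists S, forall s, s < S -> 0 < u s) -> v s0 = 0 ->
  0 < u s0 * (th s0 - PI / 4).
Proof.
  intros Ho Habove Hlim [S Hu] Hv0. assert (HPI := PI_RGT_0). assert (V := vc_pos (alpha := alpha)).
  assert (Hk := kappa_bounds (alpha := alpha)). assert (Hvm := v_mono th v u Ho).
  assert (Hrange : forall s, 0 <= th s <= PI / 2) by (intros s; apply (Ho s)).
  assert (Hcf0 : forall s, cf alpha (th s) = 0 -> collision (th s)).
  { intros s E. apply NNPP. intros N. assert (K := cf_pos _ (not_collision _ (Hrange s) N)). lra. }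
  assert (Ccf : forall s, continuous (fun s => cf alpha (th s)) s).
  { intros s. apply (continuous_comp th (cf alpha)); [now apply (th_continuous th v u)|apply cf_continuous]. }
  assert (Cu : forall s, continuous u s) by now apply (orbit_u_continuous th v u).
  assert (Hmove : forall s, s <= s0 -> 0 < th s < PI / 2 -> u s <> 0).
  { intros s Hs Hi. apply (slow_moves th v u s (Ho s) Hi). specialize (Hvm s s0 Hs).
    specialize (Habove s). lra. }
  destruct (Hlim (PI / 8)) as [S1 HS1]; [lra|].
  assert (Hstart : forall s, s < S1 -> 0 < th s < PI / 2).
  { intros s Hs. destruct (HS1 s Hs) as [K _]. apply Rabs_def2 in K. lra. }
  assert (Hpos : forall T, T <= s0 -> (forall s, s < T -> 0 < th s < PI / 2) -> forall s, s < T -> 0 < u s).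
  { intros T HT Hin s Hs. pose (r := Rmin (S - 1) s).
    assert (Q1 := Rmin_l (S - 1) s). assert (Q2 := Rmin_r (S - 1) s). fold r in Q1, Q2.
    apply (sign_pos u r s); [trivial|intros; apply Cu| |].
    - intros x Hx. apply Hmove; [lra|apply Hin; lra].
    - apply Hu. lra. }
  assert (Hvbar : forall sg s, 0 <= height (alpha := alpha) sg (th s) -> gap_up (alpha := alpha) th v sg s <= 0 -> v s <= height (alpha := alpha) sg (th s) - c).
  { intros sg s Hb Hg. unfold gap_up in Hg.
    assert (v s + c <= height (alpha := alpha) sg (th s)); [|lra]. apply sqrt_le_0; trivial; [|lra].
    specialize (Habove s). lra. }
  assert (Hbar1 : forall s, PI / 4 < th s -> 0 < height (alpha := alpha) 1 (th s) /\ height (alpha := alpha) 1 (th s) < c).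
  { intros s Hs. split; [apply height_1_pos; split; [trivial|apply Hrange]|].
    unfold height. destruct (rpow_sin_cos_bounds (th s) (Hrange s)) as [B1 B2].
    assert (0 < rpow (sin (th s)) (1 - alpha / 2)).
    { rewrite rpow_of_pos; [apply Rpower_pos|]. apply sin_gt_0; specialize (Hrange s); lra. }
    nra. }
  destruct (classic (exists s1, s1 <= s0 /\ collision (th s1))) as [[s1 [Hs1 Hc1]]|Hnone].
  2:{ exfalso.
      assert (Hin : forall s, s <= s0 -> 0 < th s < PI / 2).
      { intros s Hs. apply not_collision; [apply Hrange|]. intros K. apply Hnone. now exists s. }
      destruct (first_arc th v u Ho Habove s0 Hlim) with (s := s0) as [A1 [A2 _]]; [|lra|].
      - intros s Hs. split; [apply Hin; lra|]. apply (Hpos s0); trivial; [lra|]. intros; apply Hin; lra.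
      - destruct (Hbar1 s0 A1) as [B1 B2]. specialize (Hvbar 1 s0 ltac:(lra) A2). lra. }
  assert (exists sc, sc <= s0 /\ th sc = PI / 2 /\ forall s, s < sc -> 0 < th s < PI / 2) as [sc [Hsc0 [Hsc Hin]]].
  { pose (a := Rmin (S1 - 1) (s1 - 1)). assert (Q1 := Rmin_l (S1 - 1) (s1 - 1)).
    assert (Q2 := Rmin_r (S1 - 1) (s1 - 1)). fold a in Q1, Q2.
    destruct (first_zero (fun s => cf alpha (th s)) a s1) as [sc [C1 [C2 C3]]]; [lra| | | |].
    - intros; apply Ccf.
    - apply cf_pos, Hstart. lra.
    - rewrite (cf_collision _ Hc1). lra.
    - assert (Hin : forall s, s < sc -> 0 < th s < PI / 2).
      { intros s Hs. destruct (Rlt_dec s a) as [L|L]; [apply Hstart; lra|].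
        apply not_collision; [apply Hrange|]. intros K. specialize (C3 s ltac:(lra)).
        rewrite (cf_collision _ K) in C3. lra. }
      exists sc. split; [lra|]. split; trivial.
      destruct (Hcf0 sc C2) as [E|E]; trivial. exfalso.
      assert (th a < th sc).
      { apply mono_lt; [lra|intros; now apply (th_continuous th v u)|].
        intros x Hx. exists (u x). split; [apply Ho|]. apply (Hpos sc); trivial; lra. }
      specialize (Hrange a). lra. }
  destruct (first_arc th v u Ho Habove sc Hlim) with (s := sc) as [_ [Aup Alow]]; [|lra|].
  { intros s Hs. split; [now apply Hin|]. now apply (Hpos sc). }
  assert (Hvsc : v sc <= - kappa (alpha := alpha)).
  { assert (K := Hvbar 1 sc). rewrite Hsc, height_PI2 in K. specialize (K ltac:(lra) Aup). lra. }
  assert (Hsc1 : sc < s0).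
  { destruct Hsc0 as [L|L]; trivial. rewrite L in Hvsc. lra. }
  destruct (collision_sign_PI2 th v u (sc - 1) (sc + 1) sc) as [e [He0 He]]; [lra|intros; apply Ho|trivial|].
  assert (Hneg : forall T, sc < T <= s0 -> (forall s, sc < s < T -> 0 < th s < PI / 2) ->
     forall s, sc < s < T -> u s < 0).
  { intros T HT Hin2 s Hs. pose (r := Rmin (e / 2) ((s - sc) / 2)).
    assert (Q1 := Rmin_l (e / 2) ((s - sc) / 2)). assert (Q2 := Rmin_r (e / 2) ((s - sc) / 2)).
    assert (Q3 : 0 < r) by (apply Rmin_pos; lra). fold r in Q1, Q2.
    apply (sign_neg u (sc + r) s); [lra|intros; apply Cu| |apply He; lra].
    intros x Hx. apply Hmove; [lra|apply Hin2; lra]. }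
  destruct (classic (exists s2, sc < s2 <= s0 /\ collision (th s2))) as [[s2 [Hs2 Hc2]]|Hnone].
  - (* a second collision would come too late *)
    exfalso.
    assert (exists s3, sc < s3 <= s0 /\ th s3 = 0 /\ forall s, sc < s < s3 -> 0 < th s < PI / 2) as [s3 [Hs3 [Eth Hin2]]].
    { pose (r := Rmin (e / 2) ((s2 - sc) / 2)).
      assert (Q1 := Rmin_l (e / 2) ((s2 - sc) / 2)). assert (Q2 := Rmin_r (e / 2) ((s2 - sc) / 2)).
      assert (Q3 : 0 < r) by (apply Rmin_pos; lra). fold r in Q1, Q2.
      assert (Hearly : forall s, sc < s <= sc + r -> 0 < th s < PI / 2).
      { intros s Hs. apply not_collision; [apply Hrange|]. intros K.
        assert (K1 := u_collision th v u s (Ho s) K). destruct (He (s - sc) ltac:(lra)) as [_ K2].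
        replace (sc + (s - sc)) with s in K2 by ring. lra. }
      destruct (first_zero (fun s => cf alpha (th s)) (sc + r) s2) as [s3 [C1 [C2 C3]]]; [lra| | | |].
      - intros; apply Ccf.
      - apply cf_pos, Hearly. lra.
      - rewrite (cf_collision _ Hc2). lra.
      - assert (Hin2 : forall s, sc < s < s3 -> 0 < th s < PI / 2).
        { intros s Hs. destruct (Rle_dec s (sc + r)) as [L|L]; [apply Hearly; lra|].
          apply not_collision; [apply Hrange|]. intros K. specialize (C3 s ltac:(lra)).
          rewrite (cf_collision _ K) in C3. lra. }
        exists s3. split; [lra|]. split; trivial.
        destruct (Hcf0 s3 C2) as [E|E]; trivial. exfalso.
        assert (th s3 < th sc); [|lra].
        cut (- th sc < - th s3); [lra|]. apply (mono_lt (fun s => - th s)); [lra| |].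
        + intros x _. apply: continuous_opp. now apply (th_continuous th v u).
        + intros x Hx. exists (- u x). split; [apply: is_derive_opp; apply Ho|].
          assert (u x < 0); [|lra]. apply (Hneg s3); trivial. lra. }
    destruct (second_arc th v u Ho Habove sc s3 Hsc Aup Alow) with (s := s3) as [_ Blow]; [|lra|].
    { intros s Hs. split; [now apply Hin2|]. apply (Hneg s3); trivial. }
    unfold gap_low in Blow. rewrite Eth in Blow.
    assert (K := lower_barrier_wins (alpha := alpha)). assert (Hq := ratio_bounds (alpha := alpha)).
    assert (K2 : ratio (alpha := alpha) * height (alpha := alpha) (- 1) 0 <= v s3 + c).
    { apply sqrt_le_0; try lra. specialize (Habove s3). lra. }
    specialize (Hvm s3 s0 ltac:(lra)). lra.
  - assert (Hin2 : forall s, sc < s <= s0 -> 0 < th s < PI / 2).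
    { intros s Hs. apply not_collision; [apply Hrange|]. intros K. apply Hnone. now exists s. }
    assert (Hneg0 : forall s, sc < s < s0 -> u s < 0).
    { apply (Hneg s0); [lra|]. intros; apply Hin2; lra. }
    assert (Hus0 : u s0 < 0).
    { apply (sign_neg u ((sc + s0) / 2) s0); [lra|intros; apply Cu| |apply Hneg0; lra].
      intros x Hx. apply Hmove; [lra|apply Hin2; lra]. }
    assert (Hths0 : th s0 < PI / 4); [|nra].
    (* as long as th > PI / 4 the gap between v and the barrier increases *)
    apply Rnot_le_lt. intros Hge.
    assert (Bup : forall s, sc < s <= s0 -> v s <= height (alpha := alpha) (- 1) (th s) - c).
    { intros s Hs. apply Hvbar; [left; apply height_m1_pos, Hrange|].
      apply (second_arc th v u Ho Habove sc s0 Hsc Aup Alow); trivial.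
      intros x Hx. split; [apply Hin2; lra|now apply Hneg0]. }
    assert (Hdec : forall s, sc <= s < s0 -> th s0 < th s).
    { intros s Hs. cut (- th s < - th s0); [lra|]. apply (mono_lt (fun s => - th s)); [lra| |].
      - intros x _. apply: continuous_opp. now apply (th_continuous th v u).
      - intros x Hx. exists (- u x). split; [apply: is_derive_opp; apply Ho|].
        specialize (Hneg0 x ltac:(lra)). lra. }
    assert (Hbneg : forall s, sc <= s <= s0 -> height (alpha := alpha) (- 1) (th s) - c <= 0).
    { intros s Hs. assert (PI / 4 <= th s).
      { destruct (Req_dec s s0) as [->|N]; trivial. specialize (Hdec s ltac:(lra)). lra. }
      unfold height. assert (Ha0 := alpha_bounds).
      assert (rpow (cos (th s)) (1 - alpha / 2) <= rpow (sin (th s)) (1 - alpha / 2)); [|nra].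
      apply rpow_le; [lra|]. rewrite <- (sin_compl (alpha := alpha)).
      specialize (Hrange s). apply sin_incr_1; lra. }
    assert (G : (height (alpha := alpha) (- 1) (th sc) - c) - v sc < (height (alpha := alpha) (- 1) (th s0) - c) - v s0).
    { apply (mono_lt (fun s => (height (alpha := alpha) (- 1) (th s) - c) - v s)); trivial.
      - intros x _. apply: continuous_minus; [|now apply (v_continuous th v u)].
        apply: continuous_minus; [|apply continuous_const].
        apply (continuous_comp th (height (alpha := alpha) (- 1))); [now apply (th_continuous th v u)|apply height_continuous].
      - intros x Hx. assert (Hi := Hin2 x ltac:(lra)). assert (Hux := Hneg0 x Hx).
        destruct (Ho x) as [O1 [O2 [O3 [O4 _]]]]. assert (Ha0 := alpha_bounds).
        set (w := velocity alpha (th x) (u x)) in *.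
        assert (Hw2 := velocity_sq _ _ _ Hi O2). fold w in Hw2. rewrite (U_sep (alpha := alpha)) in Hw2.
        assert (Huw := u_eq (th x) (u x) Hi). fold w in Huw. assert (Hg := gf_pos (th x) Hi).
        assert (Hw : w < 0) by nra.
        assert (Een := height_energy (- 1) (th x) Hi ltac:(ring)).
        assert (Hsl := slope_m1_pos (alpha := alpha) (th x) Hi).
        assert (Hfar : th x <> PI / 4) by (specialize (Hdec x ltac:(lra)); lra).
        assert (Eee := sep_gt (th x) Hi Hfar). assert (Htt := sep_min_ge_2 (alpha := alpha)).
        assert (B1 := Bup x ltac:(lra)). assert (B2 := Hbneg x ltac:(lra)).
        exists ((1 - alpha / 2) * (- u x) * (slope (alpha := alpha) (- 1) (th x) + w)). split.
        + eapply derive_minus; [|exact O4|].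
          * eapply derive_minus; [|apply: is_derive_const|reflexivity].
            eapply derive_comp; [apply derive_height; [exact Hi|ring]|exact O3|reflexivity].
          * rewrite (Rmult_assoc _ (sqrt _)), (sqrtW_Qf _ _ _ Hi O2). fold w. unfold zero; simpl.
            replace (gf alpha (th x) * (w * (w * 1))) with (u x * w) by (rewrite Huw; ring). ring.
        + assert (Hgap : c ^ 2 * (1 + sep (alpha := alpha) (th x)) / (1 + sep_min (alpha := alpha))
                         < c ^ 2 * sep (alpha := alpha) (th x) / sep_min (alpha := alpha)).
          { cut (0 < c ^ 2 * sep (alpha := alpha) (th x) / sep_min (alpha := alpha)
               - c ^ 2 * (1 + sep (alpha := alpha) (th x)) / (1 + sep_min (alpha := alpha))); [lra|].
            set (E := sep (alpha := alpha) (th x)) in *. set (T := sep_min (alpha := alpha)) in *.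
            replace (c ^ 2 * E / T - c ^ 2 * (1 + E) / (1 + T)) with (c ^ 2 * ((E - T) / (T * (1 + T)))) by (field; lra).
            apply Rmult_lt_0_compat; [nra|]. apply Rdiv_lt_0_compat; nra. }
          assert (w ^ 2 < slope (alpha := alpha) (- 1) (th x) ^ 2).
          { rewrite Hw2, Een. assert ((height (alpha := alpha) (- 1) (th x) - c) ^ 2 <= v x ^ 2) by nra. lra. }
          assert (0 < slope (alpha := alpha) (- 1) (th x) + w) by nra.
          apply Rmult_lt_0_compat; [nra|trivial]. }
    assert (Hsc2 : 0 <= (height (alpha := alpha) (- 1) (th sc) - c) - v sc).
    { rewrite Hsc, height_PI2. lra. }
    specialize (Hbneg s0 ltac:(lra)). lra.
Qed.

End NoConnection.

Section UnstableBranches.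
Context {alpha : R} {Ha : admissible alpha}.
Set Default Proof Using "All".

Local Notation c := (vc (alpha := alpha)).

Lemma crossing_sign (th v u : R -> R) (s0 : R) :
  (forall s, orbit_at alpha th v u s) -> (forall s, - c < v s) ->
  from_c_minus (alpha := alpha) th v -> v s0 = 0 ->
  0 < u s0 * (th s0 - PI / 4).
Proof.
  intros Ho Habove Hlim Hv0. assert (HPI := PI_RGT_0). assert (V := vc_pos (alpha := alpha)).
  assert (Cu : forall s, continuous u s) by now apply (orbit_u_continuous th v u).
  destruct (Hlim (Rmin c (PI / 8))) as [S HS]; [apply Rmin_pos; lra|].
  assert (Q1 := Rmin_l c (PI / 8)). assert (Q2 := Rmin_r c (PI / 8)).
  assert (Hn : forall s, s < S -> u s <> 0).
  { intros s Hs. destruct (HS s Hs) as [K1 K2]. apply Rabs_def2 in K1. specialize (Habove s).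
    apply (slow_moves th v u s (Ho s)); lra. }
  destruct (Rtotal_order (u (S - 1)) 0) as [L|[L|L]].
  - replace (u s0 * (th s0 - PI / 4)) with (- u s0 * ((PI / 2 - th s0) - PI / 4)) by field.
    apply (crossing_sign_rightward (fun s => PI / 2 - th s) v (fun s => - u s)); trivial.
    + intros s. now apply orbit_at_reflect.
    + intros e He. destruct (Hlim e He) as [S' HS']. exists S'. intros s Hs.
      destruct (HS' s Hs) as [K1 K2]. split; trivial.
      replace (PI / 2 - th s - PI / 4) with (- (th s - PI / 4)) by field. now rewrite Rabs_Ropp.
    + exists (S - 1). intros s Hs. cut (u s < 0); [lra|]. apply Rnot_le_lt. intros [K|K].
      * assert (0 < u (S - 1)); [|lra]. apply (sign_pos u s (S - 1)); [lra|intros; apply Cu| |trivial].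
        -- intros x Hx. apply Hn. lra.
      * apply (Hn s); [lra|now symmetry].
  - exfalso. apply (Hn (S - 1)); [lra|trivial].
  - apply (crossing_sign_rightward th v u); trivial. exists (S - 1). intros s Hs.
    apply Rnot_le_lt. intros [K|K].
    + assert (u (S - 1) < 0); [|lra]. apply (sign_neg u s (S - 1)); [lra|intros; apply Cu| |trivial].
      * intros x Hx. apply Hn. lra.
    + apply (Hn s); [lra|trivial].
Qed.

Lemma rest_orbit (s : R) : orbit_at alpha (fun _ => PI / 4) (fun _ => - c) (fun _ => 0) s.
Proof.
  assert (I := PI4_interior). assert (HQ : Qf alpha (PI / 4) (- c) = 0).
  { rewrite (Qf_interior _ _ I). replace ((- c) ^ 2) with (c ^ 2) by ring. rewrite vc_sq.
    assert (K := U_pos (alpha := alpha) (PI / 4)). field. lra. }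
  split; [lra|]. split; [rewrite HQ; ring|]. split; [apply: is_derive_const|]. split; [|split].
  - rewrite HQ, Rmult_0_r. apply: is_derive_const.
  - intros _. eapply derive_eq; [apply: is_derive_const|].
    rewrite velocity_eq, U'_PI4. unfold zero; simpl. unfold Rdiv at 3. ring.
  - intros K. exfalso. now apply (interior_not_collision _ I).
Qed.

(** The equilibrium is reached in no finite time: by uniqueness, an orbit that
    meets it rests there. *)
Lemma rest_forever (th v u : R -> R) (s0 s : R) :
  (forall s, orbit_at alpha th v u s) -> th s0 = PI / 4 -> v s0 = - c -> u s0 = 0 ->
  s0 <= s -> v s = - c.
Proof.
  intros Ho E1 E2 E3 Hs.
  destruct (dependence (fun _ => PI / 4) (fun _ => - c) (fun _ => 0) rest_orbit) as [h [Hh Hdep]].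
  pose (P s := th s = PI / 4 /\ v s = - c /\ u s = 0).
  assert (Hz : forall x y : R, (forall e, 0 < e -> Rabs (x - y) < e) -> x = y).
  { intros x y H. apply NNPP. intros N. assert (K : 0 < Rabs (x - y)) by (apply Rabs_pos_lt; lra).
    specialize (H _ K). lra. }
  assert (Hstep : forall s, P s -> P (s + h / 2)).
  { intros r [P1 [P2 P3]].
    assert (N : forall e, 0 < e -> near (PI / 4) (- c) 0 (th (r + h / 2)) (v (r + h / 2)) (u (r + h / 2)) e).
    { intros e He. destruct (Hdep (h / 2) ltac:(lra) e He) as [d [Hd K]].
      specialize (K (fun t => th (t + r)) (fun t => v (t + r)) (fun t => u (t + r))).
      rewrite (Rplus_comm r). apply K; [intros t; now apply orbit_at_shift|].
      unfold near. rewrite Rplus_0_l, P1, P2, P3, !Rminus_diag_eq, Rabs_R0 by trivial. auto. }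
    repeat split; apply Hz; intros e He; apply (N e He). }
  assert (Hn : forall n : nat, P (s0 + INR n * (h / 2))).
  { induction n as [|n IH]; [now rewrite Rmult_0_l, Rplus_0_r|].
    rewrite S_INR. replace (s0 + (INR n + 1) * (h / 2)) with (s0 + INR n * (h / 2) + h / 2) by ring.
    now apply Hstep. }
  destruct (INR_unbounded ((s - s0) / (h / 2))) as [n Hlarge].
  destruct (Hn n) as [_ [K _]]. assert (Hvm := v_mono th v u Ho).
  apply (Rmult_gt_compat_r (h / 2)) in Hlarge; [|lra].
  replace ((s - s0) / (h / 2) * (h / 2)) with (s - s0) in Hlarge by (field; lra).
  assert (K1 := Hvm s0 s Hs). assert (K2 := Hvm s (s0 + INR n * (h / 2)) ltac:(lra)). lra.
Qed.

Definition tends_to_c_minus (th v : R -> R) : Prop :=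
  forall e, 0 < e -> exists S, forall s, s < S ->
    Rabs (th s - PI / 4) < e /\ Rabs (v s + c) < e.

Lemma at_c_minus (x z : R) : 0 <= x <= PI / 2 -> z ^ 2 = cf alpha x * Qf alpha x (- c) ->
  Qf alpha x (- c) = 0 -> x = PI / 4 /\ z = 0.
Proof.
  intros Hx Hz HQ. rewrite HQ, Rmult_0_r in Hz.
  assert (Hi : 0 < x < PI / 2).
  { apply not_collision; trivial. intros K. unfold Qf in HQ.
    rewrite (cf_collision _ K) in HQ. unfold Rdiv in HQ. lra. }
  split; [|nra].
  apply NNPP. intros N. assert (K := U_min_strict x Hi N). rewrite (Qf_interior _ _ Hi) in HQ.
  assert (P := U_pos (alpha := alpha) x). assert (V := vc_sq (alpha := alpha)).
  replace ((- c) ^ 2) with (c ^ 2) in HQ by ring. rewrite V in HQ.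
  apply (Rmult_eq_compat_r (U alpha x)) in HQ.
  unfold Rdiv in HQ. rewrite Rmult_assoc, Rinv_l in HQ by lra. lra.
Qed.

(** Since [v] is monotone, it is not below its limit in the past, and if it
    equals it, then it has been constant until then, hence at a rest point. *)
Lemma c_minus_level (th v u : R -> R) (s : R) :
  (forall s, orbit_at alpha th v u s) -> tends_to_c_minus th v ->
  - c <= v s /\ (v s = - c -> th (s - 1) = PI / 4 /\ v (s - 1) = - c /\ u (s - 1) = 0).
Proof.
  intros Ho Hlim. assert (Hvm := v_mono th v u Ho).
  assert (Hge : forall s, - c <= v s).
  { intros t. apply Rnot_lt_le. intros K. destruct (Hlim (- c - v t)) as [S HS]; [lra|].
    destruct (HS (Rmin (S - 1) t)) as [_ L].
    - assert (Q := Rmin_l (S - 1) t). lra.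
    - assert (Q := Hvm (Rmin (S - 1) t) t (Rmin_r _ _)). apply Rabs_def2 in L. lra. }
  split; [apply Hge|]. intros E.
  assert (Hc : forall t, t <= s -> v t = - c).
  { intros t Ht. specialize (Hge t). specialize (Hvm t s Ht). lra. }
  destruct (Ho (s - 1)) as [O1 [O2 [_ [O4 _]]]].
  assert (D : is_derive v (s - 1) 0).
  { apply (is_derive_ext_loc (fun _ => - c)); [|apply: is_derive_const].
    apply (locally_of_lt _ (s - 2) s); [lra|]. intros t Ht. symmetry. apply Hc. lra. }
  rewrite (Hc (s - 1)) in O2, O4 by lra.
  assert (HQ : Qf alpha (th (s - 1)) (- c) = 0).
  { apply is_derive_unique in O4. apply is_derive_unique in D. rewrite D in O4.
    symmetry in O4. apply Rmult_integral in O4. destruct O4 as [O4|O4]; trivial. exfalso.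
    assert (HW := W_bounds _ O1). assert (P := sqrt_lt_R0 (W alpha (th (s - 1))) ltac:(lra)).
    assert (Ha0 := alpha_bounds). nra. }
  destruct (at_c_minus _ _ O1 O2 HQ) as [F1 F2].
  split; [|split]; trivial. apply Hc. lra.
Qed.

Lemma branch_above (th v u : R -> R) (s1 : R) :
  (forall s, orbit_at alpha th v u s) -> tends_to_c_minus th v -> - c < v s1 ->
  forall s, - c < v s.
Proof.
  intros Ho Hlim Hs1 s. destruct (c_minus_level th v u s Ho Hlim) as [[K|K] H]; trivial.
  destruct H as [F1 [F2 F3]]; [now symmetry|]. exfalso.
  destruct (Rle_dec (s - 1) s1) as [L|L].
  - rewrite (rest_forever th v u (s - 1) s1) in Hs1; trivial. lra.
  - assert (K1 := v_mono th v u Ho s1 (s - 1) ltac:(lra)). lra.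
Qed.

(** An orbit joining the two equilibria would cross the level [v = 0] with [u
    (th - PI / 4) > 0]; so would its time reversal, where this product has the
    opposite sign. *)
Lemma no_connection (th v u : R -> R) (s1 : R) :
  (forall s, orbit_at alpha th v u s) -> tends_to_c_minus th v -> - c < v s1 ->
  ~ (forall s, v s <= c).
Proof.
  intros Ho Hlim Hs1 HM. assert (V := vc_pos (alpha := alpha)). assert (V2 := vc_sq (alpha := alpha)).
  assert (Hvm := v_mono th v u Ho). assert (Habove := branch_above th v u s1 Ho Hlim Hs1).
  destruct (bounded_limit th v u c Ho HM) as [L1 [L2 _]]. rewrite <- V2 in L2.
  assert (L3 : forall e, 0 < e -> exists S, forall s, S < s -> Rabs (th s - PI / 4) < e /\ c - v s < e).
  { intros e He. destruct (L1 e He) as [S1 H1].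
    pose (d := v s1 + c). assert (Hd : 0 < d) by (unfold d; lra).
    destruct (L2 (e * d)) as [S2 H2]; [nra|].
    exists (Rmax S1 (Rmax S2 s1)). intros s Hs.
    assert (Q1 := Rmax_l S1 (Rmax S2 s1)). assert (Q2 := Rmax_r S1 (Rmax S2 s1)).
    assert (Q3 := Rmax_l S2 s1). assert (Q4 := Rmax_r S2 s1).
    split; [apply H1; lra|]. specialize (H2 s ltac:(lra)). apply Rabs_def2 in H2.
    assert (K := Hvm s1 s ltac:(lra)). specialize (HM s).
    apply Rnot_le_lt. intros N. assert (d <= c + v s) by (unfold d; lra). nra. }
  pose (th' s := th (- s)). pose (v' s := - v (- s)). pose (u' s := - u (- s)).
  assert (Ho' : forall s, orbit_at alpha th' v' u' s) by (intros s; now apply orbit_at_reverse).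
  assert (Hlim' : tends_to_c_minus th' v').
  { intros e He. destruct (L3 e He) as [S HS]. exists (- S). intros s Hs.
    destruct (HS (- s) ltac:(lra)) as [K1 K2]. split; [exact K1|]. unfold v'.
    specialize (HM (- s)). apply Rabs_def1; lra. }
  assert (Hz : exists s0, v s0 = 0).
  { destruct (Hlim c V) as [Sa Ka]. destruct (L3 c V) as [Sb Kb].
    pose (a := Rmin (Sa - 1) Sb). assert (A1 : a <= Sa - 1) by apply Rmin_l.
    assert (A2 : a <= Sb) by apply Rmin_r.
    destruct (Ka a ltac:(lra)) as [_ K1]. destruct (Kb (Sb + 1) ltac:(lra)) as [_ K2].
    apply Rabs_def2 in K1.
    destruct (first_zero (fun s => - v s) a (Sb + 1)) as [s0 [_ [E _]]]; try lra.
    - intros x _. apply: continuous_opp. now apply (v_continuous th v u).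
    - exists s0. lra. }
  destruct Hz as [s0 Hs0].
  assert (Hw : forall th v, tends_to_c_minus th v -> from_c_minus (alpha := alpha) th v).
  { intros th1 v1 H e He. destruct (H e He) as [S HS]. exists S. intros s Hs.
    destruct (HS s Hs) as [K1 K2]. apply Rabs_def2 in K2. split; trivial. lra. }
  assert (P1 := crossing_sign th v u s0 Ho Habove (Hw _ _ Hlim) Hs0).
  assert (P2 : 0 < u' (- s0) * (th' (- s0) - PI / 4)).
  { apply (crossing_sign th' v' u'); trivial.
    - apply (branch_above th' v' u' (- s0)); trivial. unfold v'. rewrite Ropp_involutive, Hs0. lra.
    - now apply Hw.
    - unfold v'. rewrite Ropp_involutive, Hs0. ring. }
  unfold u', th' in P2. rewrite !Ropp_involutive in P2. lra.
Qed.

Lemma Wu_c_minus_escapes (p : R * R * R) :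
  Wu_c_minus alpha p -> Ws alpha 0 p \/ Ws alpha (PI / 2) p.
Proof.
  intros [Hp [th [v [u [[Hio E] Hlim]]]]].
  assert (Ho := proj1 (is_orbit_iff th v u) Hio).
  assert (HL : tends_to_c_minus th v).
  { intros e He. specialize (Hlim (ball (c_minus alpha) e) (locally_ball _ (mkposreal e He))).
    destruct Hlim as [S HS]. exists S. intros s Hs. destruct (HS s Hs) as [[K1 K2] _].
    split; [exact K1|]. replace (v s + c) with (v s - - c) by ring. exact K2. }
  assert (exists s1, - c < v s1) as [s1 Hs1].
  { apply NNPP. intros N. apply Hp. rewrite <- E.
    destruct (c_minus_level th v u 1 Ho HL) as [K1 K2]. replace (1 - 1) with 0 in K2 by ring.
    destruct K2 as [F1 [F2 F3]]; [|unfold c_minus; now rewrite F1, F2, F3].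
    apply Rle_antisym; trivial. apply Rnot_lt_le. intros K. apply N. now exists 1. }
  destruct (classic (exists s, c < v s)) as [[s Hs]|N].
  - destruct (Rtotal_order (th s) (PI / 4)) as [L|[L|L]].
    + left. exists th, v, u. split; [now split|]. now apply (escape_0 th v u s).
    + exfalso. now apply (not_center_above th v u s).
    + right. exists th, v, u. split; [now split|]. now apply (escape_PI2 th v u s).
  - exfalso. apply (no_connection th v u s1); trivial.
    intros s. apply Rnot_lt_le. intros K. apply N. now exists s.
Qed.

End UnstableBranches.

Theorem proposition3p4 :
  forall alpha : R, 0 < alpha <= 1 ->
    (forall p : R * R * R,
       Wu_c_minus alpha p -> Ws alpha 0 p \/ Ws alpha (PI / 2) p) /\
    (forall eps sigma : R,
       eps = 0 \/ eps = 1 -> sigma = 0 \/ sigma = 1 ->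
       open_in (parabolic_manifold alpha)
         (fun p => Wu alpha (eps * PI / 2) p /\ Ws alpha (sigma * PI / 2) p)).
Proof.
  intros alpha Halpha. assert (Ha : admissible alpha) by exact Halpha.
  split; [exact Wu_c_minus_escapes|]. intros eps sigma Heps Hsigma.
  assert (Hc : forall e : R, e = 0 \/ e = 1 -> collision (e * PI / 2)).
  { intros e [-> | ->]; [left|right]; field. }
  apply Wu_Ws_open; now apply Hc.
Qed.
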